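(* Let $\{Z_n\}_{n\ge0}$ be the $d$-dimensional branching random walk described in the context, with offspring mean $m=1$, and suppose the offspring generating function satisfies $f(s)=s+(1-s)^{1+\beta}L(1-s)$ for $s\in[0,1]$, for some $\beta\in(0,\frac1d]$ and some function $L$ on $[0,1]$ slowly varying at $0+$ (i.e. $\lim_{s\to0+}L(sx)/L(s)=1$ for all $x\in(0,1]$). Suppose $\mathbb{E}[|X|^{\alpha}]<\infty$ for some $\alpha>(\beta+1)d$. Then for every $r>0$, $$\lim_{n\to\infty}\mathbb{P}\left(\frac{R_n}{b_n}\ge r\right)=\exp\left\{-v_d(r)(\beta^{-1})^{\beta^{-1}}\right\},$$ where $b_n:=\big[nL\big(\mathbb{P}_{\delta_0}(|Z_n|>0)\big)\big]^{\frac{1}{\beta d}}$, $\mathbb{P}_{\delta_0}(|Z_n|>0)$ is the probability that the branching random walk started from a single particle at the origin has at least one particle at generation $n$, and $v_d(r)=\frac{\pi^{d/2}r^d}{\Gamma(d/2+1)}$.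
   Context: Let $\{p_k\}_{k\ge0}$ be an offspring distribution on $\{0,1,2,\dots\}$ with $p_0<1$, $p_1<1$, mean $m=\sum_k kp_k$ and generating function $f(s)=\sum_k p_ks^k$. Let $X$ be an $\mathbb{R}^d$-valued random vector (the displacement) with mean zero whose components are i.i.d. The branching random walk $\{Z_n\}_{n\ge0}$: under $\mathbb{P}$, $Z_0$ is a Poisson random measure on $\mathbb{R}^d$ with Lebesgue intensity (under $\mathbb{P}_{\delta_0}$, $Z_0$ is a single particle at $0$); at each generation every particle independently is replaced by a random number of children with law $\{p_k\}$, each child independently displaced from its parent's position by an independent copy of $X$; $Z_n$ is the counting measure of particle positions at generation $n$ and $|Z_n|=Z_n(\mathbb{R}^d)$. Let $B(u)=\{x\in\mathbb{R}^d:|x|<u\}$ and $R_n:=\sup\{u>0:Z_n(B(u))=0\}$ (with $\sup\emptyset=0$). *)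

(* Defs.v *)
From HB Require Import structures.
From mathcomp Require Import all_boot all_order all_algebra.
From mathcomp Require Import all_classical all_reals all_analysis.
Set Implicit Arguments. Unset Strict Implicit. Unset Printing Implicit Defensive.
Import Order.TTheory GRing.Theory Num.Theory.
Import numFieldNormedType.Exports.
Local Open Scope classical_set_scope.
Local Open Scope ring_scope.

Definition Gamma (R : realType) (x : R) : R :=
  fine (\int[@lebesgue_measure R]_(t in [set t : R | (0 < t)%R])
          ((t `^ (x - 1) * expR (- t))%R%:E))%E.

Definition vol_ball (R : realType) (d : nat) (r : R) : R :=
  pi `^ (d%:R / 2) * r ^+ d / Gamma (d%:R / 2 + 1).

Definition eucl (R : realType) (d : nat) (x : 'I_d -> R) : R :=
  Num.sqrt (\sum_(i < d) x i ^+ 2).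

Definition ball0 (R : realType) (d : nat) (u : R) : set ('I_d -> R) :=
  [set x | eucl x < u].

Definition slowly_varying_at0 (R : realType) (L : R -> R) : Prop :=
  forall x : R, 0 < x <= 1 -> L (s * x) / L s @[s --> 0%R^'+] --> (1 : R).

Definition offspring_law (R : realType) (p : nat -> R) : Prop :=
  (forall k, 0 <= p k) /\ series p @ \oo --> (1 : R) /\ p 0%N < 1 /\ p 1%N < 1.

Definition mutually_independent {dT : measure_display} {T : measurableType dT}
  {R : realType} (P : probability T R) {I : eqType} (F : I -> set (set T)) : Prop :=
  forall (s : seq I), uniq s ->
  forall A : I -> set T, (forall i, i \in s -> F i (A i)) ->
    P (\bigcap_(i in [set` s]) A i) = (\prod_(i <- s) P (A i))%E.

Definition sigma_nat {T : Type} (Y : T -> nat) : set (set T) :=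
  [set B | exists A : set nat, B = Y @^-1` A].
Definition sigma_real {T : Type} {R : realType} (Y : T -> R) : set (set T) :=
  [set B | exists2 A : set R, measurable A & B = Y @^-1` A].

(* Labels:  z : 'rV[int]_d  indexes the unit cube z + [0,1)^d,
   j : nat indexes the j-th Poisson point of that cube,
   s : seq nat is an Ulam-Harris word (descendant of the initial particle). *)
Notation zd d := 'rV[int]_d.

Notation brw_index d :=
  (((zd d + (zd d * nat * 'I_d)%type)
    + ((zd d * nat * seq nat)%type + (zd d * nat * seq nat * 'I_d)%type))
   + (seq nat + (seq nat * 'I_d)%type))%type.

Definition alive (xi : seq nat -> nat) (s : seq nat) : bool :=
  all (fun k => (nth 0 s k < xi (take k s))%N) (iota 0 (size s)).

(* position of particle s relative to its ancestor: sum of the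
   displacements of s and of all its strict ancestors except the root *)
Definition disp_sum (R : realType) (d : nat) (X : seq nat -> 'I_d -> R)
  (s : seq nat) : 'I_d -> R :=
  fun i => \sum_(1 <= k < (size s).+1) X (take k s) i.

Section BRW.
Context {R : realType} {d : nat} {dT : measure_display} {T : measurableType dT}.
Variables (N : zd d -> T -> nat) (U : zd d -> nat -> 'I_d -> T -> R)
  (xi : zd d -> nat -> seq nat -> T -> nat) (Xd : zd d -> nat -> seq nat -> 'I_d -> T -> R)
  (xi0 : seq nat -> T -> nat) (Xd0 : seq nat -> 'I_d -> T -> R).

Definition brw_class (c : brw_index d) : set (set T) :=
  match c with
  | inl (inl (inl z)) => sigma_nat (N z)
  | inl (inl (inr (z, j, i))) => sigma_real (U z j i)
  | inl (inr (inl (z, j, s))) => sigma_nat (xi z j s)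
  | inl (inr (inr (z, j, s, i))) => sigma_real (Xd z j s i)
  | inr (inl s) => sigma_nat (xi0 s)
  | inr (inr (s, i)) => sigma_real (Xd0 s i)
  end.

Definition disp_var (c : ((zd d * nat * seq nat * 'I_d) + (seq nat * 'I_d))%type) : T -> R :=
  match c with
  | inl (z, j, s, i) => Xd z j s i
  | inr (s, i) => Xd0 s i
  end.

Definition init_pos (z : zd d) (j : nat) (w : T) : 'I_d -> R :=
  fun i => (z ord0 i)%:~R + U z j i w.

Definition brw_pos (z : zd d) (j : nat) (s : seq nat) (w : T) : 'I_d -> R :=
  fun i => init_pos z j w i + disp_sum (fun v k => Xd z j v k w) s i.

(* Z_n(B) under P (initial configuration = Poisson random measure) *)
Definition brwZ (n : nat) (B : set ('I_d -> R)) (w : T) : \bar R :=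
  \esum_(c in [set c : zd d * nat * seq nat |
      (c.1.2 < N c.1.1 w)%N /\ alive (fun v => xi c.1.1 c.1.2 v w) c.2
      /\ size c.2 = n /\ B (brw_pos c.1.1 c.1.2 c.2 w)]) 1%E.

(* R_n = sup {u > 0 : Z_n(B(u)) = 0}, with sup of the empty set = 0 *)
Definition brwR (n : nat) (w : T) : \bar R :=
  maxe 0%E (ereal_sup (EFin @` [set u : R | 0 < u /\ brwZ n (ball0 u) w = 0%E])).

(* |Z_n| for the branching random walk started from delta_0
   (offspring numbers xi0, displacements Xd0) *)
Definition brwZ0_total (n : nat) (w : T) : \bar R :=
  \esum_(s in [set s : seq nat | alive (fun v => xi0 v w) s /\ size s = n]) 1%E.

Definition brwZ0 (n : nat) (B : set ('I_d -> R)) (w : T) : \bar R :=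
  \esum_(s in [set s : seq nat | alive (fun v => xi0 v w) s /\ size s = n
                 /\ B (disp_sum (fun v k => Xd0 v k w) s)]) 1%E.

End BRW.

(* The probabilistic model: on (T, P) the variables
   - N z  (z in Z^d) : Poisson(1) number of initial points in cube z + [0,1)^d,
   - U z j i : i-th coordinate (uniform on [0,1)) of the j-th point in cube z,
   - xi z j s : number of children of particle s in the tree of (z, j), law p,
   - Xd z j s i : i-th component of the displacement of particle s from its parent,
   - xi0, Xd0 : same for the branching random walk started from delta_0,
   are mutually independent, and all displacement components are identically
   distributed with mean zero. *)
Definition is_brw_model {R : realType} {d : nat} {dT : measure_display}
  {T : measurableType dT} (P : probability T R) (p : nat -> R)
  (N : zd d -> T -> nat) (U : zd d -> nat -> 'I_d -> T -> R)
  (xi : zd d -> nat -> seq nat -> T -> nat) (Xd : zd d -> nat -> seq nat -> 'I_d -> T -> R)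
  (xi0 : seq nat -> T -> nat) (Xd0 : seq nat -> 'I_d -> T -> R) : Prop :=
  [/\
      (forall z k, measurable (N z @^-1` [set k]))
      /\ (forall z j s k, measurable (xi z j s @^-1` [set k]))
      /\ (forall s k, measurable (xi0 s @^-1` [set k]))
      /\ (forall z j i, measurable_fun setT (U z j i))
      /\ (forall c, measurable_fun setT (disp_var Xd Xd0 c)),
      (forall z k, P (N z @^-1` [set k]) = (expR (-1) / k`!%:R)%:E)
      /\ (forall z j i, P (U z j i @^-1` `[0, 1[%classic) = 1%E)
      /\ (forall z j i t, 0 <= t <= 1 -> P (U z j i @^-1` `]-oo, t]%classic) = t%:E)
      /\ (forall z j s k, P (xi z j s @^-1` [set k]) = (p k)%:E)
      /\ (forall s k, P (xi0 s @^-1` [set k]) = (p k)%:E),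
      (forall c c' A, measurable A ->
         P (disp_var Xd Xd0 c @^-1` A) = P (disp_var Xd Xd0 c' @^-1` A))
      /\ (forall c, P.-integrable setT (EFin \o disp_var Xd Xd0 c)
                    /\ ('E_P[disp_var Xd Xd0 c])%E = 0%E) &
      mutually_independent P (brw_class N U xi Xd xi0 Xd0)].

(* Main.v *)
Require Import Defs.
From HB Require Import structures.
From mathcomp Require Import all_boot all_order all_algebra.
From mathcomp Require Import all_classical all_reals all_analysis.
From mathcomp Require Import measurable_realfun ring lra.
Import Order.TTheory GRing.Theory Num.Theory.
Import numFieldNormedType.Exports.
Local Open Scope classical_set_scope.
Local Open Scope ring_scope.

(** The clusters of distinct initial points are independent and their number in each
    unit cube is Poisson, so the probability that [ball0 rho] is empty at generation
    [n] is a product over the cubes of terms [exp (- hit probability)].  From below,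
    the hit probability is at least the survival probability [q_n] times the
    probability that one tagged particle lies in the ball; from above, it is at most
    [q_n] times the probability that the ancestor starts in the ball of radius
    [(1 + eps) rho], plus the expected number of particles that travel further than
    [eps rho] and end in the ball (the expected population size being [1]).  Summed
    over the cubes, translation invariance of Lebesgue measure turns this into
    [exp (- (q_n vol ((1 + eps) rho) + P (|S_n| >= eps rho) vol rho)) <= P (void)
     <= exp (- q_n vol rho)], where [S_n] is the displacement of one particle.
    The recursion [q_(n+1) = q_n - q_n^(1+beta) L (q_n)] gives
    [n q_n^beta L (q_n) --> 1 / beta], hence [q_n b_n^d --> (1/beta)^(1/beta)], and a
    Fuk-Nagaev bound gives [b_n^d P (|S_n| >= eps b_n) --> 0] because
    [alpha > (beta + 1) d]. *)

(** * The recursion for the survival probabilities *)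

(** Convexity of [g] replaces its derivative: the increments [g (q n) - g (q n.+1)] are compared
    with chords whose endpoints are fixed multiples of [q n], where slow variation of [L] applies.
    Statements about $b_n$ are reduced to $q_n$: since $q_n b_n^d=(n q_n^\beta L(q_n))^{1/\beta}$,
    $b_n^d$ is traded for $1/q_n$, and [L] is absorbed by $n q_n^\theta\to0$ for every
    $\theta>\beta$. The one-jump term $n b_n^{d-\alpha}$ is then of order $n q_n^{(\alpha-d)/d}$,
    whose exponent exceeds $\beta$ exactly when $\alpha>(\beta+1)d$. The other Fuk-Nagaev term asks
    for an order $t=\min(\alpha,2)$ above $\beta d$; for $t=2$ this comes from $\beta d\le1$.
    Particles of one tree share ancestors, so their positions are dependent. Both hit bounds avoid
    these correlations: they use that genealogy and displacements are independent and that all words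
    of length [n] have the same displacement law. Lebesgue measure on $\mathbb{R}^d$ is built from
    the uniform points of the model, so sums over cubes are its values by construction; a Gaussian
    integral identifies its value on balls. *)

Section CriticalRecursion.
Context {R : realType}.
Variables (beta : R) (L g : R -> R) (q : nat -> R).
Hypothesis beta_gt0 : 0 < beta.
Hypothesis slow : slowly_varying_at0 L.
Hypothesis gE : forall s : R, 0 < s <= 1 -> g s = s `^ (1 + beta) * L s.
Hypothesis g0 : g 0 = 0.
Hypothesis g_gt0 : forall s, 0 < s <= 1 -> 0 < g s.
Hypothesis g_lt : forall s : R, 0 < s <= 1 -> g s < s.
Hypothesis g_conv : forall a b c : R, 0 <= a -> a < b -> b < c -> c <= 1 ->
  (g b - g a) * (c - b) <= (g c - g b) * (b - a).
Hypothesis q0 : q 0%N = 1.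
Hypothesis qS : forall n, q n.+1 = q n - g (q n).

Lemma recursion_itv n : 0 < q n <= 1.
Proof.
elim: n => [|n /andP[q1 q2]]; first by rewrite q0 ltr01 lexx.
have := g_lt (q n); have := g_gt0 (q n); rewrite q1 q2 qS => /(_ isT) ? /(_ isT) ?.
by apply/andP; split; lra.
Qed.

Let q_gt0 n : 0 < q n. Proof. by case/andP: (recursion_itv n). Qed.
Let q_le1 n : q n <= 1. Proof. by case/andP: (recursion_itv n). Qed.

(** Convexity at the three points [0 < s < t], with [g 0 = 0]. *)
Lemma chord_slope_le (s t : R) : 0 < s -> s <= t -> t <= 1 -> g s / s <= g t / t.
Proof.
move=> s0; rewrite le_eqVlt => /predU1P[->//|st] t1.
have := g_conv 0 s t (lexx _) s0 st t1; rewrite g0 !subr0 => H.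
rewrite ler_pdivrMr// mulrAC ler_pdivlMr; last exact: lt_trans s0 st.
lra.
Qed.

Lemma recursion_map_le (s t : R) : 0 < s -> s <= t -> t <= 1 -> g s <= g t.
Proof.
move=> s0 st t1.
have /g_gt0 gs : 0 < s <= 1 by rewrite s0 (le_trans st).
have := chord_slope_le s t s0 st t1.
rewrite ler_pdivrMr// mulrAC ler_pdivlMr; last exact: lt_le_trans s0 st.
nra.
Qed.

Lemma recursion_decr : {homo q : m n / (m <= n)%N >-> n <= m}.
Proof.
apply/nonincreasing_seqP => n; rewrite qS lerBlDr lerDl ltW//.
by apply: g_gt0; rewrite q_gt0 q_le1.
Qed.

(** A positive limit [l] would make every increment at most [- g l < 0], while increments of a
    convergent sequence tend to 0. Monotonicity of [g] does the work of continuity. *)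
Lemma recursion_cvg0 : q @ \oo --> (0 : R).
Proof.
have cq : cvgn q.
  apply: nonincreasing_is_cvgn; first by move=> m n; exact: recursion_decr.
  by exists 0 => _ [n _ <-]; exact: ltW.
have lq n : limn q <= q n.
  by apply: nonincreasing_cvgn_ge => // a b; exact: recursion_decr.
have l0 : 0 <= limn q by apply: limr_ge => //; apply: nearW => n; exact: ltW.
move: l0; rewrite le_eqVlt => /predU1P[l0|l0]; first by rewrite l0; exact: cq.
have c1 : q n.+1 - q n @[n --> \oo] --> (0 : R).
  rewrite -(subrr (limn q)); apply: cvgB; last exact: cq.
  by rewrite cvg_shiftS; exact: cq.
have l1 : limn q <= 1 by apply: le_trans (lq 0%N) _; rewrite q0.
have gl : 0 < g (limn q) by apply: g_gt0; rewrite l0.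
suff : 0 <= - g (limn q) by rewrite oppr_ge0 leNgt gl.
rewrite -(cvg_lim _ c1)//; apply: limr_le; first by apply/cvg_ex; exists 0.
apply: nearW => n; rewrite qS [_ - q n]addrC addKr lerN2.
exact: recursion_map_le.
Qed.

Let q_cvg0r : q @ \oo --> (0 : R)^'+.
Proof.
move=> A; rewrite /at_right/= => -[e /= e0 He].
have /cvgrPdist_lt/(_ e e0) := recursion_cvg0.
by apply: filterS => n /= nq; apply: He => //=; rewrite distrC in nq *; rewrite distrC.
Qed.

Let L_gt0 (s : R) : 0 < s <= 1 -> 0 < L s.
Proof.
move=> s01; have := g_gt0 s s01; rewrite gE// pmulr_rgt0// powR_gt0//.
by case/andP: s01.
Qed.

Let gratio (lam : R) : 0 < lam <= 1 ->
  g (q n * lam) / g (q n) @[n --> \oo] --> lam `^ (1 + beta).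
Proof.
move=> /[dup] lam01 /andP[l0 l1].
have := cvg_comp _ _ q_cvg0r (slow lam lam01) => /= H.
rewrite -[X in _ --> X]mulr1.
apply: cvg_trans; last by apply: (cvgM _ H); first exact: (cvg_cst (lam `^ (1 + beta))).
apply: near_eq_cvg; apply: nearW => n /=.
have qn := q_gt0 n; have qn1 := q_le1 n.
have ql : 0 < q n * lam <= 1 by rewrite mulr_gt0//= mulr_ile1// ltW.
have qn01 : 0 < q n <= 1 by rewrite qn.
rewrite (gE _ ql) (gE (q n))//.
rewrite powRM ?ltW//.
have /gt_eqF/negbT := L_gt0 _ qn01.
have /gt_eqF/negbT := powR_gt0 (1 + beta) qn.
by move=> ? ?; field; apply/andP.
Qed.

(** Slow variation is stated for factors at most 1, so it is applied at the base point [q n / lam],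
    which lies in []0, 1]] once [q n < lam]. *)
Let gratio' (lam : R) : 0 < lam < 1 ->
  g (q n / lam) / g (q n) @[n --> \oo] --> (lam `^ (1 + beta))^-1.
Proof.
move=> /andP[l0 l1].
have ql : (q n / lam) @[n --> \oo] --> (0 : R)^'+.
  move=> A; rewrite /at_right/= => -[e /= e0 He].
  have el : 0 < e * lam by rewrite mulr_gt0.
  have /cvgrPdist_lt/(_ _ el) := recursion_cvg0.
  apply: filterS => n /=; rewrite sub0r normrN gtr0_norm// => nq.
  apply: He => //=; last by rewrite divr_gt0.
  by rewrite sub0r normrN gtr0_norm ?divr_gt0// ltr_pdivrMr.
have lam01 : 0 < lam <= 1 by rewrite l0 ltW.
have lb : lam `^ (1 + beta) != 0 by rewrite gt_eqF// powR_gt0.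
have := cvg_comp _ _ ql (slow lam lam01) => /= H.

have H1 : lam `^ (1 + beta) * (L (q n / lam * lam) / L (q n / lam)) @[n --> \oo]
    --> lam `^ (1 + beta) * 1.
  by apply: (cvgM _ H); exact: cvg_cst.
rewrite mulr1 in H1; have H2 := cvgV lb H1.
apply: cvg_trans; last exact: H2.
apply: near_eq_cvg.
have /cvgrPdist_lt/(_ _ l0) := recursion_cvg0.
apply: filterS => n; rewrite sub0r normrN gtr0_norm// => qlam.
have qn := q_gt0 n.
have q1 : q n / lam <= 1 by rewrite ler_pdivrMr// mul1r ltW.
have q01 : 0 < q n / lam <= 1 by rewrite divr_gt0.
have qn01 : 0 < q n <= 1 by rewrite qn q_le1.
have lam0 : lam != 0 by rewrite gt_eqF.
have e1 : q n / lam * lam = q n by rewrite divfK.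
have e2 : q n `^ (1 + beta) = (q n / lam) `^ (1 + beta) * lam `^ (1 + beta).
  by rewrite -powRM ?(ltW l0)// ?e1// ltW// divr_gt0.
rewrite /unstable.inv_fun/= e1 (gE _ q01) (gE (q n))// e2.
have L1 := L_gt0 _ qn01; have L2 := L_gt0 _ q01.
have x0 : 0 < (q n / lam) `^ (1 + beta) by rewrite powR_gt0// divr_gt0.
by field; rewrite ?(gt_eqF x0) ?(gt_eqF L1) ?(gt_eqF L2) ?lb.
Qed.

(** The relative decrement of [q], equal to $q_n^\beta L(q_n)$; the asymptotics amount to $n
    h_n\to1/\beta$. *)
Let h n := g (q n) / q n.

Let h_gt0 n : 0 < h n.
Proof. by rewrite divr_gt0// g_gt0// q_gt0 q_le1. Qed.

(** [h] decreases to some [c], and then [g s / s >= c] on []0, 1]]. Evaluated at [q n / 2], regular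
    variation gives $c\le 2^{-\beta}c$, which excludes $c>0$. *)
Let h_cvg0 : h @ \oo --> (0 : R).
Proof.
have hdecr m n : (m <= n)%N -> h n <= h m.
  by move=> mn; apply: chord_slope_le => //; exact: recursion_decr.
have ch : cvgn h.
  apply: nonincreasing_is_cvgn => //.
  by exists 0 => _ [n _ <-]; exact: ltW.
have hl n : limn h <= h n by exact: nonincreasing_cvgn_ge.
have l0 : 0 <= limn h by apply: limr_ge => //; apply: nearW => n; exact: ltW.
move: l0; rewrite le_eqVlt => /predU1P[l0|l0]; first by rewrite l0; exact: ch.
have hlow s : 0 < s <= 1 -> limn h <= g s / s.
  move=> /andP[s0 s1]; have /cvgrPdist_lt/(_ _ s0) := recursion_cvg0.
  case=> N _ /(_ N (leqnn N)); rewrite sub0r normrN gtr0_norm// => qs.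
  by apply: le_trans (hl N) _; apply: chord_slope_le => //; exact: ltW.
have := gratio 2^-1; rewrite invr_gt0 ltr0n invf_le1 ?ler1n ?ltr0n// => /(_ isT) H.
have H1 : g (q n * 2^-1) / (q n / 2) @[n --> \oo] --> 2^-1 `^ (1 + beta) / 2^-1 * limn h.
  apply: cvg_trans; last by apply: (cvgM _ ch); apply: (cvgM H); exact: cvg_cst.
  apply: near_eq_cvg; apply: nearW => n /=; rewrite /h.
  have /gt_eqF/negbT := q_gt0 n.
  have /gt_eqF/negbT : 0 < g (q n) by rewrite g_gt0// q_gt0 q_le1.
  by move=> ? ?; field; apply/andP.
suff : limn h <= 2^-1 `^ (1 + beta) / 2^-1 * limn h.
  rewrite ler_pMl// powRD ?invr_eq0 ?pnatr_eq0// ?implybT//.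
  rewrite powRr1 ?invr_ge0// mulrAC divff// mul1r.
  rewrite leNgt -[X in _ < X](powRr0 2^-1) => /negP[].
  rewrite /powR invr_eq0 pnatr_eq0/= ltr_expR ltr_nM2r//.
  by rewrite ln_lt0// invr_gt0 ltr0n/= invf_lt1// ltr1n.
rewrite -(cvg_lim _ H1)//; apply: limr_ge; first by apply/cvg_ex; eexists; exact: H1.
apply: nearW => n; apply: hlow; have := q_gt0 n; have := q_le1 n => ? ?.
by apply/andP; split; lra.
Qed.

Let D n := (g (q n) - g (q n.+1)) / g (q n).

(** Both quotients are difference quotients of $x^{1+\beta}$ at 1, towards [lam] and towards
    [lam^-1], so they are close to the derivative $1+\beta$. *)
Let slope_lim (e : R) : 0 < e -> exists2 lam : R, 0 < lam < 1 &
  1 + beta - e < (1 - lam `^ (1 + beta)) / (1 - lam) /\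
  ((lam `^ (1 + beta))^-1 - 1) / (lam^-1 - 1) < 1 + beta + e.
Proof.
move=> e0.
have d1 (x : R^o) : is_derive (1 : R^o) 1 (fun a => a `^ x : R^o) x.
  split; first by apply: derivable_powR; rewrite in_itv/= ltr01.
  by rewrite -derive1E powR_derive1 ?in_itv/= ?ltr01// powR1 mulr1.
have [dr dv] := d1 (1 + beta).
have : (((fun a => a `^ (1 + beta)) (t + 1) - 1) / t) @[t --> 0^'] --> 1 + beta.
  move: dr => /cvg_ex[l Hl]; move: dv; rewrite /derive (cvg_lim _ Hl)// => lE.
  move: Hl; rewrite lE.
  move=> H; apply: cvg_trans H; apply: near_eq_cvg.
  by apply: nearW => t /=; rewrite powR1 /GRing.scale/= mulr1 mulrC.
move=> /cvgrPdist_lt/(_ _ e0); rewrite /at_left => -[d /= d0 Hd].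
have [l l01 [Hl1 Hl2]] : exists2 l : R, 0 < l < 1 & (1 - l < d) /\ l^-1 - 1 < d.
  (* With this [l], [l^-1 - 1] is half of [Num.min d 1], and [1 - l] is no larger, so both
     increments are within [d]. *)
  exists (1 + Num.min d 1 / 2)^-1.
    rewrite invr_gt0 invf_lt1; case: (ltrP d 1) => ?; lra.
  rewrite invrK; have : 0 < Num.min d 1 by rewrite lt_min d0 ltr01.
  have : Num.min d 1 <= d by rewrite ge_min lexx.
  set m := Num.min d 1 => md m0; split; last by lra.
  have m1 : 0 < 1 + m / 2 by lra.
  have : 1 - m / 2 <= (1 + m / 2)^-1 by rewrite -[leRHS]mul1r ler_pdivlMr//; nra.
  by lra.
case/andP: l01 => l0 l1; exists l; first by rewrite l0.
have lb : 0 < l `^ (1 + beta) by exact: powR_gt0.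
split.
- have /Hd : ball (0 : R^o) d (l - 1) by rewrite /ball/= sub0r normrN distrC gtr0_norm; lra.
  move=> /(_ _); rewrite subr_eq0 lt_eqF// => /(_ isT).
  rewrite subrK => /(le_lt_trans (ler_norm _)).
  have -> : (l `^ (1 + beta) - 1) / (l - 1) = (1 - l `^ (1 + beta)) / (1 - l).
    by rewrite -[l - 1]opprB -[l `^ _ - 1]opprB invrN mulrNN.
  by lra.
- have li1 : 1 < l^-1 by rewrite invf_gt1.
  have /Hd : ball (0 : R^o) d (l^-1 - 1) by rewrite /ball/= sub0r normrN gtr0_norm; lra.
  move=> /(_ _); rewrite subr_eq0 gt_eqF// => /(_ isT).
  rewrite subrK distrC => /(le_lt_trans (ler_norm _)).
  rewrite -[l^-1 `^ _]/(_) -(powR_inv1 (ltW l0)) -powRrM mulN1r powRN (powR_inv1 (ltW l0)).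
  by lra.
Qed.

(** As [q n - q n.+1 = g (q n)], this quotient is the slope of [g] over [[q n.+1, q n]] divided by
    [g (q n) / q n]. By convexity that slope lies between the chord slopes over [[lam * q n, q n]]
    and [[q n, q n / lam]], whose normalised limits are those of [slope_lim]. The condition
    [h n < 1 - lam] places [q n.+1] above [lam * q n]. *)
Let Dh_cvg : D n / h n @[n --> \oo] --> 1 + beta.
Proof.
apply/cvgrPdist_lt => e e0.
have e20 : 0 < e / 2 by rewrite divr_gt0.
have [lam /[dup] lam01 /andP[l0 l1] [H1 H2]] := slope_lim _ e20.
have lam01' : 0 < lam <= 1 by rewrite l0 ltW.
have A1 : (1 - g (q n * lam) / g (q n)) / (1 - lam) @[n --> \oo] -->
    (1 - lam `^ (1 + beta)) / (1 - lam).
  apply: cvgM; last exact: cvg_cst.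
  by apply: cvgB; [exact: cvg_cst|exact: gratio].
have B1 : (g (q n / lam) / g (q n) - 1) / (lam^-1 - 1) @[n --> \oo] -->
    ((lam `^ (1 + beta))^-1 - 1) / (lam^-1 - 1).
  apply: cvgM; last exact: cvg_cst.
  by apply: cvgB; [exact: gratio'|exact: cvg_cst].
move/cvgrPdist_lt : A1 => /(_ _ e20) A1.
move/cvgrPdist_lt : B1 => /(_ _ e20) B1.
have l10 : 0 < 1 - lam by lra.
have /cvgrPdist_lt/(_ _ l10) H3 := h_cvg0.
have /cvgrPdist_lt/(_ _ l0) H4 := recursion_cvg0.
near=> n.
have : `|0 - h n| < 1 - lam by near: n.
rewrite sub0r normrN gtr0_norm// => hn.
have : `|0 - q n| < lam by near: n.
rewrite sub0r normrN gtr0_norm// => qn.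
have gq : 0 < g (q n) by apply: g_gt0; rewrite q_gt0 q_le1.
have li : 0 < lam^-1 - 1 by rewrite subr_gt0 invf_gt1.
have ltqS : q n * lam < q n.+1.
  by move: hn; rewrite /h qS ltr_pdivrMr//; lra.
have ltqS' : q n.+1 < q n by rewrite qS; lra.
have ltq : q n < q n / lam by rewrite ltr_pdivlMr// gtr_pMr.
have leq1 : q n / lam <= 1 by rewrite ler_pdivrMr// mul1r ltW.
have C1 := g_conv _ _ _ (ltW (mulr_gt0 (q_gt0 n) l0)) ltqS ltqS' (q_le1 n).
have C2 := g_conv _ _ _ (ltW (q_gt0 n.+1)) ltqS' ltq leq1.
have LB : (1 - g (q n * lam) / g (q n)) / (1 - lam) <= D n / h n.
  have -> : D n / h n = (g (q n) - g (q n.+1)) * q n / g (q n) / g (q n).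
    by rewrite /D /h; field; rewrite !gt_eqF.
  have -> : (1 - g (q n * lam) / g (q n)) / (1 - lam) =
     ((g (q n) - g (q n * lam)) / (1 - lam)) / g (q n).
    by field; rewrite !gt_eqF.
  rewrite ler_pM2r ?invr_gt0// ler_pdivrMr// mulrAC ler_pdivlMr//.
  by move: C1; rewrite qS; lra.
have UB : D n / h n <= (g (q n / lam) / g (q n) - 1) / (lam^-1 - 1).
  have -> : D n / h n = (g (q n) - g (q n.+1)) * q n / g (q n) / g (q n).
    by rewrite /D /h; field; rewrite !gt_eqF.
  have -> : (g (q n / lam) / g (q n) - 1) / (lam^-1 - 1) =
     ((g (q n / lam) - g (q n)) / (lam^-1 - 1)) / g (q n).
    move: li; set y := lam^-1 - 1 => li.
    by field; rewrite (gt_eqF gq) (gt_eqF li).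
  rewrite ler_pM2r ?invr_gt0// ler_pdivrMr// mulrAC ler_pdivlMr//.
  by move: C2; rewrite qS; lra.
have : `|(1 - lam `^ (1 + beta)) / (1 - lam) -
   (1 - g (q n * lam) / g (q n)) / (1 - lam)| < e / 2 by near: n; exact: A1.
move=> /(le_lt_trans (ler_norm _)) H5.
have : `|((lam `^ (1 + beta))^-1 - 1) / (lam^-1 - 1) -
   (g (q n / lam) / g (q n) - 1) / (lam^-1 - 1)| < e / 2 by near: n; exact: B1.
rewrite distrC => /(le_lt_trans (ler_norm _)) H6.
by rewrite ltr_norml; apply/andP; split; lra.
Unshelve. all: by end_near. Qed.

(** The increment equals [(D n / h n - 1) / (1 - D n)] exactly, and [D n] tends to 0. *)
Let inv_h_incr : (h n.+1)^-1 - (h n)^-1 @[n --> \oo] --> beta.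
Proof.
have D0 : D n @[n --> \oo] --> (0 : R).
  have : D n / h n * h n @[n --> \oo] --> (1 + beta) * 0.
    exact: (cvgM Dh_cvg h_cvg0).
  rewrite mulr0; apply: cvg_trans.
  apply: near_eq_cvg; apply: nearW => n /=.
  by rewrite divfK// gt_eqF.
have H : (D n / h n - 1) / (1 - D n) @[n --> \oo] --> (1 + beta - 1) / (1 - 0).
  apply: cvgM; first by apply: cvgB => //; exact: cvg_cst.
  apply: cvgV; first by rewrite subr0 oner_eq0.
  by apply: cvgB => //; exact: cvg_cst.
rewrite subr0 divr1 addrC addKr in H.
apply: cvg_trans H; apply: near_eq_cvg; apply: nearW => n /=.
have gq : 0 < g (q n) by apply: g_gt0; rewrite q_gt0 q_le1.
have gq' : 0 < g (q n.+1) by apply: g_gt0; rewrite q_gt0 q_le1.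
have e1 := qS n; have qn := q_gt0 n; have qn' := q_gt0 n.+1.
rewrite /D /h; move: gq gq' qn qn' e1.
move: (g (q n)) => G; move: (g (q n.+1)) => G'; move: (q n.+1) => y; move: (q n) => x.
move=> G0 G'0 x0 y0 ye.
have -> : 1 - (G - G') / G = G' / G by field; rewrite gt_eqF.
by rewrite ye in y0 *; field; rewrite (gt_eqF G0) (gt_eqF G'0) ?(gt_eqF x0) ?(gt_eqF y0).
Qed.

(** By Cesaro, [(h n)^-1 / n] has the same limit [beta] as the increments of [(h n)^-1]. *)
Let nh_cvg : n%:R * h n @[n --> \oo] --> beta^-1.
Proof.
have := cesaro inv_h_incr; rewrite /arithmetic_mean/= => H.
have {}H : ((h n.+1)^-1 - (h 0%N)^-1) / n.+1%:R @[n --> \oo] --> beta.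
  apply: cvg_trans H; apply: near_eq_cvg; apply: nearW => n /=.
  by rewrite seriesEnat/= telescope_sumr// mulrC.
have H1 : (h 0%N)^-1 / n.+1%:R @[n --> \oo] --> (0 : R).
  rewrite -[X in _ --> X](mulr0 (h 0%N)^-1).
  by apply: cvgM; [exact: cvg_cst|exact: cvg_harmonic].
have {}H : ((h n.+1)^-1 - (h 0%N)^-1) / n.+1%:R + (h 0%N)^-1 / n.+1%:R
    @[n --> \oo] --> beta + 0 by exact: cvgD.
have {}H : (((h n.+1)^-1 - (h 0%N)^-1) / n.+1%:R + (h 0%N)^-1 / n.+1%:R)^-1
    @[n --> \oo] --> beta^-1.
  by apply: cvgV; [rewrite gt_eqF|rewrite addr0 in H].
rewrite -(cvg_shiftS (fun n => n%:R * h n)).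
apply: cvg_trans H; apply: near_eq_cvg; apply: nearW => n /=.
by rewrite -mulrDl subrK invfM !invrK mulrC.
Qed.

Lemma recursion_asymptotics : n%:R * (q n `^ beta * L (q n)) @[n --> \oo] --> beta^-1.
Proof.
apply: cvg_trans nh_cvg; apply: near_eq_cvg; apply: nearW => n /=.
congr (_ * _); rewrite /h gE ?q_gt0 ?q_le1// powRD ?(gt_eqF (addr_gt0 ltr01 beta_gt0))//.
by rewrite (powRr1 (ltW (q_gt0 n))); field; rewrite gt_eqF.
Qed.

(** For [c] strictly between [theta^-1] and [beta^-1], eventually [h n >= c / n], so $n^c q_n$ is
    eventually nonincreasing: $q_{n+1}\le q_n e^{-c/n}$ and $(n+1)^c\le n^c e^{c/n}$. Hence
    $q_n=O(n^{-c})$ with $c\theta>1$. *)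
Lemma recursion_small theta : beta < theta ->
  n%:R * q n `^ theta @[n --> \oo] --> (0 : R).
Proof.
move=> bt; have t0 : 0 < theta by exact: lt_trans bt.
have itb : theta^-1 < beta^-1 by rewrite ltf_pV2.
have it0 : 0 < theta^-1 by rewrite invr_gt0.
pose c := (theta^-1 + beta^-1) / 2.
have tc : theta^-1 < c by rewrite /c; lra.
have c0 : 0 < c by exact: lt_trans tc.
have cb : 0 < beta^-1 - c by rewrite /c; lra.
have /cvgrPdist_lt/(_ _ cb)[N _ HN] := nh_cvg.
have hc n : (N.+1 <= n)%N -> c / n%:R <= h n.
  move=> Nn; have /HN/= : (N <= n)%N by exact: ltnW.
  move=> /(le_lt_trans (ler_norm _)) H.
  have n0 : (0 : R) < n%:R by rewrite ltr0n (leq_trans _ Nn).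
  by rewrite ler_pdivrMr//; lra.
pose v n := n%:R `^ c * q n.
have vS n : (N.+1 <= n)%N -> v n.+1 <= v n.
  move=> Nn; have n0 : (0 : R) < n%:R by rewrite ltr0n (leq_trans _ Nn).
  have e1 : q n.+1 <= q n * expR (- (c / n%:R)).
    rewrite qS; have -> : q n - g (q n) = q n * (1 - h n).
      by rewrite /h; field; rewrite gt_eqF.
    rewrite ler_pM2l//; apply: le_trans (expR_ge1Dx _) _.
    by rewrite ler_expR lerN2 hc.
  have e2 : n.+1%:R `^ c <= n%:R `^ c * expR (c / n%:R).
    have -> : n.+1%:R = n%:R * (1 + n%:R^-1) :> R.
      by rewrite -natr1; field; rewrite gt_eqF.
    rewrite powRM ?ler0n// ?addr_ge0 ?invr_ge0//.
    rewrite ler_pM2l ?powR_gt0// [c / _]mulrC expRM.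
    apply: ge0_ler_powR; [exact: ltW|by rewrite nnegrE addr_ge0 ?invr_ge0|
      by rewrite nnegrE expR_ge0|exact: expR_ge1Dx].
  rewrite /v; apply: le_trans (ler_pM _ _ e2 e1) _; [exact: powR_ge0|exact: ltW|].
  by rewrite mulrACA expRN divff ?mulr1// gt_eqF// expR_gt0.
have vle m : (N.+1 <= m)%N -> v m <= v N.+1.
  elim: m => // m IH; rewrite leq_eqVlt => /predU1P[->//|Nm].
  exact: le_trans (vS m Nm) (IH Nm).
have v0 : 0 <= v N.+1 by rewrite mulr_ge0 ?powR_ge0 ?ltW.
have ct : 0 < c * theta - 1 by rewrite subr_gt0 -ltr_pdivrMr// mul1r.
have inv0 : n.+1%:R^-1 @[n --> \oo] --> (0 : R)^'+.
  move=> A; rewrite /at_right/= => -[e /= e0 He].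
  have /cvgrPdist_lt/(_ e e0) := @cvg_harmonic R.
  apply: filterS => n /= nq; apply: He => //=.
have H0 : v N.+1 `^ theta * (n.+1%:R^-1 `^ (c * theta - 1)) @[n --> \oo] --> (0 : R).
  rewrite -[X in _ --> X](mulr0 (v N.+1 `^ theta)).
  apply: cvgM; first exact: cvg_cst.
  exact: (cvg_comp _ _ inv0 (powR_cvg0 ct)).
rewrite -(cvg_shiftS (fun n => n%:R * q n `^ theta)).
apply: (squeeze_cvgr _ (cvg_cst 0) H0); exists N => // n /= Nn.
rewrite mulr_ge0 ?powR_ge0//=.
have n0 : (0 : R) < n.+1%:R by rewrite ltr0n.
have nc : n.+1%:R `^ c != 0 :> R by rewrite gt_eqF// powR_gt0.
have -> : q n.+1 = v n.+1 * (n.+1%:R^-1 `^ c).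
  by rewrite /v -(powR_inv1 (ltW n0)) -powRrM mulN1r powRN mulrAC divff// mul1r.
have vn : 0 <= v n.+1 by rewrite mulr_ge0 ?powR_ge0 ?(ltW (q_gt0 _)).
rewrite (powRM _ vn (powR_ge0 _ _)) mulrCA.
apply: ler_pM; rewrite ?powR_ge0 ?mulr_ge0 ?powR_ge0//.
  by apply: ge0_ler_powR; rewrite ?nnegrE//; [exact: ltW|exact: vle].
rewrite -powRrM -(powR_inv1 (ltW n0)) -!powRrM -[X in X * _ <= _](powRr1 (ltW n0)).
rewrite -powRD; last by rewrite (gt_eqF n0) implybT.
by rewrite le_eqVlt; apply/orP; left; apply/eqP; congr (_ `^ _); lra.
Qed.

End CriticalRecursion.

(** * Grouping of independent families *)

Section BigcapSeq.
Context {T : Type} {I : eqType}.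
Implicit Types (A : I -> set T) (s : seq I).

Lemma bigcap_nil A : \bigcap_(i in [set` [::]]) A i = setT.
Proof. by apply/seteqP; split. Qed.

Lemma bigcap_cons A i s :
  \bigcap_(j in [set` i :: s]) A j = A i `&` \bigcap_(j in [set` s]) A j.
Proof.
apply/seteqP; split => w /=.
  by move=> H; split => [|j js]; apply: H; rewrite /= inE ?eqxx// js orbT.
by move=> [Ai As] j /=; rewrite inE => /predU1P[->//|]; exact: As.
Qed.

Lemma bigcap_cat A s t : \bigcap_(j in [set` s ++ t]) A j =
  \bigcap_(j in [set` s]) A j `&` \bigcap_(j in [set` t]) A j.
Proof.
elim: s => [|i s IH]; first by rewrite bigcap_nil setTI.
by rewrite cat_cons !bigcap_cons IH setIA.
Qed.

End BigcapSeq.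

Section Independence.
Context {R : realType} {dT : measure_display} {T : measurableType dT}.
Variable P : probability T R.

(** The finite measures $P(\cdot\cap B)$ and $P(B)P(\cdot)$ agree on the pi-system [G]. *)
Lemma pi_system_independent (G : set (set T)) (B : set T) :
  G `<=` measurable -> setI_closed G -> G setT -> measurable B ->
  (forall A, G A -> P (A `&` B) = (P A * P B)%E) ->
  forall A, <<s G >> A -> P (A `&` B) = (P A * P B)%E.
Proof.
move=> Gm GI GT mB H A GA.
have PB0 : 0 <= fine (P B) by rewrite fine_ge0.
have PBf : P B \is a fin_num by rewrite fin_num_measure.
have cov : \bigcup_(k in [set: nat]) (fun=> setT : set T) k = setT.
  by apply/seteqP; split => // w _; exists 0%N.
have U := @g_sigma_algebra_measure_unique _ R T G Gm (fun=> setT) (fun=> GT) cov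
  (mrestr P mB) (mscale (NngNum PB0) P) GI.
have /= := U _ _ A GA; rewrite /mrestr /mscale/= fineK// muleC; apply.
- by move=> C /H ->; rewrite muleC.
- by move=> _; rewrite setTI ltey_eq PBf.
Qed.

Context {I : eqType}.
Variable F : I -> set (set T).
Hypothesis Fm : forall i, F i `<=` measurable.
Hypothesis FI : forall i, setI_closed (F i).
Hypothesis FT : forall i, F i setT.
Hypothesis Find : mutually_independent P F.

Definition group_gen (J : set I) : set (set T) := \bigcup_(i in J) F i.

Lemma group_gen_measurable J : group_gen J `<=` measurable.
Proof. by move=> A [i _ /Fm]. Qed.

Lemma group_sigma_measurable J A : <<s group_gen J >> A -> measurable A.
Proof.
apply: smallest_sub; last exact: group_gen_measurable.
exact: sigma_algebra_measurable.
Qed.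

Lemma group_sigma_sub J K : J `<=` K -> <<s group_gen J >> `<=` <<s group_gen K >>.
Proof.
move=> JK; apply: sub_smallest2r; first exact: smallest_sigma_algebra.
by move=> A [i Ji Fi]; exists i => //; exact: JK.
Qed.

(** Finite cylinders: [group_gen J] is not closed under intersection, whereas these are, and they
    generate the same sigma-algebra. *)
Let cyl J : set (set T) := [set B | exists s : seq I, exists A : I -> set T,
  [/\ uniq s, (forall i, i \in s -> J i /\ F i (A i)) &
      B = \bigcap_(i in [set` s]) A i]].

Let cylT J : cyl J setT.
Proof.
exists [::], (fun=> setT); split=> //.
by apply/seteqP; split.
Qed.

Let cylI J : setI_closed (cyl J).
Proof.
move=> _ _ [s1 [A1 [u1 H1 ->]]] [s2 [A2 [u2 H2 ->]]].
(* The two families are merged index by index, with [setT] for an absent index, so that each index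
   occurs once, as mutual independence requires. *)
exists (undup (s1 ++ s2)),
  (fun i => (if i \in s1 then A1 i else setT) `&` (if i \in s2 then A2 i else setT)).
split; first exact: undup_uniq.
- move=> i; rewrite mem_undup mem_cat => i12; split.
    by case/orP: i12 => [/H1[]|/H2[]].
  apply: FI; first by case: ifPn => [/H1[]|_].
  by case: ifPn => [/H2[]|_].
- apply/seteqP; split => w /=.
    move=> [w1 w2] i /=; rewrite mem_undup mem_cat => i12.
    by split; case: ifPn => // ii; [apply: w1|apply: w2].
  move=> w12; split => i /= ii.
    by have [] := w12 i; rewrite /= ?mem_undup ?mem_cat ii ?orbT.
  by have [] := w12 i; rewrite /= ?mem_undup ?mem_cat ii ?orbT.
Qed.

Let cyl_sub J : cyl J `<=` <<s group_gen J >>.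
Proof.
move=> _ [s [A [_ H ->]]].
elim: s H => [|i s IH] H.
  have -> : \bigcap_(i in [set` [::]]) A i = setT by apply/seteqP; split.
  exact: (@measurableT _ (g_sigma_algebraType (group_gen J))).
rewrite bigcap_cons.
apply: (@measurableI _ (g_sigma_algebraType (group_gen J))).
  by apply: sub_sigma_algebra; exists i; apply H; rewrite mem_head.
by apply: IH => j js; apply: H; rewrite inE js orbT.
Qed.

Let cyl_gen J : <<s group_gen J >> `<=` <<s cyl J >>.
Proof.
apply: sub_smallest2r; first exact: smallest_sigma_algebra.
move=> A [i Ji Fi]; exists [:: i], (fun=> A); split => //.
  by move=> j; rewrite inE => /eqP ->.
by rewrite bigcap_cons bigcap_nil setIT.
Qed.

Let cyl_measurable J : cyl J `<=` measurable.
Proof. by move=> A /cyl_sub; exact: group_sigma_measurable. Qed.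

(** Uniqueness is used twice: with a cylinder over [K] fixed, the cylinder over [J] is extended to
    the generated sigma-algebra; then [A] is fixed and the other side is extended. *)
Lemma group_independent2 J K A B : J `&` K = set0 ->
  <<s group_gen J >> A -> <<s group_gen K >> B -> P (A `&` B) = (P A * P B)%E.
Proof.
move=> JK JA KB.
have step1 C : cyl K C -> P (A `&` C) = (P A * P C)%E.
  move=> KC; apply: (@pi_system_independent (cyl J)) => //.
  - exact: cyl_measurable KC.
  - move=> {JA}{}A [s1 [A1 [u1 H1 ->]]].
    case: KC => s2 [A2 [u2 H2 ->]].
    have s12 i : i \in s1 -> i \in s2 -> False.
      move=> /H1[Ji _] /H2[Ki _].
      by have : (J `&` K) i by []; rewrite JK.
    pose A0 i := if i \in s1 then A1 i else A2 i.
    have E1 : \bigcap_(i in [set` s1]) A1 i = \bigcap_(i in [set` s1]) A0 i.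
      by apply: eq_bigcapr => i /= i1; rewrite /A0 i1.
    have E2 : \bigcap_(i in [set` s2]) A2 i = \bigcap_(i in [set` s2]) A0 i.
      apply: eq_bigcapr => i /= i2; rewrite /A0; case: ifPn => // i1.
      by case: (s12 i).
    have I0 i : i \in s1 ++ s2 -> F i (A0 i).
      rewrite mem_cat /A0; case: ifPn => [/H1[]//|_ /=]; by move=> /H2[].
    rewrite E1 E2 (Find _ u1); last by move=> i i1; apply: I0; rewrite mem_cat i1.
    rewrite (Find _ u2); last by move=> i i1; apply: I0; rewrite mem_cat i1 orbT.
    rewrite -big_cat/= -Find//.
      by rewrite bigcap_cat.
    rewrite cat_uniq u1 u2 andbT/=; apply/hasPn => i i2; apply/negP => i1.
    exact: s12 i1 i2.
  - exact: cyl_gen.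
rewrite setIC muleC.
apply: (@pi_system_independent (cyl K)) => //.
- exact: group_sigma_measurable JA.
- by move=> C KC; rewrite setIC muleC; exact: step1.
- exact: cyl_gen.
Qed.

Lemma group_independent (K : eqType) (J : K -> set I) (s : seq K) (A : K -> set T) :
  uniq s -> {in s &, forall k l, k != l -> J k `&` J l = set0} ->
  (forall k, k \in s -> <<s group_gen (J k) >> (A k)) ->
  P (\bigcap_(k in [set` s]) A k) = (\prod_(k <- s) P (A k))%E.
Proof.
elim: s => [|k s IH] /=.
  by move=> _ _ _; rewrite big_nil bigcap_nil probability_setT.
move=> /andP[ks us] Jd HA.
rewrite big_cons bigcap_cons.
rewrite (@group_independent2 (J k) (\bigcup_(l in [set` s]) J l)).
- rewrite IH//; last by move=> l ls; apply: HA; rewrite inE ls orbT.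
  by move=> i j i1 j1; apply: Jd; rewrite inE ?i1 ?j1 orbT.
- rewrite setI_bigcupr bigcup0// => l /= ls.
  apply: Jd; rewrite ?inE ?eqxx ?ls ?orbT//.
  by apply/negP => /eqP kl; rewrite kl ls in ks.
- by apply: HA; rewrite mem_head.
- pose G := group_gen (\bigcup_(l in [set` s]) J l).
  have Hs l : l \in s -> <<s G >> (A l).
    move=> ls; apply: (@group_sigma_sub (J l)); first exact: bigcup_sup.
    by apply: HA; rewrite inE ls orbT.
  rewrite -/G; move: (G) Hs => G'; elim: (s) => [|l t IHt] Ht.
    by rewrite bigcap_nil; exact: (@measurableT _ (g_sigma_algebraType G')).
  rewrite bigcap_cons; apply: (@measurableI _ (g_sigma_algebraType G')).
    by apply: Ht; rewrite mem_head.
  by apply: IHt => j jt; apply: Ht; rewrite inE jt orbT.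
Qed.

Section decoupling.
Variables (J K : set I).
Hypothesis JK : J `&` K = set0.
Local Notation TJ := (g_sigma_algebraType (group_gen J)).
Local Notation TK := (g_sigma_algebraType (group_gen K)).

Let mJ : measurable_fun setT (idfun : T -> TJ).
Proof. by move=> _ A JA; rewrite setTI; exact: group_sigma_measurable JA. Qed.
Let mK : measurable_fun setT (idfun : T -> TK).
Proof. by move=> _ A JA; rewrite setTI; exact: group_sigma_measurable JA. Qed.
Let mD : measurable_fun setT (fun w : T => (w : TJ, w : TK)).
Proof. exact: (measurable_fun_pair mJ mK). Qed.
Let idJ : {mfun T >-> TJ} := HB.pack (idfun : T -> TJ) (isMeasurableFun.Build _ _ _ _ _ mJ).
Let idK : {mfun T >-> TK} := HB.pack (idfun : T -> TK) (isMeasurableFun.Build _ _ _ _ _ mK).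
Let idD : {mfun T >-> (TJ * TK)%type} :=
  HB.pack (fun w : T => (w : TJ, w : TK)) (isMeasurableFun.Build _ _ _ _ _ mD).

(** The diagonal map into the product of the two sub-sigma-algebras has the product law, by
    independence. Tonelli then lets the second argument be read from an independent copy [v] of the
    sample point. *)
Lemma decoupling (H : TJ * TK -> \bar R) :
  measurable_fun setT H -> (forall x, 0 <= H x)%E ->
  (\int[P]_w H (w, w) = \int[P]_w \int[P]_v H (w, v))%E.
Proof.
move=> mH H0.
transitivity (\int[distribution P idD]_z H z)%E.
  by rewrite ge0_integral_distribution.
transitivity (\int[distribution P idJ \x distribution P idK]_z H z)%E.
  apply: eq_measure_integral => A mA _.
  apply/esym; apply: product_measure_unique => // B C mB mC.
  rewrite /= /pushforward/= -(group_independent2 _ _ _ _ JK mB mC).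
  by congr (P _).
rewrite fubini_tonelli1//.
rewrite ge0_integral_distribution//.
- apply: eq_integral => w _ /=; rewrite /fubini_F.
  rewrite ge0_integral_distribution//.
  exact: measurableT_comp mH (pair1_measurable _).
- exact: measurable_fun_fubini_tonelli_F.
- by move=> w; apply: integral_ge0.
Qed.

Lemma expectation_mul (f : TJ -> \bar R) (g : TK -> \bar R) :
  measurable_fun setT f -> measurable_fun setT g ->
  (forall w, 0 <= f w)%E -> (forall w, 0 <= g w)%E ->
  (\int[P]_w (f w * g w) = \int[P]_w f w * \int[P]_w g w)%E.
Proof.
move=> mf mg f0 g0.
rewrite (@decoupling (fun z => f z.1 * g z.2)%E).
- have mf' : measurable_fun setT (f : T -> \bar R).
    exact: (measurableT_comp mf mJ).
  have mg' : measurable_fun setT (g : T -> \bar R).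
    exact: (measurableT_comp mg mK).
  rewrite -ge0_integralZr//; last exact: integral_ge0.
  by apply: eq_integral => w _ /=; rewrite ge0_integralZl.
- apply: emeasurable_funM; first exact: measurableT_comp mf measurable_fst.
  exact: measurableT_comp mg measurable_snd.
- by move=> x; rewrite mule_ge0.
Qed.

End decoupling.

Lemma expectation_prod (K : eqType) (J : K -> set I) (s : seq K) (f : K -> T -> R) :
  uniq s -> {in s &, forall k l, k != l -> J k `&` J l = set0} ->
  (forall k, k \in s ->
     measurable_fun setT (f k : g_sigma_algebraType (group_gen (J k)) -> R)) ->
  (forall k w, 0 <= f k w) ->
  (\int[P]_w (\prod_(k <- s) f k w)%:E = \prod_(k <- s) \int[P]_w (f k w)%:E)%E.
Proof.
move=> + + + f0; elim: s => [|k s IH] /=.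
  move=> _ _ _; under eq_integral do rewrite big_nil.
  by rewrite big_nil integral_cst//= mul1e probability_setT.
move=> /andP[ks us] Jd Hf.
under eq_integral do rewrite big_cons EFinM.
pose M := \bigcup_(l in [set` s]) J l.
have Msub l : l \in s -> J l `<=` M by move=> ls; exact: bigcup_sup.
rewrite (@expectation_mul (J k) M _ (fun w => (f k w)%:E)
  (fun w => (\prod_(k <- s) f k w)%:E)).
- rewrite big_cons IH//; last by move=> l ls; apply: Hf; rewrite inE ls orbT.
  by move=> i j i1 j1; apply: Jd; rewrite inE ?i1 ?j1 orbT.
- rewrite setI_bigcupr bigcup0// => l /= ls.
  apply: Jd; rewrite ?inE ?eqxx ?ls ?orbT//.
  by apply/negP => /eqP kl; rewrite kl ls in ks.
- by apply/measurable_EFinP; apply: Hf; rewrite mem_head.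
- apply/measurable_EFinP.
  have Hs l : l \in s -> measurable_fun setT (f l : g_sigma_algebraType (group_gen M) -> R).
    move=> ls _ A mA; apply: (@group_sigma_sub (J l)); first exact: Msub.
    by apply: Hf => //; rewrite inE ls orbT.
  elim: (s) Hs => [|l t IHt] Ht.
    by under eq_fun do rewrite big_nil; exact: measurable_cst.
  under eq_fun do rewrite big_cons.
  apply: measurable_funM; first by apply: Ht; rewrite mem_head.
  by apply: IHt => j jt; apply: Ht; rewrite inE jt orbT.
- by move=> w; rewrite lee_fin.
- by move=> w; rewrite lee_fin prodr_ge0.
Qed.

End Independence.

(** * Product sigma-algebra over a finite index type and uniqueness of product laws *)

Section FiniteLaws.
Context {R : realType} {K : finType}.

Definition boxes : set (set (K -> R)) :=
  [set B | exists2 A : K -> set R, (forall k, measurable (A k)) &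
     B = [set x | forall k, A k (x k)]].

Lemma boxesT : boxes setT.
Proof. by exists (fun=> setT) => //; apply/seteqP; split. Qed.

Lemma boxesI : setI_closed boxes.
Proof.
move=> _ _ [A mA ->] [B mB ->]; exists (fun k => A k `&` B k).
  by move=> k; exact: measurableI.
apply/seteqP; split => x /=; first by move=> [xA xB] k.
by move=> xAB; split=> k; have [] := xAB k.
Qed.

Lemma measurable_coord k :
  measurable_fun setT ((fun x => x k) : g_sigma_algebraType boxes -> R).
Proof.
move=> _ A mA; rewrite setTI; apply: sub_sigma_algebra.
exists (fun l => if l == k then A else setT); first by move=> l; case: ifP.
apply/seteqP; split => x /=; first by move=> xA l; case: eqP => // ->.
by move=> /(_ k); rewrite eqxx.
Qed.

Lemma boxes_preimage d (T : measurableType d) (V : K -> T -> R) A :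
  [set w | forall k, A k (V k w)] = \big[setI/setT]_(k : K) V k @^-1` A k.
Proof.
rewrite -bigcap_seq; apply/seteqP; split => w /=; first by move=> H k _; exact: H.
by move=> H k; apply: H; rewrite /= mem_index_enum.
Qed.

Lemma measurable_tuple_fun d (T : measurableType d) (V : K -> T -> R) :
  (forall k, measurable_fun setT (V k)) ->
  measurable_fun setT ((fun w k => V k w) : T -> g_sigma_algebraType boxes).
Proof.
move=> mV; apply: (@measurability _ _ T (g_sigma_algebraType boxes) setT _ boxes (erefl _)) => _ [_ [A mA ->] <-].
rewrite setTI (_ : _ @^-1` _ = \big[setI/setT]_(k : K) V k @^-1` A k); last exact: boxes_preimage.
apply: bigsetI_measurable => k _.
by rewrite -[X in measurable X]setTI; exact: mV.
Qed.

(** Independent coordinates with equal marginals give equal probabilities to all boxes, a generating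
    pi-system. This will transport joint laws from any particle to a reference particle. *)
Lemma law_unique d (T : measurableType d) (P : probability T R) (V W : K -> T -> R) :
  (forall k, measurable_fun setT (V k)) -> (forall k, measurable_fun setT (W k)) ->
  (forall A, (forall k, measurable (A k)) ->
     P (\big[setI/setT]_(k : K) V k @^-1` A k) = \prod_(k : K) P (V k @^-1` A k))%E ->
  (forall A, (forall k, measurable (A k)) ->
     P (\big[setI/setT]_(k : K) W k @^-1` A k) = \prod_(k : K) P (W k @^-1` A k))%E ->
  (forall k A, measurable A -> P (V k @^-1` A) = P (W k @^-1` A)) ->
  forall B, <<s boxes >> B ->
  P [set w | B (fun k => V k w)] = P [set w | B (fun k => W k w)].
Proof.
move=> mV mW iV iW VW B mB.
pose fV : {mfun T >-> g_sigma_algebraType boxes} :=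
  HB.pack ((fun w k => V k w) : T -> g_sigma_algebraType boxes)
   (isMeasurableFun.Build _ _ _ _ _ (measurable_tuple_fun _ _ _ mV)).
pose fW : {mfun T >-> g_sigma_algebraType boxes} :=
  HB.pack ((fun w k => W k w) : T -> g_sigma_algebraType boxes)
   (isMeasurableFun.Build _ _ _ _ _ (measurable_tuple_fun _ _ _ mW)).
apply: (@g_sigma_algebra_measure_unique _ R (g_sigma_algebraType boxes) boxes _
  (fun=> setT) (fun=> boxesT) _ (distribution P fV) (distribution P fW) boxesI) => //.
- exact: sub_sigma_algebra.
- by rewrite bigcup_const//; exists 0%N.
- move=> _ [A mA ->].
  transitivity (P [set w | forall k, A k (V k w)]); first by [].
  transitivity (P [set w | forall k, A k (W k w)]); last by [].
  rewrite !boxes_preimage iV// iW//; apply: eq_bigr => k _; exact: VW.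
- by move=> _; rewrite ltey_eq fin_num_measure.
Qed.

End FiniteLaws.

(** * Lebesgue measure as the intensity of a uniformly jittered lattice *)

Section CountableSums.
Context {R : realType}.
Local Open Scope ereal_scope.

(** Turns sums over countable labels into series over codes, where monotone convergence is
    available; a natural number that codes no label contributes 0. *)
Lemma esum_pickle (I : countType) (a : I -> \bar R) : (forall i, 0 <= a i) ->
  \esum_(i in [set: I]) a i = \sum_(k <oo) oapp a 0 (pickle_inv k).
Proof.
move=> a0; have b0 k : 0 <= oapp a 0 (@pickle_inv I k) by case: pickle_inv => /=.
rewrite nneseries_esumT//.
have Ha i : a i = oapp a 0 (@pickle_inv I (pickle i)) by rewrite pickleK_inv.
under eq_esum do rewrite Ha.
rewrite -(esum_image [set: I] pickle (fun k => oapp a 0 (pickle_inv k))); last first.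
  by move=> i j _ _ /(pcan_inj pickleK_inv).
rewrite esum_mkcond; apply: eq_esum => k _; case: ifPn => //.
rewrite notin_setE/= => Hk; have := @pickle_invK I k.
by case: (pickle_inv k) => //= i ik; exfalso; apply: Hk; exists i.
Qed.

(** One inequality holds on finite subsums; for finite positive [x] the other is the same inequality
    with factor [x^-1]. The values 0 and [+oo] are treated apart. *)
Lemma esumZl (I : choiceType) (S : set I) (x : \bar R) (a : I -> \bar R) :
  0 <= x -> (forall i, 0 <= a i) ->
  \esum_(i in S) (x * a i) = x * \esum_(i in S) a i.
Proof.
move=> x0 a0.
have le1 y (b : I -> \bar R) : 0 <= y -> (forall i, 0 <= b i) ->
    \esum_(i in S) (y * b i) <= y * \esum_(i in S) b i.
  move=> y0 b0; apply: ge_ereal_sup => _ [A [fA AS] <-].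
  rewrite -ge0_mule_fsumr//; apply: lee_wpmul2l => //.
  by apply: ereal_sup_ubound; exists A.
apply/eqP; rewrite eq_le le1//=.
case: x x0 => [x| |//] x0.
- have [{}x0|x_le0] := ltrP 0%R x; last first.
    have -> : x = 0%R by apply/eqP; rewrite eq_le x_le0 -lee_fin.
    by rewrite mul0e esum_ge0// => i _; rewrite mul0e.
  have -> : \esum_(i in S) a i = \esum_(i in S) (x^-1%:E * (x%:E * a i)).
    by apply: eq_esum => i _; rewrite muleA -EFinM mulVf ?mul1e// gt_eqF.
  apply: (@le_trans _ _ (x%:E * (x^-1%:E * \esum_(i in S) (x%:E * a i)))).
    apply: lee_wpmul2l; first by rewrite lee_fin ltW.
    apply: le1; first by rewrite lee_fin invr_ge0 ltW.
    by move=> i; rewrite mule_ge0// lee_fin ltW.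
  by rewrite muleA -EFinM divff ?mul1e// gt_eqF.
- have [H|] := pselect (forall i, S i -> a i = 0).
    by rewrite esum1// mule0 esum_ge0// => i Si; rewrite H// mule0.
  move=> /existsNP[i /not_implyP[Si /eqP ai]].
  apply: (@le_trans _ _ +oo); first exact: leey.
  apply: esum_ge; exists [set i]; first by split => // _ ->.
  by rewrite fsbig_set1 gt0_mulye// lt0e ai a0.
Qed.

Lemma esum_prod_row (d : nat) (a : 'I_d -> int -> \bar R) : (forall i m, 0 <= a i m) ->
  \esum_(z in [set: 'rV[int]_d]) \prod_(i < d) a i (z ord0 i) =
  \prod_(i < d) \esum_(m in [set: int]) a i m.
Proof.
elim: d a => [|d IH] a a0.
  have -> : [set: 'rV[int]_0] = [set 0%R].
    by apply/seteqP; split => z // _; apply/rowP => -[].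
  by rewrite esum_set1 ?big_ord0.
pose e (p : int * 'rV[int]_d) : 'rV[int]_(1 + d) := row_mx (const_mx p.1) p.2.
have be : set_bij [set: int * 'rV[int]_d] [set: 'rV[int]_(1 + d)] e.
  split => //.
  - move=> [m z] [m' z'] _ _ /= /eq_row_mx[/rowP/(_ ord0)].
    by rewrite !mxE/= => -> ->.
  - move=> z _; exists (z ord0 (lshift d ord0), rsubmx z) => //.
    rewrite /e/= -[RHS]hsubmxK; congr row_mx.
    by apply/rowP => j; rewrite !mxE (ord1 j).
rewrite (reindex_esum _ _ _ _ be).
have p0 (z : 'rV[int]_d) : 0 <= \prod_(i < d) a (lift ord0 i) (z ord0 i).
  by apply: prode_ge0.
transitivity (\esum_(p in [set: int] `*`` (fun=> [set: 'rV[int]_d]))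
    a ord0 p.1 * \prod_(i < d) a (lift ord0 i) (p.2 ord0 i)).
  rewrite (_ : _ `*`` _ = setT); last by apply/seteqP; split.
  apply: eq_esum => -[m z] _; rewrite big_ord_recl /e/=; congr (_ * _).
    have E0 : row_mx (const_mx m : 'rV_1) z ord0 (lshift d ord0) = m.
      by rewrite row_mxEl mxE.
    by rewrite -[in RHS]E0; congr (a _ (row_mx _ _ _ _)); exact/val_inj.
  apply: eq_bigr => i _.
  have E1 : row_mx (const_mx m : 'rV_1) z ord0 (rshift 1 i) = z ord0 i.
    by rewrite row_mxEr.
  by rewrite -E1; congr (a _ (row_mx _ _ _ _)); exact/val_inj.
rewrite -(@esum_esum _ _ _ [set: int] (fun=> setT) (fun (m : int) (z : 'rV[int]_d) => a ord0 m * \prod_(i < d) a (lift ord0 i) (z ord0 i))).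
  rewrite big_ord_recl -IH//.
  under eq_esum do rewrite esumZl//.
  under eq_esum do rewrite muleC.
  by rewrite esumZl ?esum_ge0// muleC.
by move=> m z _ _; rewrite mule_ge0.
Qed.

End CountableSums.

Section SumLaw.
Context {R : realType} {dT : measure_display} {T : measurableType dT}.
Variable P : probability T R.

Definition image_measure {d1 d2} {T1 : measurableType d1} {T2 : measurableType d2}
    (mu : {measure set T1 -> \bar R}) {f : T1 -> T2} (mf : measurable_fun setT f) :
    {measure set T2 -> \bar R} :=
  measure_function_pushforward__canonical__measure_function_Measure mu mf.

Context {Z : countType} {dY : measure_display} {Y : measurableType dY}.
Variable V : Z -> T -> Y.
Hypothesis mV : forall z, measurable_fun setT (V z).

(** The intensity measure of the random points [V z]: the expected number of them in a set. As a
    series of image measures it is a measure by construction. *)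
Definition sum_law : {measure set Y -> \bar R} :=
  mseries (fun k => if pickle_inv k is Some z then image_measure P (mV z) else mzero) 0.

Lemma sum_lawE (A : set Y) :
  sum_law A = (\esum_(z in [set: Z]) P (V z @^-1` A))%E.
Proof.
rewrite esum_pickle; last by [].
rewrite /sum_law /= /mseries; apply: eq_eseriesr => k _.
by case: pickle_inv.
Qed.

Lemma integral_sum_law (f : Y -> \bar R) : measurable_fun setT f ->
  (forall y, 0 <= f y)%E ->
  (\int[sum_law]_y f y = \esum_(z in [set: Z]) \int[P]_w f (V z w))%E.
Proof.
move=> mf f0; rewrite esum_pickle; last by move=> z; exact: integral_ge0.
rewrite ge0_integral_measure_series//; apply: eq_eseriesr => k _.
case: pickle_inv => [z|] /=; last by rewrite integral_measure_zero.
by rewrite ge0_integral_pushforward.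
Qed.

End SumLaw.

Section Lebesgue1.
Context {R : realType}.
Local Notation lam := (@lebesgue_measure R).

Lemma lebesgue_affine (a c : R) (A : set R) : 0 < a -> measurable A ->
  (lam A = a%:E * lam ((fun x => a * x + c)%R @^-1` A))%E.
Proof.
move=> a0 mA.
have mf : measurable_fun setT (fun x : R => a * x + c).
  by apply: measurable_funD => //; exact: measurable_funM.
apply: (@lebesgue_measure_unique R (mscale (NngNum (ltW a0))
  (@image_measure R _ _ (measurableTypeR R) (measurableTypeR R) lam _ mf))) => // _ [[u v] _ <-].
rewrite -[RHS]/(a%:E * lam ((fun x => a * x + c)%R @^-1` `]u, v]%classic))%E.
rewrite (_ : _ @^-1` _ = `](u - c) / a, (v - c) / a]%classic); last first.
  apply/seteqP; split => x /=; rewrite !in_itv/=.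
    move=> /andP[ux xv]; rewrite ltr_pdivrMr// ler_pdivlMr//.
    by apply/andP; split; lra.
  rewrite ltr_pdivrMr// ler_pdivlMr// => /andP[? ?].
  by apply/andP; split; lra.
rewrite !lebesgue_measure_itv/= !lte_fin ltr_pM2r ?invr_gt0// ltrD2r.
case: ifPn => // _; last by rewrite mule0.
rewrite -!EFinD -EFinM; congr (_%:E); field.
by rewrite gt_eqF.
Qed.

Context {dT : measure_display} {T : measurableType dT}.
Variables (P : probability T R) (U : T -> R).
Hypothesis mU : measurable_fun setT U.
Hypothesis U_unif : forall t, 0 <= t <= 1 -> P (U @^-1` `]-oo, t]%classic) = t%:E.

Let mpre (A : set R) : measurable A -> measurable (U @^-1` A).
Proof. by move=> mA; rewrite -[X in measurable X]setTI; exact: mU. Qed.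

(** The distribution function is given on [[0, 1]] only; monotonicity of [P] supplies the values
    outside. Open half-lines are the generating pi-system. *)
Lemma uniform_law (A : set R) : measurable A ->
  P (U @^-1` A) = lam (A `&` `]0, 1]%classic).
Proof.
move=> mA; have m01 : measurable (`]0, 1]%classic : set R) by [].
have := @g_sigma_algebra_measure_unique _ R (measurableTypeR R) (@RGenOInfty.G R) _
   (fun n => `]- n%:R, +oo[%classic) _ _ (@image_measure R _ _ T (measurableTypeR R) P _ mU) (mrestr lam m01).
have Gn (n : nat) : (@RGenOInfty.G R) (`](- n%:R : R), +oo[%classic) by exists (- n%:R).
apply => //.
- by move=> _ [x ->].
- apply/seteqP; split => // x _; exists (Num.trunc `|x|).+1 => //=.
  rewrite in_itv/= andbT ltrNl; apply: le_lt_trans (truncnS_gt _).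
  by rewrite -normrN ler_norm.
- move=> _ _ [x ->] [y ->]; exists (Num.max x y).
  apply/seteqP; split => w /=; rewrite !in_itv/= !andbT gt_max.
    by move=> [-> ->].
  by move=> /andP[].
- move=> _ [x ->].
  rewrite -[LHS]/(P (U @^-1` `]x, +oo[%classic)).
  rewrite -[RHS]/(lam (`]x, +oo[%classic `&` `]0, 1]%classic)).
  have -> : `]x, +oo[ `&` `]0, 1] = `](Num.max x 0), 1]%classic :> set R.
    apply/seteqP; split => w /=; rewrite !in_itv/= !andbT gt_max.
      by move=> [-> ].
    by move=> /andP[/andP[-> ->] ->].
  rewrite lebesgue_measure_itv/= lte_fin.
  have -> : U @^-1` `]x, +oo[ = ~` (U @^-1` `]-oo, x]).
    by apply/seteqP; split => w /=; rewrite !in_itv/= andbT ltNge; move/negP.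
  rewrite probability_setC; last exact: mpre.
  have [x0|x0] := ltrP x 0.
    rewrite ltr01 (_ : P _ = 0)%E ?sube0//.
    have P0 : P (U @^-1` `]-oo, 0]%classic) = 0%E by rewrite U_unif ?lexx ?ler01.
    apply/eqP; rewrite -measure_le0.
    apply: (@le_trans _ _ (P (U @^-1` `]-oo, 0]%classic))); last by rewrite P0.
    apply: le_measure; rewrite ?inE; [exact: mpre|exact: mpre|].
    by move=> w /=; rewrite !in_itv/= => /le_trans; apply; exact: ltW.
  have [x1|x1] := ltrP x 1; first by rewrite U_unif ?x0 ?ltW.
  rewrite (_ : P _ = 1)%E ?subee//.
  apply/eqP; rewrite eq_le probability_le1/=; last exact: mpre.
  have P1 : P (U @^-1` `]-oo, 1]%classic) = 1%E by rewrite U_unif ?lexx ?ler01.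
  apply: (@le_trans _ _ (P (U @^-1` `]-oo, 1]%classic))); first by rewrite P1.
  apply: le_measure; rewrite ?inE; [exact: mpre|exact: mpre|].
  by move=> w /=; rewrite !in_itv/= => /le_trans; apply.
- move=> k; rewrite ltey_eq; apply/orP; left.
  exact: (fin_num_measure P _ (mpre _ (measurable_itv _))).
- have : (@RGenOInfty.G R).-sigma.-measurable A by rewrite -RGenOInfty.measurableE.
  exact.
Qed.

Let mUm (m : int) : @measurable_fun _ _ T (measurableTypeR R) setT (fun w => m%:~R + U w).
Proof. exact: measurable_funD. Qed.

(** [m + U] is uniform on the unit interval at [m], and these intervals partition the line. *)
Lemma sum_uniform_law (A : set R) : measurable A -> @sum_law R _ T P int _ (measurableTypeR R) _ mUm A = lam A.
Proof.
move=> mA; rewrite sum_lawE.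
pose B (m : int) : set R := `](m%:~R), (m + 1)%:~R]%classic.
have mB m : measurable (B m) by exact: measurable_itv.
have E m : P ((fun w => m%:~R + U w) @^-1` A) = lam (A `&` B m).
  rewrite (lebesgue_affine 1 m%:~R)//; last exact: (measurableI _ _ mA (mB m)).
  rewrite mul1e -[LHS]/(P (U @^-1` ((fun x => m%:~R + x) @^-1` A))) uniform_law; last first.
    have mf : measurable_fun setT (fun x : R => m%:~R + x) by exact: measurable_funD.
    by rewrite -[X in measurable X]setTI; exact: mf.
  congr (lam _); apply/seteqP; split => x /=; rewrite /B/= !in_itv/= mul1r intrD/=.
    by move=> [? /andP[? ?]]; rewrite addrC; split => //; apply/andP; split; lra.
  by move=> [? /andP[? ?]]; rewrite addrC; split => //; apply/andP; split; lra.
under eq_esum do rewrite E.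
rewrite esum_pickle//.
pose F k := oapp (fun m => A `&` B m) set0 (pickle_inv k).
transitivity (lam (\bigcup_k F k)).
  rewrite measure_bigcup//.
  - rewrite [RHS]eseries_mkcond; apply: eq_eseriesr => k _.
    by rewrite in_setT /F; case: pickle_inv => //=; rewrite measure0.
  - by move=> k _; rewrite /F; case: pickle_inv => //= m; exact: (measurableI _ _ mA (mB m)).
  - apply/trivIsetP => i j _ _ ij; rewrite /F.
    case Ei: (pickle_inv i) => [m|]; last by rewrite set0I.
    case Ej: (pickle_inv j) => [m'|]; last by rewrite setI0.
    apply/seteqP; split => // x /= [[_]] + [_]; rewrite /B /= !in_itv/=.
    move=> /andP[a1 a2] /andP[b1 b2].
    have : (m < m' + 1)%R by rewrite -(ltr_int R); exact: lt_le_trans b2.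
    have : (m' < m + 1)%R by rewrite -(ltr_int R); exact: lt_le_trans a2.
    rewrite !ltzD1 => h1 h2; have mm : m = m' by apply/eqP; rewrite eq_le h1 h2.
    have Hi : pickle m = i by move: (@pickle_invK int i); rewrite Ei.
    have Hj : pickle m' = j by move: (@pickle_invK int j); rewrite Ej.
    by move: ij; rewrite -Hi -Hj mm eqxx.
congr (lam _); apply/seteqP; split => [x [k _]|x Ax].
  by rewrite /F; case: pickle_inv => //= m [].
(* The intervals [B m] are open on the left, so the one containing [x] is indexed by the ceiling
   minus 1, not by the floor. *)
set m := Num.ceil x - 1; have Fm : F (pickle m) = A `&` B m by rewrite /F pickleK_inv.
exists (pickle m); first exact: I.
rewrite Fm /m; split; first exact: Ax.
by rewrite /B/= in_itv/= subrK intrB; have := ceil_itv x; rewrite intrB.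
Qed.

Lemma integral_sum_uniform (f : R -> \bar R) : measurable_fun setT f ->
  (forall x, 0 <= f x)%E ->
  (\esum_(m in [set: int]) \int[P]_w f (m%:~R + U w)%R = \int[lam]_x f x)%E.
Proof.
move=> mf f0; rewrite -(@integral_sum_law R _ T P int _ (measurableTypeR R) _ mUm)//.
by apply: eq_measure_integral => A mA _; exact: sum_uniform_law.
Qed.

End Lebesgue1.

Lemma in_set_pred {T : Type} (p : pred T) (x : T) : (x \in [set t | p t]) = p x.
Proof. by apply/idP/idP; rewrite inE. Qed.

Section MeasurableLt.
Context {R : realType} {d : measure_display} {T : measurableType d}.

Lemma measurable_set_lt (f g : T -> R) :
  measurable_fun setT f -> measurable_fun setT g -> measurable [set x | f x < g x].
Proof.
move=> mf mg.
have mt : measurable [set true] by [].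
by have := measurable_fun_ltr mf mg measurableT mt; rewrite setTI; congr measurable.
Qed.

End MeasurableLt.

Section ExpTail.
Context {R : realType}.

Lemma integral_expRN_tail (s : R) :
  (\int[@lebesgue_measure R]_t (expR (- t) * \1_[set t | s < t] t)%:E = (expR (- s))%:E)%E.
Proof.
have cN : continuous (fun t : R => expR (- t)).
  move=> t; apply: continuous_comp; first exact: opp_continuous.
  exact: continuous_expR.
transitivity (\int[@lebesgue_measure R]_(t in `]s, +oo[) (expR (- t))%:E)%E.
  rewrite [RHS]integral_mkcond; apply: eq_integral => t _.
  rewrite patchE indicE in_set_pred.
  rewrite (_ : (t \in `]s, +oo[%classic) = (s < t)).
    by case: ifP => _; rewrite ?mulr1 ?mulr0.
  by apply/idP/idP; rewrite inE/= in_itv/= andbT.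
rewrite integral_itv_obnd_cbnd; last first.
  by apply/measurable_EFinP; apply: measurable_funTS; exact: continuous_measurable_fun.
have d1 (x : R) : is_derive x 1 (fun t => - expR (- t)) (expR (- x)).
  by apply: is_derive_eq; rewrite ?scaleN1r ?mulN1r ?mulrN1 ?opprK.
rewrite (@ge0_continuous_FTC2y R (fun t => expR (- t)) (fun t => - expR (- t)) s 0).
- by rewrite sub0e EFinN oppeK.
- by move=> x _; exact: expR_ge0.
- by apply: continuous_subspaceT; exact: cN.
- by rewrite -oppr0; apply: cvgN; exact: cvgr_expR.
- by move=> x _; have [] := d1 x.
- by apply: cvg_at_right_filter; apply: cvgN; exact: cN.
- by move=> x _; rewrite derive1E; have [_ ->] := d1 x.
Qed.

End ExpTail.

(** * Lebesgue measure in dimension [d] and the volume of balls *)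

Section LebesgueD.
Context {R : realType} {d : nat} {dT : measure_display} {T : measurableType dT}.
Variables (P : probability T R) (U : 'I_d -> T -> R).
Hypothesis mU : forall i, measurable_fun setT (U i).
Hypothesis U_unif : forall i t, 0 <= t <= 1 -> P (U i @^-1` `]-oo, t]%classic) = t%:E.
Hypothesis U_indep : forall f : 'I_d -> R -> R,
  (forall i, measurable_fun setT (f i)) -> (forall i x, 0 <= f i x) ->
  (\int[P]_w (\prod_(i < d) f i (U i w))%:E = \prod_(i < d) \int[P]_w (f i (U i w))%:E)%E.

Local Notation lam := (@lebesgue_measure R).
Local Notation Rd := (g_sigma_algebraType (@boxes R 'I_d)).

Definition cube_point (z : 'rV[int]_d) (w : T) : Rd := fun i => (z ord0 i)%:~R + U i w.

Lemma measurable_cube_point z : measurable_fun setT (cube_point z).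
Proof.
by apply: measurable_tuple_fun => i; exact: measurable_funD.
Qed.

(** Lebesgue measure on $\mathbb{R}^d$, defined as the expected number of points [z + U] in [A] with
    one uniform point per unit cube. The sums over cubes of the branching model thus need no change
    of variables. *)
Definition lebesgued (A : set Rd) : \bar R :=
  sum_law P cube_point measurable_cube_point A.

HB.instance Definition _ := Measure.copy lebesgued
  (sum_law P cube_point measurable_cube_point).

Lemma integral_lebesgued_prod (f : 'I_d -> R -> R) :
  (forall i, measurable_fun setT (f i)) -> (forall i x, 0 <= f i x) ->
  (\int[lebesgued]_x (\prod_(i < d) f i (x i))%:E =
   \prod_(i < d) \int[lam]_x (f i x)%:E)%E.
Proof.
move=> mf f0.
transitivity (\int[sum_law P cube_point measurable_cube_point]_x
  (\prod_(i < d) f i (x i))%:E)%E; first by [].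
rewrite integral_sum_law.
- under eq_esum do rewrite /cube_point.
  have E (z : 'rV[int]_d) : (\int[P]_w (\prod_(i < d) f i ((z ord0 i)%:~R + U i w))%:E =
      \prod_(i < d) \int[P]_w (f i ((z ord0 i)%:~R + U i w))%:E)%E.
    rewrite (U_indep (fun i x => f i ((z ord0 i)%:~R + x)))// => i.
    by apply: measurableT_comp => //; exact: measurable_funD.
  under eq_esum do rewrite E.
  rewrite (esum_prod_row d (fun i m => \int[P]_w (f i (m%:~R + U i w)%R)%:E)%E); last first.
    by move=> i m; apply: integral_ge0 => w _; rewrite lee_fin.
  apply: eq_bigr => i _.
  rewrite (integral_sum_uniform P (U i) (mU i) (U_unif i) (fun x => (f i x)%:E))//; first by apply/measurable_EFinP.
  by move=> x; rewrite lee_fin.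
- apply/measurable_EFinP; apply: measurable_prod => i _.
  by apply: measurableT_comp => //; exact: measurable_coord.
- by move=> x; rewrite lee_fin prodr_ge0.
Qed.

Lemma measurable_box (A : 'I_d -> set R) : (forall i, measurable (A i)) ->
  measurable ([set x | forall i, A i (x i)] : set Rd).
Proof. by move=> mA; apply: sub_sigma_algebra; exists A. Qed.

Lemma lebesgued_box (A : 'I_d -> set R) : (forall i, measurable (A i)) ->
  lebesgued [set x | forall i, A i (x i)] = (\prod_(i < d) lam (A i))%E.
Proof.
move=> mA; have mB := measurable_box A mA.
rewrite -[X in lebesgued X]setIT -integral_indic//.
transitivity (\int[lebesgued]_x (\prod_(i < d) (\1_(A i) (x i) : R))%:E)%E.
  apply: eq_integral => x _; congr (_%:E); rewrite indicE.
  have [xA|xA] := boolP (_ \in _).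
    by rewrite big1// => i _; rewrite indicE mem_set//; move: xA; rewrite inE.
  have /existsNP[i Ai] : ~ forall i, A i (x i) by move: xA; rewrite notin_setE.
  by rewrite (bigD1 i)//= indicE memNset// mul0r.
rewrite (integral_lebesgued_prod (fun i => \1_(A i))); first last.
- by move=> i x; rewrite indicE.
- by move=> i; exact: measurable_indic.
apply: eq_bigr => i _.
by have := @integral_indic _ _ R lam setT measurableT (A i) (mA i); rewrite setIT.
Qed.

Let cubes (n : nat) : set Rd := [set x | forall i, `[- n%:R, n%:R]%classic (x i)].

Let cubes_box n : boxes (cubes n).
Proof. by exists (fun=> `[- n%:R, n%:R]%classic). Qed.

Let cubes_cover : \bigcup_k cubes k = setT.
Proof.
apply/seteqP; split => // x _.
exists (\sum_(i < d) (Num.trunc `|x i|).+1)%N => // i /=.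
rewrite in_itv/= -ler_norml; apply: le_trans (ltW (truncnS_gt _)) _.
by rewrite ler_nat (bigD1 i)//= leq_addr.
Qed.

Let cubes_fin n : (lebesgued (cubes n) < +oo)%E.
Proof.
rewrite (lebesgued_box (fun=> `[- n%:R, n%:R]%classic))//.
rewrite [X in (X < _)%E](_ : _ = (\prod_(i < d) fine (lam `[- n%:R, n%:R]%classic))%:E) ?ltry//.
rewrite -prodEFin; apply: eq_bigr => i _; rewrite fineK//.
by rewrite lebesgue_measure_itv/=; case: ifP.
Qed.

(** Scaling will serve for the volume of balls, translation ([a = 1]) for adding a displacement to
    the initial points. *)
Lemma lebesgued_affine (a : R) (c : 'I_d -> R) (B : set Rd) : 0 < a -> measurable B ->
  lebesgued B = ((a ^+ d)%:E * lebesgued ((fun x i => a * x i + c i)%R @^-1` B))%E.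
Proof.
move=> a0 mB.
have mf : measurable_fun setT ((fun x i => a * x i + c i) : Rd -> Rd).
  apply: measurable_tuple_fun => i; apply: measurable_funD => //.
  by apply: measurable_funM => //; exact: measurable_coord.
have ad0 : 0 <= a ^+ d by rewrite exprn_ge0// ltW.
apply: (@g_sigma_algebra_measure_unique _ R Rd (@boxes R 'I_d) _ cubes cubes_box cubes_cover
  lebesgued (mscale (NngNum ad0) (image_measure lebesgued mf)) (@boxesI R 'I_d)) => //.
- exact: sub_sigma_algebra.
- move=> _ [A mA ->].
  rewrite -[RHS]/((a ^+ d)%:E * lebesgued [set x | forall i, A i (a * x i + c i)%R])%E.
  have mA' i : measurable ((fun y => a * y + c i) @^-1` A i).
    have mg : measurable_fun setT (fun y : R => a * y + c i).
      by apply: measurable_funD => //; exact: measurable_funM.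
    by rewrite -[X in measurable X]setTI; exact: mg.
  rewrite (lebesgued_box (fun i => (fun y => a * y + c i) @^-1` A i))//.
  transitivity (\prod_(i < d) lam (A i))%E; first exact: lebesgued_box.
  have -> : (a ^+ d)%:E = (\prod_(i < d) a%:E)%E.
    by rewrite prodEFin prodr_const card_ord.
  rewrite -big_split/=.
  by apply: eq_bigr => i _; exact: lebesgue_affine.
Qed.

Definition normsq (x : 'I_d -> R) : R := \sum_(i < d) x i ^+ 2.

Lemma normsq_ge0 x : 0 <= normsq x.
Proof. by apply: sumr_ge0 => i _; exact: sqr_ge0. Qed.

Lemma measurable_normsq : measurable_fun setT (normsq : Rd -> R).
Proof.
apply: measurable_sum => i; apply: measurable_funX; exact: measurable_coord.
Qed.

Lemma measurable_normsq_lt t : measurable ([set x | normsq x < t] : set Rd).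
Proof.
by apply: measurable_set_lt => //; exact: measurable_normsq.
Qed.

Lemma ball0E (u : R) : 0 < u -> @Defs.ball0 R d u = [set x | normsq x < u ^+ 2].
Proof.
move=> u0; have uE : u = Num.sqrt (u ^+ 2) by rewrite sqrtr_sqr gtr0_norm.
apply/seteqP; split => x /=; rewrite /Defs.ball0/= /eucl -/(normsq x).
  by rewrite {1}uE ltr_sqrt ?exprn_gt0.
by rewrite {2}uE ltr_sqrt ?exprn_gt0.
Qed.

Let V := lebesgued [set x | normsq x < 1].

Let normsq_scale u : 0 < u ->
  lebesgued [set x | normsq x < u ^+ 2] = ((u ^+ d)%:E * V)%E.
Proof.
move=> u0; rewrite (lebesgued_affine u (fun=> 0) _ u0 (measurable_normsq_lt _)).
congr (_ * lebesgued _)%E; apply/seteqP; split => x /=; rewrite /normsq.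
  under eq_bigr do rewrite addr0 exprMn; rewrite -mulr_sumr.
  by rewrite gtr_pMr// exprn_gt0.
under [X in _ -> X < _]eq_bigr do rewrite addr0 exprMn; rewrite -mulr_sumr.
by rewrite gtr_pMr// exprn_gt0.
Qed.

Let sf : sigma_finite setT lebesgued.
Proof.
exists cubes => //; move=> n; split; last exact: cubes_fin.
by apply: sub_sigma_algebra; exact: cubes_box.
Qed.

HB.instance Definition _ := Measure_isSigmaFinite.Build _ _ _ lebesgued sf.

(** The integral of [Gamma (d / 2 + 1)] before [fine], kept extended because [fine] would send an
    infinite value to 0. *)
Let gammaint := (\int[lam]_(t in [set t : R | (0 < t)%R])
  ((t `^ (d%:R / 2 + 1 - 1) * expR (- t))%R%:E))%E.

(** The integral of $e^{-|x|^2}$ in two ways. It factors into one-dimensional Gaussian integrals.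
    With $e^{-s}=\int_s^\infty e^{-t}dt$ and Tonelli it is also $\int_0^\infty
    e^{-t}\,\mathrm{vol}(|x|^2<t)\,dt$, where the volume is $t^{d/2}V$ by scaling. *)
Let gauss_layer : ((pi `^ (d%:R / 2))%:E = gammaint * V)%E.
Proof.
transitivity (\int[lebesgued]_x (expR (- normsq x))%:E)%E.
  transitivity (\int[lebesgued]_x (\prod_(i < d) gauss_fun (x i))%:E)%E.
    rewrite (integral_lebesgued_prod (fun=> gauss_fun)); first last.
    - by move=> i x; exact: gauss_fun_ge0.
    - by move=> i; exact: measurable_gauss_fun.
    rewrite integralT_gauss prodEFin prodr_const card_ord; congr (_%:E).
    by rewrite -powR_mulrn ?sqrtr_ge0// -powR12_sqrt ?pi_ge0// -powRrM mulrC.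
  by apply: eq_integral => x _; rewrite /normsq -sumrN expR_sum.
transitivity (\int[lebesgued]_x \int[lam]_t
    (expR (- t) * \1_[set t | normsq x < t] t)%:E)%E.
  by apply: eq_integral => x _; rewrite integral_expRN_tail.
have mS : measurable [set z : Rd * R | normsq z.1 < z.2].
  apply: measurable_set_lt; last exact: measurable_snd.
  exact: measurableT_comp measurable_normsq measurable_fst.
pose G (z : Rd * R) := (expR (- z.2) * \1_[set z : Rd * R | normsq z.1 < z.2] z)%:E.
have mG : measurable_fun setT G.
  apply/measurable_EFinP; apply: measurable_funM; last exact: measurable_indic.
  have mE : measurable_fun setT (fun t : R => expR (- t)) by apply: measurableT_comp.
  exact: (measurableT_comp mE measurable_snd).
have G0 z : (0 <= G z)%E by rewrite lee_fin mulr_ge0 ?expR_ge0.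
have GE x t : (expR (- t) * \1_[set t | normsq x < t] t)%:E = G (x, t).
  by rewrite /G/= !indicE !in_set_pred.
under eq_integral do under eq_integral do rewrite GE.
have := @fubini_tonelli _ _ Rd (measurableTypeR R) R lebesgued lam G mG G0.
rewrite /fubini_F /fubini_G => ->.
have mpos : measurable [set t : R | 0 < t].
  rewrite (_ : [set t : R | 0 < t] = `]0, +oo[%classic)//.
  by apply/seteqP; split => x /=; rewrite in_itv/= andbT.
rewrite /gammaint -ge0_integralZr//; first last.
- exact: measure_ge0.
- by move=> t _; rewrite lee_fin mulr_ge0 ?powR_ge0 ?expR_ge0.
- apply/measurable_EFinP; apply: measurable_funM.
    by apply: measurable_funTS; exact: measurable_powR.
  by apply: measurable_funTS; apply: measurableT_comp => //; apply: measurableT_comp.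
rewrite [RHS]integral_mkcond.
apply: eq_integral => t _; rewrite patchE.
have E : (\int[lebesgued]_x G (x, t) = (expR (- t))%:E * lebesgued [set x | (normsq x < t)%R])%E.
  under eq_integral do rewrite /G/= EFinM.
  rewrite ge0_integralZl//.
  - rewrite -[X in lebesgued X]setIT -(integral_indic lebesgued measurableT (measurable_normsq_lt t)).
    by congr (_ * _)%E; apply: eq_integral => x _; rewrite !indicE !in_set_pred.
  - apply/measurable_EFinP; apply: measurable_indic.
    exact: measurable_normsq_lt.
rewrite E; case: ifPn.
  rewrite inE/= => t0.
  have -> : [set x | normsq x < t] = [set x | normsq x < (Num.sqrt t) ^+ 2].
    by rewrite sqr_sqrtr// ltW.
  rewrite normsq_scale ?sqrtr_gt0// muleA -EFinM mulrC; congr (_%:E * _)%E.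
  congr (_ * _).
  by rewrite -powR_mulrn ?sqrtr_ge0// -powR12_sqrt ?ltW// -powRrM mulrC addrK.
rewrite notin_setE/= => /negP; rewrite -leNgt => t0.
rewrite (_ : [set x | _] = set0) ?measure0 ?mule0//.
apply/seteqP; split => // x /= /lt_le_trans/(_ t0).
by rewrite ltNge normsq_ge0.
Qed.

Lemma lebesgued_ball (u : R) : 0 < u ->
  lebesgued (@Defs.ball0 R d u) = (vol_ball d u)%:E.
Proof.
move=> u0; rewrite ball0E// normsq_scale//.
have V0 : (0 <= V)%E by exact: measure_ge0.
have g0 : (0 <= gammaint)%E.
  by apply: integral_ge0 => t _; rewrite lee_fin mulr_ge0 ?powR_ge0 ?expR_ge0.
have pg : 0 < (pi : R) `^ (d%:R / 2) by rewrite powR_gt0// pi_gt0.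
have := gauss_layer; rewrite /vol_ball /Gamma -/gammaint.
(* Both factors are finite and nonzero because their product is the finite positive number
   $\pi^{d/2}$; every other case contradicts this. *)
case: (gammaint) g0 => [g| |//]; case: (V) V0 => [v| |//]; rewrite ?lee_fin => v0 g0.
- rewrite -!EFinM => -[E]; congr (_%:E).
  have g1 : g != 0 by apply/eqP => gz; move: pg; rewrite E gz mul0r ltxx.
  by rewrite /= E; field.
- move: g0; rewrite le_eqVlt => /predU1P[<-|g0].
    by rewrite mul0e => -[E]; move: pg; rewrite E ltxx.
  by rewrite gt0_muley ?lte_fin.
- move: v0; rewrite le_eqVlt => /predU1P[<-|v0].
    by rewrite mule0 => -[E]; move: pg; rewrite E ltxx.
  by rewrite gt0_mulye ?lte_fin.
- by rewrite mulyy.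
Qed.

End LebesgueD.

(** * Fuk-Nagaev tail bound *)

Section ExpInequality.
Context {R : realType}.

(** For [u <= 0] the remainder $e^u-1-u$ is at most $\min(|u|,u^2)\le|u|^t$, and the constant is at
    least 1. For [u > 0] it is at most $u^2e^u=u^t\,u^{2-t}e^u\le u^t\,v^{2-t}e^v$, and $v^2\le
    e^{2v}$ produces the exponent [3 * v]. *)
Lemma expR_le_tangent_pow (u v t : R) : 0 < v -> u <= v -> 1 <= t <= 2 ->
  expR u <= 1 + u + `|u| `^ t * (expR (3 * v) / v `^ t).
Proof.
move=> v0 uv /andP[t1 t2].
have vt : 0 < v `^ t by exact: powR_gt0.
have ve : v <= expR v by apply: le_trans (expR_ge1Dx v); lra.
have v2 : v ^+ 2 <= expR (2 * v).
  by rewrite expRM_natl ler_pXn2r ?nnegrE ?expR_ge0// ltW.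
have e1 : 1 <= expR v by rewrite -expR0 ler_expR ltW.
have e23 : expR (2 * v) <= expR (3 * v) by rewrite ler_expR; lra.
have vte : v `^ t <= expR (3 * v).
  have [v1|v1] := lerP 1 v.
    apply: le_trans e23; apply: le_trans v2.
    by rewrite -(powR_mulrn 2 (ltW v0)); exact: ler_powR.
  apply: (@le_trans _ _ 1); last first.
    by apply: le_trans e1 _; rewrite ler_expR; lra.
  rewrite -(powRr0 v); apply: ger_powR; lra.
have c1 : 1 <= expR (3 * v) / v `^ t by rewrite ler_pdivlMr// mul1r.
have [u0|u0] := lerP u 0.
  have w0 : 0 <= - u by lra.
  have ut : Num.min (- u) ((- u) ^+ 2) <= `|u| `^ t.
    rewrite ler0_norm//; have [w1|w1] := lerP 1 (- u).
      by rewrite ge_min -[X in X <= _](powRr1 w0) ler_powR.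
    rewrite ge_min -(powR_mulrn 2 w0); apply/orP; right.
    move: w0; rewrite le_eqVlt => /predU1P[<-|w0].
      by rewrite !powR0//; apply/negP => /eqP; lra.
    by apply: ger_powR => //; rewrite w0 ltW.
  suff : expR u <= 1 + u + Num.min (- u) ((- u) ^+ 2).
    move=> /le_trans; apply; rewrite lerD2l; apply: le_trans ut _.
    by rewrite ler_peMr ?powR_ge0.
  rewrite /Num.min; case: ifP => _.
    by rewrite addrK -expR0 ler_expR.
  have : expR u <= (1 - u)^-1.
    rewrite -[u]opprK expRN lef_pV2 ?posrE ?expR_gt0//; last by lra.
    by rewrite opprK; exact: expR_ge1Dx.
  move=> /le_trans; apply; rewrite -[X in X <= _]mul1r ler_pdivrMr; last by lra.
  rewrite sqrrN; nra.
have eu : expR u - 1 <= u * expR u.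
  have : 1 - u <= expR (- u) by exact: expR_ge1Dx.
  rewrite expRN -[X in _ <= X]mul1r ler_pdivlMr ?expR_gt0//; lra.
have H1 : expR u <= 1 + u + u ^+ 2 * expR u.
  have : u * (expR u - 1) <= u * (u * expR u) by rewrite ler_pM2l.
  rewrite expr2; lra.
apply: le_trans H1 _; rewrite lerD2l gtr0_norm//.
have -> : u ^+ 2 = u `^ t * u `^ (2 - t).
  rewrite -powRD; last by rewrite (gt_eqF u0) implybT.
  by rewrite addrC subrK (powR_mulrn 2 (ltW u0)).
rewrite -mulrA ler_pM2l ?powR_gt0//.
have H2 : u `^ (2 - t) * expR u <= v `^ (2 - t) * expR v.
  apply: ler_pM; rewrite ?powR_ge0 ?expR_ge0 ?ler_expR//.
  by apply: ge0_ler_powR; rewrite ?nnegrE; lra.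
apply: le_trans H2 _; rewrite powRB ?(gt_eqF v0) ?implybT// (powR_mulrn 2 (ltW v0)).
rewrite mulrAC ler_pM2r ?invr_gt0//.
have -> : expR (3 * v) = expR (2 * v) * expR v by rewrite -expRD; congr expR; lra.
by rewrite ler_pM2r ?expR_gt0.
Qed.

End ExpInequality.

Lemma lee_prod {R : realDomainType} (I : Type) (s : seq I) (f g : I -> \bar R) :
  (forall i, 0 <= f i)%E -> (forall i, f i <= g i)%E ->
  (\prod_(i <- s) f i <= \prod_(i <- s) g i)%E.
Proof.
move=> f0 fg.
suff [] : (0 <= \prod_(i <- s) f i)%E /\ (\prod_(i <- s) f i <= \prod_(i <- s) g i)%E.
  by [].
apply: (big_ind2 (fun x y => (0 <= x)%E /\ (x <= y)%E)) => //.
move=> x1 x2 y1 y2 [x0 x12] [y0 y12]; split; first exact: mule_ge0.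
exact: lee_pmul.
Qed.

Section TailBound.
Context {R : realType} {dT : measure_display} {T : measurableType dT}.
Variable P : probability T R.
Variables (t alpha A : R).
Hypothesis t12 : 1 <= t <= 2.
Hypothesis talpha : t <= alpha.
Hypothesis A0 : 0 <= A.

(** Truncation from above only lowers the variable, so the linear term integrates to at most
    [h * E X = 0]. The remainder is controlled by [|min X y|^t <= 1 + |X|^alpha], the source of
    [1 + A], and [1 + x <= expR x] concludes. *)
Lemma truncated_mgf (X : T -> R) (h y : R) :
  measurable_fun setT X -> P.-integrable setT (EFin \o X) ->
  (\int[P]_w (X w)%:E = 0)%E -> (\int[P]_w (`|X w| `^ alpha)%:E <= A%:E)%E ->
  0 < h -> 0 < y ->
  (\int[P]_w (expR (h * Num.min (X w) y))%:E <=
   (expR ((1 + A) * (expR (3 * (h * y)) / y `^ t)))%:E)%E.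
Proof.
move=> mX iX EX AX h0 y0.
set c := expR (3 * (h * y)) / y `^ t.
have c0 : 0 < c by rewrite divr_gt0 ?expR_gt0 ?powR_gt0.
have pw w : expR (h * Num.min (X w) y) <= h * X w + (1 + c + c * (`|X w| `^ alpha)).
  have hy0 : 0 < h * y by rewrite mulr_gt0.
  have mXy : h * Num.min (X w) y <= h * y by rewrite ler_pM2l// ge_min lexx orbT.
  apply: le_trans (expR_le_tangent_pow _ _ t hy0 mXy t12) _.
  have -> : `|h * Num.min (X w) y| `^ t * (expR (3 * (h * y)) / (h * y) `^ t) =
     c * `|Num.min (X w) y| `^ t.
    rewrite normrM (gtr0_norm h0) !powRM ?(ltW h0) ?(ltW y0)// /c.
    field; rewrite !gt_eqF// ?powR_gt0//.
  have H1 : `|Num.min (X w) y| <= `|X w|.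
    rewrite /Num.min; case: ltP => // yX.
    by rewrite !ger0_norm// ltW// (lt_le_trans y0).
  have H2 : `|Num.min (X w) y| `^ t <= 1 + `|X w| `^ alpha.
    case/andP: t12 => t1 t2.
    apply: (@le_trans _ _ (`|X w| `^ t)).
      by apply: ge0_ler_powR; rewrite ?nnegrE//; lra.
    have [x1|x1] := lerP 1 `|X w|.
      by apply: le_trans (ler_powR x1 talpha) _; lra.
    have : `|X w| `^ t <= 1.
      have E1 : 1 `^ t = 1 :> R by rewrite powR1.
      rewrite -[X in _ <= X]E1.
      by apply: ge0_ler_powR; rewrite ?nnegrE//; lra.
    by have := powR_ge0 `|X w| alpha; lra.
  have H3 : h * Num.min (X w) y <= h * X w by rewrite ler_pM2l// ge_min lexx.
  have : c * `|Num.min (X w) y| `^ t <= c * (1 + `|X w| `^ alpha) by rewrite ler_pM2l.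
  lra.
have mXa : measurable_fun setT (fun w => `|X w| `^ alpha).
  apply: (measurableT_comp (measurable_powR alpha)).
  exact: measurableT_comp.
have mmin : measurable_fun setT (fun w => Num.min (X w) y) by exact: measurable_minr.
apply: (@le_trans _ _ (\int[P]_w ((h * X w)%:E + (1 + c + c * (`|X w| `^ alpha))%:E))%E).
  apply: ge0_le_integral => //.
  - apply/measurable_EFinP; apply: measurableT_comp => //.
    exact: measurable_funM.
  - apply/emeasurable_funD; apply/measurable_EFinP; first exact: measurable_funM.
    by apply: measurable_funD => //; exact: measurable_funM.
  - by move=> w _; rewrite -EFinD lee_fin.
have iXa : P.-integrable setT (fun w => (`|X w| `^ alpha)%:E).
  apply/integrableP; split; first exact/measurable_EFinP.
  under eq_integral do rewrite gee0_abs ?lee_fin ?powR_ge0//.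
  by apply: le_lt_trans AX _; rewrite ltry.
rewrite integralD//; first last.
- apply: (eq_integrable measurableT (fun w => (1 + c)%:E + c%:E * (`|X w| `^ alpha)%:E)%E) => //.
  apply: integrableD => //; first exact: finite_measure_integrable_cst.
  exact: integrableZl.
- apply: (eq_integrable measurableT (fun w => h%:E * (EFin \o X) w)%E) => //.
  exact: integrableZl.
have -> : (\int[P]_w (h * X w)%:E = 0)%E.
  under eq_integral do rewrite EFinM.
  by rewrite integralZl// EX mule0.
rewrite add0e.
under eq_integral do rewrite EFinD EFinM.
rewrite ge0_integralD//; first last.
- by apply: measurable_funeM; exact/measurable_EFinP.
- by move=> w _; rewrite mule_ge0 ?lee_fin ?powR_ge0 ?ltW.
- by move=> w _; rewrite lee_fin addr_ge0 ?ltW.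
rewrite integral_cst// ge0_integralZl//; first last.
- by rewrite lee_fin ltW.
- exact/measurable_EFinP.
rewrite [X in (_ * X)%E]probability_setT mule1.
apply: (@le_trans _ _ ((1 + c)%:E + c%:E * A%:E)%E).
  by rewrite leeD2l// lee_pmul2l// ?lte_fin.
rewrite -EFinM -EFinD lee_fin; apply: le_trans _ (expR_ge1Dx _).
lra.
Qed.

Variables (n : nat) (X : 'I_n -> T -> R).
Hypothesis mX : forall k, measurable_fun setT (X k).
Hypothesis iX : forall k, P.-integrable setT (EFin \o X k).
Hypothesis EX : forall k, (\int[P]_w (X k w)%:E = 0)%E.
Hypothesis AX : forall k, (\int[P]_w (`|X k w| `^ alpha)%:E <= A%:E)%E.
Hypothesis X_indep : forall f : R -> R, measurable_fun setT f -> (forall x, 0 <= f x) ->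
  (\int[P]_w (\prod_(k < n) f (X k w))%:E = \prod_(k < n) \int[P]_w (f (X k w))%:E)%E.

Let mmin y k : measurable_fun setT (fun w => Num.min (X k w) y).
Proof. exact: measurable_minr. Qed.

(** Exponential Markov inequality, with the moment factored by independence. *)
Lemma truncated_sum_tail (h x y : R) : 0 < h -> 0 < y ->
  (P [set w | (x <= \sum_(k < n) Num.min (X k w) y)%R] <=
   (expR (n%:R * ((1 + A) * (expR (3 * (h * y)) / y `^ t)) - h * x))%:E)%E.
Proof.
move=> h0 y0.
set B := [set w | _].
have mS : measurable_fun setT (fun w => \sum_(k < n) Num.min (X k w) y).
  exact: measurable_sum.
have mB : measurable B.
  have -> : B = ~` [set w | \sum_(k < n) Num.min (X k w) y < x].
    by apply/seteqP; split => w /=; rewrite /B/= leNgt => /negP.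
  by apply: measurableC; exact: measurable_set_lt.
rewrite -[X in P X]setIT -integral_indic//.
have mE : measurable_fun setT (fun w => \prod_(k < n) expR (h * Num.min (X k w) y)).
  apply: measurable_prod => k _; apply: measurableT_comp => //.
  exact: measurable_funM.
apply: (@le_trans _ _ (\int[P]_w ((expR (- (h * x)))%:E *
    (\prod_(k < n) expR (h * Num.min (X k w) y))%:E))%E).
  apply: ge0_le_integral => //.
  - by apply/measurable_EFinP; exact: measurable_indic.
  - by apply: measurable_funeM; exact/measurable_EFinP.
  - move=> w _; rewrite -EFinM lee_fin indicE.
    case: (boolP (w \in B)); last first.
      by move=> _; rewrite mulr_ge0 ?expR_ge0// prodr_ge0// => k _; exact: expR_ge0.
    rewrite inE /B/= => xw.
    rewrite -expR_sum -expRD -[X in X <= _]expR0 ler_expR -mulr_sumr addrC subr_ge0.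
    by rewrite ler_pM2l.
rewrite ge0_integralZl//; first last.
- by move=> w _; rewrite lee_fin prodr_ge0// => k _; exact: expR_ge0.
- exact/measurable_EFinP.
rewrite (X_indep (fun z => expR (h * Num.min z y))); first last.
- by move=> z; exact: expR_ge0.
- apply: measurableT_comp => //; apply: measurable_funM => //.
  exact: measurable_minr.
rewrite addrC expRD EFinM lee_pmul2l ?lte_fin ?expR_gt0//.
rewrite mulrC expRM_natr.
have -> : (expR ((1 + A) * (expR (3 * (h * y)) / y `^ t)) ^+ n)%:E =
  (\prod_(k < n) (expR ((1 + A) * (expR (3 * (h * y)) / y `^ t)))%:E)%E.
  by rewrite prodEFin prodr_const card_ord.
apply: lee_prod => k; last exact: truncated_mgf.
by apply: integral_ge0 => w _; rewrite lee_fin expR_ge0.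
Qed.

Lemma one_jump_tail (y : R) (k : 'I_n) : 0 < y ->
  (P [set w | (y < X k w)%R] <= (A / y `^ alpha)%:E)%E.
Proof.
move=> y0; have ya : 0 < y `^ alpha by exact: powR_gt0.
have al0 : 0 <= alpha by case/andP: t12 => ? _; have := talpha; lra.
have mB : measurable [set w | y < X k w] by exact: measurable_set_lt.
have mXa : measurable_fun setT (fun w => `|X k w| `^ alpha).
  apply: (measurableT_comp (measurable_powR alpha)).
  exact: measurableT_comp.
rewrite -[X in P X]setIT -integral_indic//.
apply: (@le_trans _ _ (\int[P]_w ((y `^ alpha)^-1%:E * (`|X k w| `^ alpha)%:E))%E).
  apply: ge0_le_integral => //.
  - by apply/measurable_EFinP; exact: measurable_indic.
  - by apply: measurable_funeM; exact/measurable_EFinP.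
  - move=> w _; rewrite -EFinM lee_fin indicE in_set_pred.
    case: (boolP (y < X k w)) => yX /=; last by rewrite mulr_ge0 ?powR_ge0// invr_ge0 ltW.
    rewrite mulrC ler_pdivlMr// mul1r; apply: ge0_ler_powR; rewrite ?nnegrE// ltW//.
    by rewrite (lt_le_trans yX)// ler_norm.
rewrite ge0_integralZl//; first last.
- by rewrite lee_fin invr_ge0 ltW.
- exact/measurable_EFinP.
by rewrite mulrC EFinM lee_pmul2l// lte_fin invr_gt0.
Qed.

(* The Fuk-Nagaev type truncation: either some summand exceeds [y], or the sum of the
   summands truncated at [y] is large, which the exponential moment with
   [expR (3 h y) = y ^ t / (n (1 + A))] makes polynomially unlikely of order [K]. *)
Lemma sum_tail (K : nat) (y : R) : 0 < y -> (0 < n)%N ->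
  (P [set w | (3 * K%:R * y <= \sum_(k < n) X k w)%R] <=
   (n%:R * (A / y `^ alpha) + expR 1 * (n%:R * (1 + A) / y `^ t) ^+ K)%:E)%E.
Proof.
move=> y0 n0.
set x := 3 * K%:R * y.
have nA : 0 < n%:R * (1 + A) by rewrite mulr_gt0 ?ltr0n//; have := A0; lra.
have yt : 0 < y `^ t by exact: powR_gt0.
pose Q := y `^ t / (n%:R * (1 + A)).
have Q0 : 0 < Q by rewrite divr_gt0.
have QE : n%:R * (1 + A) / y `^ t = Q^-1 by rewrite invf_div.
have mB1 k : measurable [set w | y < X k w] by exact: measurable_set_lt.
have mS (Y : 'I_n -> T -> R) : (forall k, measurable_fun setT (Y k)) ->
    measurable [set w | x <= \sum_(k < n) Y k w].
  move=> mY; have -> : [set w | x <= \sum_(k < n) Y k w] =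
      ~` [set w | \sum_(k < n) Y k w < x].
    by apply/seteqP; split => w /=; rewrite leNgt => /negP.
  by apply: measurableC; apply: measurable_set_lt => //; exact: measurable_sum.
(* If [Q <= 1] the claimed bound is at least [expR 1], hence exceeds every probability; otherwise
   [ln Q > 0] gives a positive [h]. *)
have [Q1|Q1] := lerP Q 1.
  apply: le_trans (probability_le1 _ (mS _ mX)) _; rewrite lee_fin QE.
  apply: (@le_trans _ _ (expR 1 * 1)); first by rewrite mulr1 -expR0 ler_expR.
  rewrite -[X in X <= _]add0r lerD//.
    by rewrite mulr_ge0// divr_ge0 ?powR_ge0.
  by rewrite ler_pM2l ?expR_gt0// exprn_ege1// -[X in X <= _]invr1 lef_pV2 ?posrE.
pose h := (3 * y)^-1 * ln Q.
have h0 : 0 < h by rewrite mulr_gt0 ?ln_gt0// invr_gt0; lra.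
have hy : 3 * (h * y) = ln Q by rewrite /h; field; rewrite gt_eqF.
have hx : h * x = ln Q * K%:R by rewrite /h /x; field; rewrite gt_eqF.
have sub : [set w | x <= \sum_(k < n) X k w] `<=`
    \big[setU/set0]_(k < n) [set w | y < X k w] `|`
    [set w | x <= \sum_(k < n) Num.min (X k w) y].
  move=> w /= xw; have [/existsP[k yk]|/existsPn H] := boolP [exists k, y < X k w].
    by left; rewrite -bigcup_seq/=; exists k => //=; rewrite mem_index_enum.
  right; rewrite (eq_bigr (fun k => X k w))// => k _.
  by apply/min_idPl; rewrite leNgt.
have mU : measurable (\big[setU/set0]_(k < n) [set w | y < X k w]).
  by apply: bigsetU_measurable => k _.
apply: (le_trans (le_measure _ _ _ sub)); rewrite ?inE//; first exact: mS.
  by apply: measurableU => //; exact: mS.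
apply: (le_trans (measureU2 _ _ _)) => //; first exact: mS.
rewrite EFinD; apply: leeD.
  have U1 : (P (\big[setU/set0]_(k < n) [set w | (y < X k w)%R]) <=
      \sum_(k < n) P [set w | (y < X k w)%R])%E.
    suff [] : measurable (\big[setU/set0]_(k < n) [set w | y < X k w]) /\
      (P (\big[setU/set0]_(k < n) [set w | (y < X k w)%R]) <=
      \sum_(k < n) P [set w | (y < X k w)%R])%E by [].
    apply: (big_rec2 (fun U s => measurable U /\ (P U <= s)%E)).
      by rewrite measure0.
    move=> k B s _ [mB Bs]; split; first exact: measurableU.
    by apply: le_trans (measureU2 _ _ _) _ => //; exact: leeD.
  apply: le_trans U1 _.
  apply: (@le_trans _ _ (\sum_(k < n) (A / y `^ alpha)%:E)%E).
    by apply: lee_sum => k _; exact: one_jump_tail.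
  by rewrite sumEFin sumr_const card_ord mulr_natl; exact: lexx.
apply: le_trans (truncated_sum_tail h x y h0 y0) _.
rewrite lee_fin hy hx lnK ?posrE// expRD -[- (_ * _)]mulNr expRM_natr expRN lnK ?posrE//.
rewrite QE ler_pM2r ?exprn_gt0 ?invr_gt0// ler_expR.
have -> : n%:R * ((1 + A) * (Q / y `^ t)) = n%:R * (1 + A) / y `^ t * Q by ring.
by rewrite QE mulVf ?gt_eqF.
Qed.

End TailBound.

(** * Galton-Watson trees *)

Lemma nneseries_EFin {R : realType} (u : nat -> R) (l : R) :
  series u @ \oo --> l -> (\sum_(k <oo) (u k)%:E = l%:E)%E.
Proof.
move=> ul; apply/cvg_lim => //.
rewrite (_ : (fun n => \sum_(0 <= k < n) (u k)%:E)%E = EFin \o series u).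
  by apply: cvg_EFin; [exact: nearW|exact: ul].
by apply/funext => n /=; rewrite sumEFin.
Qed.

Lemma alive_cons (xi : seq nat -> nat) j s :
  alive xi (j :: s) = (j < xi [::])%N && alive (fun u => xi (j :: u)) s.
Proof.
rewrite /alive /=; congr andb.
by rewrite -[1%N]/(1 + 0)%N iotaDl all_map.
Qed.

Section RandomConjunction.
Context {R : realType} {dT : measure_display} {T : measurableType dT}.
Variable P : probability T R.
Context {I : eqType}.
Variable F : I -> set (set T).
Hypothesis Fm : forall i, F i `<=` measurable.
Hypothesis FI : forall i, setI_closed (F i).
Hypothesis FT : forall i, F i setT.
Hypothesis Find : mutually_independent P F.

Variables (a : I) (X : T -> nat) (J : nat -> set I) (H : nat -> set T).
Hypothesis FX : forall A, F a (X @^-1` A).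
Hypothesis JH : forall j, <<s group_gen F (J j) >> (H j).
Hypothesis aJ : forall j, ~ J j a.
Hypothesis J_disj : forall i j, i != j -> J i `&` J j = set0.

Let factor (k : nat) (o : option nat) : set T :=
  if o is Some j then H j else X @^-1` [set k].

Let piece k : set T :=
  \bigcap_(o in [set` None :: map Some (iota 0 k)]) factor k o.

Let pieceE k : piece k = [set w | X w = k /\ forall j, (j < k)%N -> H j w].
Proof.
rewrite /piece bigcap_cons; apply/seteqP; split => w /=.
  move=> [Xk Hw]; split=> // j jk; apply: (Hw (Some j)) => /=.
  by rewrite mem_map ?mem_iota//; exact: Some_inj.
move=> [Xk Hw]; split=> // o /= /mapP[j]; rewrite mem_iota/= add0n => jk ->.
exact: Hw.
Qed.

Let measurable_H j : measurable (H j).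
Proof. exact: group_sigma_measurable Fm _ _ (JH j). Qed.

Let measurable_piece k : measurable (piece k).
Proof.
rewrite pieceE (_ : [set w | _] = X @^-1` [set k] `&` \bigcap_(j in `I_k) H j).
  apply: measurableI; first exact: Fm (FX _).
  exact: fin_bigcap_measurable.
by apply/seteqP; split => w [].
Qed.

(** The event is split by the value of [X]; each piece is an intersection over the disjoint groups
    [J j] and the index [a]. It serves both for the subtrees of a particle's children and for the
    Poisson number of clusters in a cube. *)
Lemma prob_random_conjunction :
  P [set w | forall j, (j < X w)%N -> H j w] =
  (\sum_(k <oo) (P (X @^-1` [set k]) * \prod_(j < k) P (H j)))%E.
Proof.
rewrite (_ : [set w | _] = \bigcup_k piece k); last first.
  apply/seteqP; split => w /=.
    by move=> Hw; exists (X w) => //; rewrite pieceE.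
  by move=> [k _]; rewrite pieceE => -[<-].
rewrite measure_bigcup//; last first.
  apply/trivIsetP => i j _ _ ij; apply/seteqP; split => // w.
  by rewrite !pieceE => -[[/= Xi _] [Xj _]]; move: ij; rewrite -Xi -Xj eqxx.
rewrite eseries_mkcond; apply: eq_eseriesr => k _; rewrite in_setT.
pose J' (o : option nat) : set I := if o is Some j then J j else [set a].
have ndS : uniq (None :: [seq Some j | j <- iota 0 k]).
  rewrite /= map_inj_uniq ?iota_uniq ?andbT; last exact: Some_inj.
  by apply/mapP => -[].
transitivity (\prod_(o <- None :: [seq Some j | j <- iota 0 k]) P (factor k o))%E.
  apply: (group_independent P F Fm FI FT Find _ J' _ (factor k) ndS).
    have disj j : [set a] `&` J j = set0.
      by apply/seteqP; split => // _ /= [-> /aJ].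
    case=> [i|] [j|] _ _ ij; rewrite /J'; [|by rewrite setIC disj|exact: disj|by case/eqP: ij].
    exact: J_disj.
  case=> [j|] _ //=.
  by apply: sub_sigma_algebra; exists a => //; exact: FX.
by rewrite big_cons big_map -(big_mkord xpredT (fun j => P (H j))) /index_iota subn0.
Qed.

End RandomConjunction.

Section Tree.
Context {R : realType} {dT : measure_display} {T : measurableType dT}.
Variable P : probability T R.
Context {I : eqType}.
Variable F : I -> set (set T).
Hypothesis Fm : forall i, F i `<=` measurable.
Hypothesis FI : forall i, setI_closed (F i).
Hypothesis FT : forall i, F i setT.
Hypothesis Find : mutually_independent P F.

Variables (emb : seq nat -> I) (X : seq nat -> T -> nat) (p : nat -> R).
Hypothesis emb_inj : injective emb.
Hypothesis FX : forall s A, F (emb s) (X s @^-1` A).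
Hypothesis X_law : forall s k, P (X s @^-1` [set k]) = (p k)%:E.

(** No descendant of [v] exists [n] generations below it, provided [v] itself exists; at depth 0
    this is false since [v] counts. Recursion on the first generation matches the iteration of the
    generating function, and [not_deadP] returns to words. *)
Fixpoint dead (n : nat) (v : seq nat) (w : T) : Prop :=
  if n is m.+1 then forall j, (j < X v w)%N -> dead m (rcons v j) w else False.

Let subtree (v : seq nat) : set I := [set emb u | u in [set u | prefix v u]].

Lemma not_deadP n v w :
  ~ dead n v w <-> exists s, size s = n /\ alive (fun u => X (v ++ u) w) s.
Proof.
elim: n v => [|n IH] v /=.
  by split => [_|_ []]; exists [::].
split.
  move=> /existsNP[j /not_implyP[jX /IH[s [sn sa]]]].
  exists (j :: s); split; first by rewrite /= sn.
  rewrite alive_cons cats0 jX /=.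
  by under [X in alive X]funext => u do rewrite -cat_rcons.
move=> [[|j s] [] // [sn] sa0] H.
move: sa0; rewrite alive_cons cats0 => /andP[jX sa].
have : ~ dead n (rcons v j) w.
  apply/IH; exists s; split => //.
  by under [X in alive X]funext => u do rewrite cat_rcons.
by apply; exact: H.
Qed.

Let subtree_rcons v j : subtree (rcons v j) `<=` subtree v.
Proof.
move=> _ [u /= vu <-]; exists u => //=.
by apply: prefix_trans vu; rewrite -cats1 prefix_prefix.
Qed.

Lemma dead_sigma n v : <<s group_gen F (subtree v) >> [set w | dead n v w].
Proof.
elim: n v => [|n IH] v.
  rewrite (_ : [set w | _] = set0); last by apply/seteqP; split.
  exact: sigma_algebra0.
rewrite (_ : [set w | _] = \bigcap_j (X v @^-1` [set k | (k <= j)%N] `|`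
    [set w | dead n (rcons v j) w])).
  apply: (@bigcapT_measurable _ (g_sigma_algebraType (group_gen F (subtree v)))) => j.
  apply: (@measurableU _ (g_sigma_algebraType (group_gen F (subtree v)))).
    apply: sub_sigma_algebra; exists (emb v); last exact: FX.
    by exists v => //=; exact: prefix_refl.
  exact: (group_sigma_sub _ _ _ (subtree_rcons v j)).
apply/seteqP; split => w /= H.
  move=> j _ /=; have [jX|jX] := ltnP j (X v w); last by left.
  by right; apply: H.
move=> j jX; have [|//] := H j Logic.I.
by move=> /=; rewrite leqNgt jX.
Qed.

Variable G : R -> R.
Hypothesis p_gen : forall s : R, 0 <= s <= 1 ->
  series (fun k => p k * s ^+ k) @ \oo --> G s.

(** Given [k] children, their subtrees carry disjoint labels and die out independently, each with
    the same probability. *)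
Lemma prob_dead n v : P [set w | dead n v w] = (iter n G 0)%:E.
Proof.
elim: n v => [|n IH] v.
  rewrite (_ : [set w | _] = set0); last by apply/seteqP; split.
  by rewrite measure0.
have r01 : 0 <= iter n G 0 <= 1.
  rewrite -!lee_fin -(IH [::]) measure_ge0 probability_le1//.
  exact: group_sigma_measurable Fm _ _ (dead_sigma n [::]).
rewrite (prob_random_conjunction P F Fm FI FT Find (emb v) (X v)
  (fun j => subtree (rcons v j)) (fun j => [set w | dead n (rcons v j) w])).
- rewrite -(nneseries_EFin _ _ (p_gen _ r01)); apply: eq_eseriesr => k _.
  rewrite X_law EFinM; congr (_ * _)%E.
  under eq_bigr do rewrite IH.
  by rewrite prodEFin prodr_const card_ord.
- exact: FX.
- by move=> j; exact: dead_sigma.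
- move=> j [u /= vu /emb_inj uv].
  by move: vu; rewrite uv => /size_prefix; rewrite size_rcons ltnn.
- move=> i j ij.
  apply/seteqP; split => // _ /= [[u /= iu <-] [u' /= ju /emb_inj uu]].
  rewrite {}uu in ju; move: ij; rewrite (_ : i = j) ?eqxx//.
  have := prefixP iu; have := prefixP ju => -[s1 ->] [s2].
  by rewrite !cat_rcons => /eqP; rewrite eqseq_cat// => /andP[_ /eqP[->]].
Qed.

(** The probability of having more than [j] children, that is, of possessing a child numbered
    [j]. *)
Let tail j : \bar R := (\sum_(k <oo) (if (j < k)%N then (p k)%:E else 0))%E.

Hypothesis p_ge0 : forall k, 0 <= p k.

Let prob_tail s j : P (X s @^-1` [set m | (j < m)%N]) = tail j.
Proof.
rewrite (_ : _ @^-1` _ = \bigcup_(k in [set k | (j < k)%N]) (X s @^-1` [set k])); last first.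
  apply/seteqP; split => w /=; first by move=> jX; exists (X s w).
  by move=> [k /= jk ->].
rewrite measure_bigcup//.
- rewrite eseries_mkcond; apply: eq_eseriesr => k _.
  rewrite in_set_pred; case: ifP => // _; exact: X_law.
- by move=> k _; exact: Fm (FX s _).
- by apply/trivIsetP => i k _ _ ik; apply/seteqP; split => // w /= [-> /eqP]; rewrite (negbTE ik).
Qed.

Lemma alive_sigma (s : seq nat) :
  <<s group_gen F (range emb) >> [set w | alive (fun u => X u w) s].
Proof.
rewrite (_ : [set w | _] = \bigcap_(k in `I_(size s))
    X (take k s) @^-1` [set m | (nth 0 s k < m)%N]).
  apply: (@fin_bigcap_measurable _ (g_sigma_algebraType (group_gen F (range emb)))) => // k _.
  by apply: sub_sigma_algebra; exists (emb (take k s)) => //; exact: FX.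
apply/seteqP; split => w /=.
  by move=> /allP H k /= ks; apply: H; rewrite mem_iota.
by move=> H; apply/allP => k; rewrite mem_iota/= add0n => /H.
Qed.

(** Each letter of [s] tests the offspring number of a different ancestor; the ancestors [take k s]
    are told apart by their lengths. *)
Lemma prob_alive (s : seq nat) :
  P [set w | alive (fun u => X u w) s] = (\prod_(j <- s) tail j)%E.
Proof.
pose A k := X (take k s) @^-1` [set m | (nth 0 s k < m)%N].
rewrite (_ : [set w | _] = \bigcap_(k in [set` iota 0 (size s)]) A k); last first.
  apply/seteqP; split => w /=; first by move=> /allP H k /= ks; exact: H.
  by move=> H; apply/allP => k; exact: H.
rewrite (group_independent P F Fm FI FT Find _ (fun k => [set emb (take k s)])).
- rewrite [RHS](big_nth 0) /index_iota subn0.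
  by apply: eq_bigr => k _; exact: prob_tail.
- exact: iota_uniq.
- move=> k l; rewrite !mem_iota/= !add0n => ks ls kl.
  apply/seteqP; split => // _ /= [-> /emb_inj/(congr1 size)].
  by rewrite !size_takel ?(ltnW ks) ?(ltnW ls)// => /eqP; rewrite (negbTE kl).
- by move=> k _; apply: sub_sigma_algebra; exists (emb (take k s)) => //; exact: FX.
Qed.

Hypothesis p_mean : series (fun k => k%:R * p k) @ \oo --> (1 : R).

Let tail_ge0 j : (0 <= tail j)%E.
Proof. by apply: nneseries_ge0 => k _ _; case: ifP => // _; rewrite lee_fin. Qed.

Let tail_sum : (\esum_(j in [set: nat]) tail j = 1)%E.
Proof.
rewrite -nneseries_esumT// /tail nneseries_interchange; last first.
  by move=> i j; case: ifP => // _; rewrite lee_fin.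
rewrite -(nneseries_EFin _ _ p_mean); apply: eq_eseriesr => k _.
rewrite (nneseries_split 0 k); last by move=> i _; case: ifP => // _; rewrite lee_fin.
rewrite add0n [X in (_ + X)%E]eseries0 ?adde0; last first.
  by move=> i ki _; rewrite ltnNge ki.
rewrite big_mkord (eq_bigr (fun=> (p k)%:E)); last by move=> i _; rewrite ltn_ord.
by rewrite sumEFin sumr_const card_ord mulr_natl.
Qed.

(** The sum is the expected size of generation [n]. It factors over the letters, and each factor is
    the sum of the tails, which is the offspring mean 1. *)
Lemma sum_prob_alive n :
  (\esum_(s in [set s | size s = n]) P [set w | alive (fun u => X u w) s] = 1)%E.
Proof.
under eq_esum do rewrite prob_alive.
elim: n => [|n IH].
  rewrite (_ : [set s | _] = [set [::]]); last first.
    by apply/seteqP; split => s /=; [move/size0nil|move=> ->].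
  by rewrite esum_set1 big_nil.
pose e (x : nat * seq nat) := x.1 :: x.2.
have be : set_bij ([set: nat] `*`` (fun=> [set s : seq nat | size s = n]))
    [set s : seq nat | size s = n.+1] e.
  split.
  - by move=> [j s] [_ /= <-].
  - by move=> [j s] [j' s'] _ _ [/= -> ->].
  - by move=> [//|j s] [/= sn]; exists (j, s).
rewrite (reindex_esum _ _ _ _ be).
under eq_esum do rewrite /e big_cons.
have p0 (s : seq nat) : (0 <= \prod_(j <- s) tail j)%E by exact: prode_ge0.
rewrite -(@esum_esum _ _ _ [set: nat] (fun=> [set s | size s = n])
  (fun j s => tail j * \prod_(i <- s) tail i)%E).
  under eq_esum do rewrite esumZl// IH mule1.
  exact: tail_sum.
by move=> j s _ _; rewrite mule_ge0.
Qed.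

End Tree.

(** * Critical offspring laws *)

Section CriticalOffspring.
Context {R : realType}.
Variables (p : nat -> R) (beta : R) (L : R -> R).
Hypothesis beta_gt0 : 0 < beta.
Hypothesis p_law : offspring_law p.
Hypothesis p_mean : series (fun k => k%:R * p k) @ \oo --> (1 : R).
Hypothesis p_gen : forall s : R, 0 <= s <= 1 ->
  series (fun k => p k * s ^+ k) @ \oo --> s + (1 - s) `^ (1 + beta) * L (1 - s).

Definition excess (s : R) : R := s `^ (1 + beta) * L s.

Let p_ge0 k : 0 <= p k. Proof. by case: p_law. Qed.
Let p_sum : series p @ \oo --> (1 : R). Proof. by case: p_law => _ []. Qed.

(** Since [p] has mass 1 and mean 1, [excess] is the [p]-average of these functions. Positivity and
    convexity can therefore be checked term by term, with [phiS] as recursion. *)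
Let phi k (s : R) : R := (1 - s) ^+ k - 1 + k%:R * s.

Let phiS k s : phi k.+1 s = (1 - s) * phi k s + k%:R * s ^+ 2.
Proof. by rewrite /phi exprS -natr1; ring. Qed.

Let phi_ge0 k s : 0 <= s <= 1 -> 0 <= phi k s.
Proof.
move=> /andP[s0 s1]; elim: k => [|k IH]; first by rewrite /phi expr0 mul0r; lra.
by rewrite phiS addr_ge0 ?mulr_ge0 ?sqr_ge0//; lra.
Qed.

Let phi_gt0 k s : 0 < s <= 1 -> 0 < phi k.+2 s.
Proof.
move=> /andP[s0 s1]; rewrite phiS ltr_wpDl ?mulr_gt0 ?exprn_gt0//.
by rewrite mulr_ge0 ?phi_ge0//; lra.
Qed.

Let pow_conv k (x y z : R) : 0 <= z -> z <= y -> y <= x ->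
  (y ^+ k - z ^+ k) * (x - y) <= (x ^+ k - y ^+ k) * (y - z).
Proof.
move=> z0 zy yx; have y0 := le_trans z0 zy; have x0 := le_trans y0 yx.
elim: k => [|k IH]; first by rewrite !expr0 !subrr !mul0r.
have zx : z ^+ k <= x ^+ k by apply: lerXn2r; rewrite ?nnegrE// (le_trans zy).
have H1 : y * ((y ^+ k - z ^+ k) * (x - y)) <= y * ((x ^+ k - y ^+ k) * (y - z)).
  exact: ler_wpM2l.
have H2 : z ^+ k * ((y - z) * (x - y)) <= x ^+ k * ((y - z) * (x - y)).
  by apply: ler_wpM2r => //; rewrite mulr_ge0 ?subr_ge0.
rewrite !exprS; lra.
Qed.

Let phi_conv k a b c : 0 <= a -> a < b -> b < c -> c <= 1 ->
  (phi k b - phi k a) * (c - b) <= (phi k c - phi k b) * (b - a).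
Proof.
move=> a0 ab bc c1.
have := @pow_conv k (1 - a) (1 - b) (1 - c).
rewrite /phi => H; have {}H := H _ _ _.
have : ((1 - b) ^+ k - (1 - c) ^+ k) * (1 - a - (1 - b)) <=
       ((1 - a) ^+ k - (1 - b) ^+ k) * (1 - b - (1 - c)) by apply: H; lra.
lra.
Qed.

Let series_excess s : 0 <= s <= 1 -> series (fun k => p k * phi k s) @ \oo --> excess s.
Proof.
move=> s01.
have s01' : 0 <= 1 - s <= 1 by lra.
have H1 := p_gen (1 - s) s01'.
rewrite subKr -/(excess s) in H1.
have H2 : s * series (fun k => k%:R * p k) n @[n --> \oo] --> s * 1.
  by apply: cvgM; [exact: cvg_cst|exact: p_mean].
have H3 : series (fun k => p k * (1 - s) ^+ k) n - series p n +
    s * series (fun k => k%:R * p k) n @[n --> \oo] --> (1 - s + excess s) - 1 + s * 1.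
  by apply: cvgD => //; apply: cvgB.
have -> : excess s = (1 - s + excess s) - 1 + s * 1 by lra.
apply: cvg_trans H3; apply: near_eq_cvg; apply: nearW => n /=.
rewrite /series/= mulr_sumr -sumrB -big_split/=.
by apply: eq_bigr => k _; rewrite /phi; ring.
Qed.

Let pos_series (t : nat -> R) (l : R) k : (forall i, 0 <= t i) -> 0 < t k ->
  series t @ \oo --> l -> 0 < l.
Proof.
move=> t0 tk tl; apply: (lt_le_trans tk).
have nd : nondecreasing_seq (series t).
  by apply: nondecreasing_series => i _ _; exact: t0.
have cv : cvgn (series t) by apply/cvg_ex; exists l.
have := nondecreasing_cvgn_le nd cv k.+1; rewrite (cvg_lim _ tl)//.
apply: le_trans; rewrite seriesSr lerDr /series/=; exact: sumr_ge0.
Qed.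

Let nonneg_series (t : nat -> R) (l : R) : (forall i, 0 <= t i) ->
  series t @ \oo --> l -> 0 <= l.
Proof.
move=> t0 tl; rewrite -(cvg_lim _ tl)//; apply: limr_ge; first by apply/cvg_ex; exists l.
by apply: nearW => n; rewrite /series/=; exact: sumr_ge0.
Qed.

(** Otherwise the mean would equal [p 1], which is below 1. This index makes the inequalities on
    [excess] strict. *)
Lemma offspring_ge2 : exists k, 0 < p k.+2.
Proof.
apply: contrapT => /forallNP H.
have p0 k : p k.+2 = 0.
  by apply/eqP; rewrite eq_le p_ge0 andbT leNgt; apply/negP => /H.
have C : series (fun k => k%:R * p k) @ \oo --> p 1%N.
  rewrite -(cvg_shiftn 2); apply: cvg_near_cst; apply: nearW => n /=.
  rewrite /series/= addn2 big_nat_recl// big_nat_recl//= mul0r add0r mul1r.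
  by rewrite big1 ?addr0// => i _; rewrite p0 mulr0.
have [_ [_ [_ p1]]] := p_law.
by move: p1; rewrite -(cvg_lim _ C)// (cvg_lim _ p_mean)// ltxx.
Qed.

Lemma excess0 : excess 0 = 0.
Proof. by rewrite /excess powR0 ?mul0r// gt_eqF// addr_gt0. Qed.

Lemma excess_gt0 s : 0 < s <= 1 -> 0 < excess s.
Proof.
move=> /[dup] s01 /andP[s0 s1]; have [k pk] := offspring_ge2.
have s01' : 0 <= s <= 1 by rewrite ltW.
apply: (@pos_series _ _ k.+2 _ _ (series_excess s s01')).
  by move=> i; rewrite mulr_ge0// phi_ge0.
by rewrite mulr_gt0// phi_gt0.
Qed.

(** [s - excess s] is one minus the generating function at [1 - s], a series of nonnegative terms
    [p k * (1 - (1 - s) ^+ k)]. *)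
Lemma excess_lt s : 0 < s <= 1 -> excess s < s.
Proof.
move=> /andP[s0 s1]; have [k pk] := offspring_ge2.
have s01' : 0 <= 1 - s <= 1 by lra.
have H1 := p_gen (1 - s) s01'; rewrite subKr -/(excess s) in H1.
have u1 i : (1 - s) ^+ i <= 1 by rewrite exprn_ile1//; lra.
have H : series (fun k => p k * (1 - (1 - s) ^+ k)) @ \oo --> 1 - (1 - s + excess s).
  apply: cvg_trans (cvgB p_sum H1); apply: near_eq_cvg; apply: nearW => n /=.
  by rewrite fctE /series/= -sumrB; apply: eq_bigr => i _; ring.
suff : 0 < 1 - (1 - s + excess s) by lra.
apply: (@pos_series _ _ k.+2 _ _ H).
  by move=> i; rewrite mulr_ge0// subr_ge0.
rewrite mulr_gt0// subr_gt0 exprS; have := u1 k.+1.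
have : 0 <= (1 - s) ^+ k.+1 by rewrite exprn_ge0//; lra.
nra.
Qed.

Lemma excess_conv a b c : 0 <= a -> a < b -> b < c -> c <= 1 ->
  (excess b - excess a) * (c - b) <= (excess c - excess b) * (b - a).
Proof.
move=> a0 ab bc c1; rewrite -subr_ge0.
have Sa : 0 <= a <= 1 by lra.
have Sb : 0 <= b <= 1 by lra.
have Sc : 0 <= c <= 1 by lra.
apply: (@nonneg_series (fun k => p k * ((phi k c - phi k b) * (b - a) -
    (phi k b - phi k a) * (c - b)))).
  by move=> i; rewrite mulr_ge0// subr_ge0 phi_conv.
have H1 : (series (fun k => p k * phi k c) n - series (fun k => p k * phi k b) n) * (b - a) -
    (series (fun k => p k * phi k b) n - series (fun k => p k * phi k a) n) * (c - b)
    @[n --> \oo] --> (excess c - excess b) * (b - a) - (excess b - excess a) * (c - b).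
  by apply: cvgB; apply: cvgM; try exact: cvg_cst; apply: cvgB; exact: series_excess.
apply: cvg_trans H1; apply: near_eq_cvg; apply: nearW => n /=.
rewrite /series/= -!sumrB !mulr_suml -sumrB; apply: eq_bigr => i _; ring.
Qed.

End CriticalOffspring.

(** * Randomly shifted lattices *)

Lemma integral_esum {R : realType} {dT : measure_display} {T : measurableType dT}
    (mu : {measure set T -> \bar R}) {Z : countType} (f : Z -> T -> \bar R) :
  (forall z, measurable_fun setT (f z)) -> (forall z w, 0 <= f z w)%E ->
  (\int[mu]_w (\esum_(z in [set: Z]) f z w) = \esum_(z in [set: Z]) \int[mu]_w f z w)%E.
Proof.
move=> mf f0.
under eq_integral do rewrite esum_pickle//.
rewrite integral_nneseries//.
- rewrite esum_pickle; last by move=> z; exact: integral_ge0.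
  by apply: eq_eseriesr => k _; case: pickle_inv => //=; rewrite integral0.
- by move=> k; case: pickle_inv => [z|] /=; [exact: mf|exact: measurable_cst].
- by move=> k w _; case: pickle_inv => [z|] /=.
Qed.

Section Shift.
Context {R : realType} {d : nat} {dT : measure_display} {T : measurableType dT}.
Variable P : probability T R.
Context {I : eqType}.
Variable F : I -> set (set T).
Hypothesis Fm : forall i, F i `<=` measurable.
Hypothesis FI : forall i, setI_closed (F i).
Hypothesis FT : forall i, F i setT.
Hypothesis Find : mutually_independent P F.
Variables JD JU : set I.
Hypothesis JDU : JD `&` JU = set0.
Local Notation TD := (g_sigma_algebraType (group_gen F JD)).
Local Notation TU := (g_sigma_algebraType (group_gen F JU)).
Variables (U D : 'I_d -> T -> R).
Hypothesis mU : forall i, measurable_fun setT (U i : TU -> R).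
Hypothesis mD : forall i, measurable_fun setT (D i : TD -> R).
Hypothesis U_unif : forall i t, 0 <= t <= 1 -> P (U i @^-1` `]-oo, t]%classic) = t%:E.
Hypothesis U_indep : forall f : 'I_d -> R -> R,
  (forall i, measurable_fun setT (f i)) -> (forall i x, 0 <= f i x) ->
  (\int[P]_w (\prod_(i < d) f i (U i w))%:E = \prod_(i < d) \int[P]_w (f i (U i w))%:E)%E.

Let mUT i : measurable_fun setT (U i).
Proof.
move=> _ A mA; apply: (group_sigma_measurable _ Fm JU).
exact: mU.
Qed.

Let mDT i : measurable_fun setT (D i).
Proof.
move=> _ A mA; apply: (group_sigma_measurable _ Fm JD).
exact: mD.
Qed.

(* The cubes tile the space and [D] is independent of [U], so that conditionally
   on [D] the points [z + U + D] have Lebesgue intensity. *)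
Lemma shift_sum (A : set T) (u : R) : 0 < u -> <<s group_gen F JD >> A ->
  (\esum_(z in [set: 'rV[int]_d])
     P (A `&` [set w | @Defs.ball0 R d u (fun i => (z ord0 i)%:~R + U i w + D i w)%R]) =
   P A * (vol_ball d u)%:E)%E.
Proof.
move=> u0 AD.
have mA : measurable A by exact: group_sigma_measurable Fm _ _ AD.
pose S (z : 'rV[int]_d) : set (TD * TU) := [set x | A x.1 /\
  @Defs.ball0 R d u (fun i => (z ord0 i)%:~R + U i x.2 + D i x.1)].
have mS z : measurable (S z).
  apply: measurableI.
    rewrite -[X in measurable X]setTI.
    exact: (@measurable_fst _ _ TD TU).
  rewrite ball0E//; apply: measurable_set_lt; last exact: measurable_cst.
  apply: measurable_sum => i; apply: measurable_funX.
  apply: measurable_funD; last exact: measurableT_comp (mD i) measurable_fst.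
  apply: measurable_funD; first exact: measurable_cst.
  exact: measurableT_comp (mU i) measurable_snd.
pose H (x : TD * TU) : \bar R := (\esum_(z in [set: 'rV[int]_d]) (\1_(S z) x)%:E)%E.
have H0 z (x : TD * TU) : (0 <= (\1_(S z) x : R)%:E)%E by rewrite lee_fin.
have mH : measurable_fun setT H.
  rewrite /H; under eq_fun do rewrite esum_pickle//.
  apply: ge0_emeasurable_sum => // [k x _ _|k _]; first by case: pickle_inv => //=.
  by case: pickle_inv => [z|] //=; apply/measurable_EFinP; exact: measurable_indic.
have mdiag z : measurable [set w : T | S z (w, w)].
  rewrite (_ : [set w | _] = A `&`
      [set w | normsq (fun i => (z ord0 i)%:~R + U i w + D i w) < u ^+ 2]).
    apply: measurableI => //; apply: measurable_set_lt => //.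
    apply: measurable_sum => i; apply: measurable_funX.
    apply: measurable_funD; last exact: mDT.
    by apply: measurable_funD.
  by rewrite /S ball0E.
have msec z (w : T) : measurable [set v : T | S z (w, v)].
  rewrite /S/=; have [Aw|Aw] := pselect (A w); last first.
    rewrite (_ : [set v | _] = set0)//.
    by apply/seteqP; split => // v /= -[].
  rewrite (_ : [set v | _] = [set v | normsq (fun i => (z ord0 i)%:~R + U i v + D i w) < u ^+ 2]).
    apply: measurable_set_lt => //; apply: measurable_sum => i; apply: measurable_funX.
    by apply: measurable_funD => //; apply: measurable_funD.
  by rewrite ball0E//; apply/seteqP; split => v /= => [[]|].
transitivity (\int[P]_w H (w, w))%E.
  rewrite /H integral_esum//.
    apply: eq_esum => z _.
    transitivity (\int[P]_w (\1_[set w | S z (w, w)] w)%:E)%E; last by [].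
    by rewrite integral_indic// setIT.
  move=> z; apply/measurable_EFinP.
  exact: (measurable_indic (mdiag z)).
rewrite (decoupling P F Fm FI FT Find _ _ JDU)//; last first.
  by move=> x; exact: esum_ge0.
transitivity (\int[P]_w ((vol_ball d u)%:E * (\1_A w)%:E))%E; last first.
  rewrite ge0_integralZl//; last first.
  - rewrite -(lebesgued_ball P U mUT U_unif U_indep u u0).
    exact: measure_ge0.
  - by apply/measurable_EFinP; exact: measurable_indic.
  by rewrite integral_indic// setIT muleC.
apply: eq_integral => w _; rewrite /H integral_esum//; last first.
  move=> z; apply/measurable_EFinP; exact: (measurable_indic (msec z w)).
have E z : (\int[P]_v (\1_(S z) (w, v))%:E = P [set v | S z (w, v)])%E.
  transitivity (\int[P]_v (\1_[set v | S z (w, v)] v)%:E)%E; first by [].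
  by rewrite integral_indic// setIT.
under eq_esum do rewrite E.
rewrite indicE; have [Aw|Aw] := pselect (A w); last first.
  rewrite memNset//.
  rewrite mule0 esum1// => z _.
  rewrite (_ : [set v | _] = set0) ?measure0//.
  by apply/seteqP; split => // v /= -[].
rewrite mem_set// mule1 -(lebesgued_ball P U mUT U_unif U_indep u u0).
(* The displacement is frozen at [w], so the count of shifted points is the measure of a translated
   ball. *)
rewrite (lebesgued_affine P U mUT U_unif U_indep 1 (fun i => D i w))//; last first.
  by rewrite ball0E//; exact: measurable_normsq_lt.
rewrite expr1n mul1e /lebesgued sum_lawE; apply: eq_esum => z _.
have vE v : (fun i => 1 * cube_point U z v i + D i w) =
    (fun i => (z ord0 i)%:~R + U i v + D i w).
  by apply/funext => i; rewrite mul1r.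
congr (P _); apply/seteqP; split => v /=; rewrite vE; first by case.
by move=> vb; split.
Qed.

End Shift.

(** * Poisson numbers of trials and infinite products *)

Lemma poisson_series {R : realType} (y : R) :
  series (fun k => expR (-1) / k`!%:R * y ^+ k) @ \oo --> expR (y - 1).
Proof.
rewrite (_ : series _ = (fun n => expR (-1) * series (exp_coeff y) n)).
  rewrite addrC expRD; apply: cvgM; first exact: cvg_cst.
  exact: is_cvg_series_exp_coeff.
apply/funext => n; rewrite /series/= mulr_sumr; apply: eq_bigr => k _.
by rewrite /exp_coeff/= [y ^+ k / _]mulrC mulrA.
Qed.

Section PoissonThinning.
Context {R : realType}.
Variables (h : nat -> R) (x : R).
Hypothesis h01 : forall j, 0 <= h j <= 1.

Lemma poisson_thinning_le : (forall j, x <= h j) -> 0 <= x ->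
  (\sum_(k <oo) (expR (-1) / k`!%:R)%:E * \prod_(j < k) (1 - h j)%:E <= (expR (- x))%:E)%E.
Proof.
move=> xh x0; rewrite (_ : - x = (1 - x) - 1); last by ring.
rewrite -(nneseries_EFin _ _ (poisson_series (1 - x))).
apply: lee_nneseries => k _.
  by rewrite mule_ge0 ?lee_fin// prode_ge0// => j _; rewrite lee_fin subr_ge0; case/andP: (h01 j).
rewrite prodEFin -EFinM lee_fin; apply: ler_wpM2l => //.
rewrite -[k in X in _ <= X]card_ord -prodr_const.
apply: ler_prod => j _; rewrite lerD2l lerN2 xh andbT subr_ge0.
by case/andP: (h01 j).
Qed.

Lemma poisson_thinning_ge : (forall j, h j <= x) ->
  ((expR (- x))%:E <= \sum_(k <oo) (expR (-1) / k`!%:R)%:E * \prod_(j < k) (1 - h j)%:E)%E.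
Proof.
(* The rate [x] may exceed 1; capping it keeps [1 - y] nonnegative, as comparing products requires,
   and only increases the exponential. *)
move=> hx; set y := Num.min x 1.
have hy j : h j <= y by rewrite le_min hx; case/andP: (h01 j).
apply: (@le_trans _ _ (expR (- y))%:E).
  by rewrite lee_fin ler_expR lerN2 ge_min lexx.
rewrite (_ : - y = (1 - y) - 1); last by ring.
have y1 : 0 <= 1 - y by rewrite subr_ge0 ge_min lexx orbT.
rewrite -(nneseries_EFin _ _ (poisson_series (1 - y))).
apply: lee_nneseries => k _.
  by rewrite lee_fin mulr_ge0// exprn_ge0.
rewrite prodEFin -EFinM lee_fin; apply: ler_wpM2l => //.
rewrite -[k in X in X <= _]card_ord -prodr_const.
by apply: ler_prod => j _; rewrite y1 lerD2l lerN2 hy.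
Qed.

End PoissonThinning.

Section IndependentIntersection.
Context {R : realType} {dT : measure_display} {T : measurableType dT}.
Variables (P : probability T R) (B : nat -> set T).
Hypothesis mB : forall k, measurable (B k).
Hypothesis B_prod : forall m,
  P (\bigcap_(k in [set` iota 0 m]) B k) = (\prod_(k <- iota 0 m) P (B k))%E.
Variables (a : nat -> R) (S : R).
Hypothesis a_ge0 : forall k, 0 <= a k.
Hypothesis aS : (\sum_(k <oo) (a k)%:E = S%:E)%E.

Let sum_le m : \sum_(k <- iota 0 m) a k <= S.
Proof.
rewrite -lee_fin -aS -sumEFin -[m in iota _ m]subn0 -/(index_iota 0 m).
by apply: nneseries_lim_ge => k _ _; rewrite lee_fin.
Qed.

Let sum_cvg : (fun m => \sum_(k <- iota 0 m) a k) @ \oo --> S.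
Proof.
rewrite (_ : (fun m => _) = series a); last first.
  by apply/funext => m; rewrite /series/= /index_iota subn0.
apply: (@fine_cvg _ _ _ _ (EFin \o series a)); rewrite -aS.
rewrite (_ : _ \o _ = (fun n => \sum_(0 <= k < n) (a k)%:E)%E).
  by apply: is_cvg_nneseries => k _ _; rewrite lee_fin.
by apply/funext => n /=; rewrite sumEFin.
Qed.

Let prod_exp m : (\prod_(k <- iota 0 m) (expR (- a k))%:E)%E = (expR (- \sum_(k <- iota 0 m) a k))%:E.
Proof. by rewrite prodEFin -expR_sum sumrN. Qed.

Let mcap m : measurable (\bigcap_(k in [set` iota 0 m]) B k).
Proof.
rewrite bigcap_seq; exact: bigsetI_measurable.
Qed.

Lemma prob_bigcap_le : (forall k, P (B k) <= (expR (- a k))%:E)%E ->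
  (P (\bigcap_k B k) <= (expR (- S))%:E)%E.
Proof.
move=> Ba.
have mI : measurable (\bigcap_k B k) by exact: bigcapT_measurable.
rewrite -(@fineK _ (P _)); last exact: fin_num_measure.
rewrite lee_fin.
have : (fun m => expR (- \sum_(k <- iota 0 m) a k)) @ \oo --> expR (- S).
  apply: continuous_cvg; first exact: continuous_expR.
  exact: cvgN sum_cvg.
move=> /cvgr_to_ge; apply; apply: nearW => m.
rewrite -lee_fin fineK; last exact: fin_num_measure.
rewrite -prod_exp.
apply: (@le_trans _ _ (P (\bigcap_(k in [set` iota 0 m]) B k))).
  apply: le_measure; rewrite ?inE//.
  by move=> w H k _; exact: H.
rewrite B_prod; apply: lee_prod => k; first exact: measure_ge0.
exact: Ba.
Qed.

(** Finite intersections decrease to the full one, and each has probability at least the exponential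
    of minus a partial sum, hence at least [expR (- S)]. *)
Lemma prob_bigcap_ge : (forall k, (expR (- a k))%:E <= P (B k))%E ->
  ((expR (- S))%:E <= P (\bigcap_k B k))%E.
Proof.
move=> Ba.
have IE : \bigcap_k B k = \bigcap_m \bigcap_(k in [set` iota 0 m]) B k.
  apply/seteqP; split => w H.
    by move=> m _ k _; exact: H.
  move=> k _; have kk : k \in iota 0 k.+1 by rewrite mem_iota add0n ltnSn.
  exact: (H k.+1 Logic.I k kk).
rewrite IE.
have : (P \o (fun m => \bigcap_(k in [set` iota 0 m]) B k)) @ \oo -->
    P (\bigcap_m \bigcap_(k in [set` iota 0 m]) B k).
  apply: nonincreasing_cvg_mu => //.
  - by rewrite ltey_eq fin_num_measure.
  - exact: bigcapT_measurable.
  - move=> m k mk; apply/subsetPset => w H i /=; rewrite mem_iota/= add0n => im.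
    by apply: H => /=; rewrite mem_iota/= add0n (leq_trans im).
move=> /cvge_to_ge; apply; apply: nearW => m /=.
rewrite B_prod; apply: (@le_trans _ _ (\prod_(k <- iota 0 m) (expR (- a k))%:E)%E).
  by rewrite prod_exp lee_fin ler_expR lerN2.
by apply: lee_prod => k; [rewrite lee_fin expR_ge0|exact: Ba].
Qed.

End IndependentIntersection.

(** * Tail of the displacement of a particle *)

Lemma measure_bigsetU_le {R : realType} {dT : measure_display} {T : measurableType dT}
    (mu : {measure set T -> \bar R}) (I : Type) (s : seq I) (B : I -> set T) :
  (forall i, measurable (B i)) ->
  (mu (\big[setU/set0]_(i <- s) B i) <= \sum_(i <- s) mu (B i))%E.
Proof.
move=> mB; elim: s => [|i s IH]; first by rewrite !big_nil measure0.
rewrite !big_cons; apply: (le_trans (measureU2 _ _ _)) => //.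
  exact: bigsetU_measurable.
exact: leeD2l.
Qed.

Section NormTail.
Context {R : realType} {dT : measure_display} {T : measurableType dT}.
Variable P : probability T R.
Variables (t alpha A : R).
Hypothesis t12 : 1 <= t <= 2.
Hypothesis talpha : t <= alpha.
Hypothesis A0 : 0 <= A.
Variables (d n : nat) (Y : 'I_d -> 'I_n -> T -> R).
Hypothesis mY : forall i k, measurable_fun setT (Y i k).
Hypothesis iY : forall i k, P.-integrable setT (EFin \o Y i k).
Hypothesis EY : forall i k, (\int[P]_w (Y i k w)%:E = 0)%E.
Hypothesis AY : forall i k, (\int[P]_w (`|Y i k w| `^ alpha)%:E <= A%:E)%E.
Hypothesis Y_indep : forall i (f : R -> R), measurable_fun setT f -> (forall x, 0 <= f x) ->
  (\int[P]_w (\prod_(k < n) f (Y i k w))%:E = \prod_(k < n) \int[P]_w (f (Y i k w))%:E)%E.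

(** If every coordinate stays below [z] in absolute value, the squared norm is below
    $dz^2\le(dz)^2$. This leaves [2 * d] one-sided events; the negative ones are tails of the sums
    of [- Y]. *)
Lemma normsq_tail (K : nat) (y : R) : (0 < d)%N -> (0 < n)%N -> 0 < y ->
  (P [set w | ((d%:R * (3 * K%:R * y)) ^+ 2 <= normsq (fun i => \sum_(k < n) Y i k w))%R] <=
   (2 * d%:R * (n%:R * (A / y `^ alpha) + expR 1 * (n%:R * (1 + A) / y `^ t) ^+ K))%:E)%E.
Proof.
move=> d0 n0 y0; set z := 3 * K%:R * y; set b := (X in (2 * d%:R * X)%R).
have z0 : 0 <= z by rewrite !mulr_ge0// ltW.
pose D i w := \sum_(k < n) Y i k w.
have mD i : measurable_fun setT (D i) by exact: measurable_sum.
have mge (f : T -> R) x : measurable_fun setT f -> measurable [set w | x <= f w].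
  move=> mf; rewrite (_ : [set w | _] = ~` [set w | f w < x]).
    by apply: measurableC; exact: measurable_set_lt.
  by apply/seteqP; split => w /=; rewrite leNgt => /negP.
pose B i := [set w | z <= D i w] `|` [set w | z <= - D i w].
have mB i : measurable (B i).
  by apply: measurableU; apply: mge => //; exact: measurableT_comp.
have PB i : (P (B i) <= (2 * b)%:E)%E.
  apply: (le_trans (measureU2 _ _ _)); [by apply: mge|by apply: mge; exact: measurableT_comp|].
  rewrite mulrDl !mul1r EFinD; apply: leeD.
    exact: (sum_tail P t alpha A t12 talpha A0 n (Y i) (mY i) (iY i) (EY i) (AY i) (Y_indep i)).
  under eq_set do rewrite /D -sumrN.
  apply: (sum_tail P t alpha A t12 talpha A0 n (fun k w => - Y i k w)) => //.
  - by move=> k; exact: measurableT_comp.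
  - by move=> k; rewrite (_ : _ \o _ = \- (EFin \o Y i k))%E//; exact: integrableN.
  - move=> k; under eq_integral do rewrite EFinN.
    rewrite (@integralN _ _ _ P _ (EFin \o Y i k)) ?EY ?oppe0//.
    exact: (integrable_add_def measurableT (iY i k)).
  - by move=> k; under eq_integral do rewrite normrN; exact: AY.
  - move=> f mf f0; apply: (Y_indep i (fun x => f (- x))) => //.
    exact: (measurableT_comp mf).
apply: (@le_trans _ _ (P (\big[setU/set0]_(i < d) B i))).
  apply: le_measure; rewrite ?inE.
  - by apply: mge; apply: measurable_sum => i; apply: measurable_funX; exact: mD.
  - exact: bigsetU_measurable.
  - move=> w /= far; rewrite -bigcup_seq.
    apply: contrapT => H; move: far; apply/negP; rewrite -ltNge.
    have Dz i : D i w ^+ 2 < z ^+ 2.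
      have /not_orP[/negP zD /negP zND] : ~ B i w.
        by move=> Bw; apply: H; exists i => //=; rewrite mem_index_enum.
      rewrite -!ltNge in zD zND.
      rewrite -ltr_sqrt ?sqrtr_sqr; last first.
        by rewrite exprn_gt0//; move: zD zND; lra.
      rewrite (ger0_norm z0) ltr_norml; apply/andP; split=> //.
      by rewrite ltrNl.
    apply: (@lt_le_trans _ _ (\sum_(i < d) z ^+ 2)).
      rewrite /normsq; apply: ltr_sum; first by apply/hasP; exists (Ordinal d0); rewrite ?mem_index_enum.
      by move=> i _; exact: Dz.
    have -> : (d%:R * z) ^+ 2 = d%:R ^+ 2 * z ^+ 2 by exact: exprMn.
    rewrite sumr_const card_ord -(mulr_natl (z ^+ 2)) -subr_ge0 -mulrBl.
    apply: mulr_ge0; last exact: sqr_ge0.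
    by rewrite subr_ge0 -natrX ler_nat -{1}[d]mul1n leq_mul2r d0 orbT.
apply: (le_trans (measure_bigsetU_le _ _ _ _ mB)).
apply: (@le_trans _ _ (\sum_(i < d) (2 * b)%:E)%E).
  by apply: lee_sum => i _; exact: PB.
rewrite sumEFin lee_fin sumr_const card_ord -(mulr_natl (2 * b)).
by rewrite mulrCA mulrA.
Qed.

End NormTail.

Lemma eq_integral_law {R : realType} {dT : measure_display} {T : measurableType dT}
    (P : probability T R) (X Y : T -> R) (f : R -> \bar R) :
  measurable_fun setT X -> measurable_fun setT Y ->
  (forall A, measurable A -> P (X @^-1` A) = P (Y @^-1` A)) ->
  measurable_fun setT f -> (forall x, 0 <= f x)%E ->
  (\int[P]_w f (X w) = \int[P]_w f (Y w))%E.
Proof.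
move=> mX mY XY mf f0.
pose X' : {mfun T >-> R} := HB.pack X (isMeasurableFun.Build _ _ _ _ _ mX).
pose Y' : {mfun T >-> R} := HB.pack Y (isMeasurableFun.Build _ _ _ _ _ mY).
transitivity (\int[distribution P X']_x f x)%E; first by rewrite ge0_integral_distribution.
transitivity (\int[distribution P Y']_x f x)%E; last by rewrite ge0_integral_distribution.
by apply: eq_measure_integral => A mA _; exact: XY.
Qed.

(** * Void probabilities of the branching random walk *)

(** A triangle inequality without square roots: $(1+\varepsilon)(x+y)^2+(1+\varepsilon^{-1})y^2-x^2$
    is the square $(\varepsilon(x+y)+y)^2/\varepsilon$, and the weights add up to
    $(1+\varepsilon)^2u^2$. *)
Lemma normsq_split {R : realType} {d : nat} (x y : 'I_d -> R) (eps u : R) :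
  0 < eps -> 0 < u -> normsq (fun i => x i + y i) < u ^+ 2 ->
  normsq y < (eps * u) ^+ 2 -> normsq x < ((1 + eps) * u) ^+ 2.
Proof.
move=> e0 u0 xy yu.
have : normsq x <= (1 + eps) * normsq (fun i => x i + y i) + (1 + eps^-1) * normsq y.
  rewrite /normsq !mulr_sumr -big_split/=; apply: ler_sum => i _.
  rewrite -subr_ge0 (_ : _ - _ = (eps * (x i + y i) + y i) ^+ 2 / eps).
    by rewrite divr_ge0 ?sqr_ge0 ?(ltW e0).
  by field; rewrite gt_eqF.
move=> /le_lt_trans; apply.
rewrite (_ : _ ^+ 2 = (1 + eps) * u ^+ 2 + (1 + eps^-1) * (eps * u) ^+ 2); last first.
  by field; rewrite gt_eqF.
by rewrite ltrD// ltr_pM2l// addr_gt0// invr_gt0.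
Qed.

Lemma esum_one_eq0 {R : realType} {I : choiceType} (S : set I) :
  (\esum_(i in S) (1 : \bar R) = 0)%E <-> S = set0.
Proof.
split=> [S0|->]; last by rewrite esum_set0.
apply/seteqP; split => // i Si.
have : (1 <= \esum_(i in S) (1 : \bar R))%E.
  apply: esum_ge; exists [set i]; first by split=> // _ ->.
  by rewrite fsbig_set1.
by rewrite S0 lee_fin ler10.
Qed.

Section Model.
Context {R : realType} {d : nat} {dT : measure_display} {T : measurableType dT}.
Variables (P : probability T R) (p : nat -> R).
Variables (N : zd d -> T -> nat) (U : zd d -> nat -> 'I_d -> T -> R)
  (xi : zd d -> nat -> seq nat -> T -> nat) (Xd : zd d -> nat -> seq nat -> 'I_d -> T -> R)
  (xi0 : seq nat -> T -> nat) (Xd0 : seq nat -> 'I_d -> T -> R).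
Hypothesis model : is_brw_model P p N U xi Xd xi0 Xd0.

Local Notation F := (brw_class N U xi Xd xi0 Xd0).
Local Notation iN z := (inl (inl (inl z)) : brw_index d).
Local Notation iU z j i := (inl (inl (inr (z, j, i))) : brw_index d).
Local Notation ixi z j s := (inl (inr (inl (z, j, s))) : brw_index d).
Local Notation iX z j s i := (inl (inr (inr (z, j, s, i))) : brw_index d).

Lemma model_measurable c : F c `<=` measurable.
Proof.
have natm (Y : T -> nat) : (forall k, measurable (Y @^-1` [set k])) ->
    sigma_nat Y `<=` measurable.
  move=> mY _ [A ->]; rewrite (_ : Y @^-1` A = \bigcup_(k in A) Y @^-1` [set k]).
    exact: bigcup_measurable.
  apply/seteqP; split => w /=; first by move=> Yw; exists (Y w).
  by move=> [k Ak ->].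
have realm (Y : T -> R) : measurable_fun setT Y -> sigma_real Y `<=` measurable.
  by move=> mY _ [A mA ->]; rewrite -[X in measurable X]setTI; exact: mY.
have [[mN [mxi [mxi0 [mU mX]]]] _ _ _] := model.
case: c => [[[z|[[z j] i]]|[[[z j] s]|[[[z j] s] i]]]|[s|[s i]]] /=.
- exact: natm.
- exact: realm.
- exact: natm.
- exact/realm/(mX (inl (z, j, s, i))).
- exact: natm.
- exact/realm/(mX (inr (s, i))).
Qed.

Lemma model_setI c : setI_closed (F c).
Proof.
have natI (Y : T -> nat) : setI_closed (sigma_nat Y).
  by move=> _ _ [A ->] [B ->]; exists (A `&` B).
have realI (Y : T -> R) : setI_closed (sigma_real Y).
  by move=> _ _ [A mA ->] [B mB ->]; exists (A `&` B); first exact: measurableI.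
by case: c => [[[z|[[z j] i]]|[[[z j] s]|[[[z j] s] i]]]|[s|[s i]]] /=;
  by [exact: natI|exact: realI].
Qed.

Lemma model_setT c : F c setT.
Proof.
by case: c => [[[z|[[z j] i]]|[[[z j] s]|[[[z j] s] i]]]|[s|[s i]]] /=; exists setT.
Qed.

Lemma model_independent : mutually_independent P F.
Proof. by case: model. Qed.

Let Fm := model_measurable.
Let FI := model_setI.
Let FT := model_setT.
Let Find := model_independent.

Let mU z j i : measurable_fun setT (U z j i).
Proof. by have [[_ [_ [_ []]]]] := model. Qed.

Let mX z j s i : measurable_fun setT (Xd z j s i).
Proof. by have [[_ [_ [_ [_ /(_ (inl (z, j, s, i)))]]]]] := model. Qed.

Let U_unif z j i t : 0 <= t <= 1 -> P (U z j i @^-1` `]-oo, t]%classic) = t%:E.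
Proof. by have [_ [_ [_ [+ _]]] _ _] := model; apply. Qed.

Let FU z j i A : measurable A -> F (iU z j i) (U z j i @^-1` A).
Proof. by exists A. Qed.

Let FX z j s i A : measurable A -> F (iX z j s i) (Xd z j s i @^-1` A).
Proof. by exists A. Qed.

Lemma prod_group_independent (K : finType) (V : K -> T -> R) (c : K -> brw_index d) :
  injective c -> (forall k A, measurable A -> F (c k) (V k @^-1` A)) ->
  forall A, (forall k, measurable (A k)) ->
  P (\big[setI/setT]_(k : K) V k @^-1` A k) = (\prod_(k : K) P (V k @^-1` A k))%E.
Proof.
move=> c_inj FV A mA; rewrite -bigcap_seq.
rewrite (_ : \bigcap_(i in [set` index_enum K]) _ =
    \bigcap_(i in [set` index_enum K]) (V i @^-1` A i))//.
apply: (group_independent P F Fm FI FT Find K (fun k => [set c k])).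
- exact: index_enum_uniq.
- move=> k l _ _ kl; apply/seteqP; split => // _ /= [-> /c_inj klE].
  by rewrite klE eqxx in kl.
- by move=> k _; apply: sub_sigma_algebra; exists (c k) => //; exact: FV.
Qed.

Variable n : nat.

Definition walk z j (s : seq nat) (w : T) : 'I_d -> R :=
  fun i => \sum_(k < n) Xd z j (take k.+1 s) i w.

Lemma brw_pos_walk z j s w : size s = n ->
  brw_pos U Xd z j s w = (fun i => (z ord0 i)%:~R + U z j i w + walk z j s w i).
Proof.
move=> sn; apply/funext => i; rewrite /brw_pos /init_pos /disp_sum sn; congr (_ + _).
by rewrite big_add1 big_mkord.
Qed.

Local Notation K := ('I_d + 'I_n * 'I_d)%type.

(** The finitely many real variables that determine the position of [s]: the coordinates of its
    initial point and the displacements along its ancestral line. *)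
Definition cluster z j s (k : K) : T -> R :=
  match k with inl i => U z j i | inr (k, i) => Xd z j (take k.+1 s) i end.

Let cluster_index z j s (k : K) : brw_index d :=
  match k with inl i => iU z j i | inr (k, i) => iX z j (take k.+1 s) i end.

Let cluster_index_inj z j s : size s = n -> injective (cluster_index z j s).
Proof.
move=> sn [i|[k i]] [i'|[k' i']] //= [] => [->//|kk ->].
congr (inr (_, _)); apply: val_inj => /=.
have := congr1 size kk.
by rewrite !size_takel ?sn ?ltn_ord// => -[].
Qed.

Let measurable_cluster z j s k : measurable_fun setT (cluster z j s k).
Proof. by case: k => [i|[k i]] /=; [exact: mU|exact: mX]. Qed.

Let F_cluster z j s k A : measurable A ->
  F (cluster_index z j s k) (cluster z j s k @^-1` A).
Proof. by case: k => [i|[k i]] mA /=; exists A. Qed.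

(** Lets every particle of generation [n] be replaced by the reference word [s0] of the tree
    [(0, 0)], so that each later probability is expressed with one pair [U0], [D0]. *)
Lemma cluster_law z j s z' j' s' : size s = n -> size s' = n ->
  forall B : set (K -> R), <<s boxes >> B ->
  P [set w | B (fun k => cluster z j s k w)] = P [set w | B (fun k => cluster z' j' s' k w)].
Proof.
move=> sn sn'; apply: law_unique => //.
- apply: prod_group_independent; first exact: (cluster_index_inj z j s sn).
  exact: F_cluster.
- apply: prod_group_independent; first exact: (cluster_index_inj z' j' s' sn').
  exact: F_cluster.
- case=> [i|[k i]] A mA /=.
    by rewrite !(uniform_law P _ _ _ A mA)//; exact: U_unif.
  have [_ _ [same_law _] _] := model.
  exact: (same_law (inl (z, j, take k.+1 s, i)) (inl (z', j', take k.+1 s', i))).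
Qed.

Let z0 : zd d := 0.
Let s0 : seq nat := nseq n 0%N.
Let s0n : size s0 = n. Proof. exact: size_nseq. Qed.

Definition U0 := U z0 0%N.
Definition D0 (i : 'I_d) (w : T) := walk z0 0%N s0 w i.

Let Kwalk (x : K -> R) : 'I_d -> R := fun i => \sum_(k < n) x (inr (k, i)).

Local Notation TK := (g_sigma_algebraType (@boxes R K)).

Let mKwalk i : measurable_fun setT (fun x : TK => Kwalk x i).
Proof. by apply: measurable_sum => k; exact: measurable_coord. Qed.

Let mKpos (z : zd d) (u : R) (f : TK -> 'I_d -> R) : 0 < u ->
  (forall i, measurable_fun setT (fun x => f x i)) ->
  measurable ([set x | @Defs.ball0 R d u (fun i => (z ord0 i)%:~R + x (inl i) + f x i)] : set TK).
Proof.
move=> u0 mf; rewrite ball0E//; apply: measurable_set_lt; last exact: measurable_cst.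
apply: measurable_sum => i; apply: measurable_funX.
apply: measurable_funD => //; apply: measurable_funD; first exact: measurable_cst.
exact: measurable_coord.
Qed.

Lemma position_law z j s u : size s = n -> 0 < u ->
  P [set w | Defs.ball0 u (brw_pos U Xd z j s w)] =
  P [set w | @Defs.ball0 R d u (fun i => (z ord0 i)%:~R + U0 i w + D0 i w)].
Proof.
move=> sn u0.
under eq_set do rewrite (brw_pos_walk _ _ _ _ sn).
exact: (cluster_law z j s z0 0%N s0 sn s0n _ (mKpos z u Kwalk u0 mKwalk)).
Qed.

(** The added 0 gives the form of [shift_sum] with zero displacement. *)
Lemma start_law z j u : 0 < u ->
  P [set w | Defs.ball0 u (init_pos U z j w)] =
  P [set w | @Defs.ball0 R d u (fun i => (z ord0 i)%:~R + U0 i w + 0)].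
Proof.
move=> u0.
rewrite -(cluster_law z j s0 z0 0%N s0 s0n s0n _ (mKpos z u (fun _ _ => 0) u0 _))//.
congr (P _); apply/seteqP; split => w /=.
  by rewrite (_ : init_pos _ _ _ _ = (fun i => (z ord0 i)%:~R + U z j i w + 0))//;
    apply/funext => i; rewrite addr0.
by rewrite (_ : init_pos _ _ _ _ = (fun i => (z ord0 i)%:~R + U z j i w + 0))//;
  apply/funext => i; rewrite addr0.
Qed.

Lemma far_law z j s u x : size s = n -> 0 < u ->
  P [set w | x <= normsq (walk z j s w) /\ Defs.ball0 u (brw_pos U Xd z j s w)] =
  P [set w | x <= normsq (D0^~ w) /\
     @Defs.ball0 R d u (fun i => (z ord0 i)%:~R + U0 i w + D0 i w)].
Proof.
move=> sn u0.
under eq_set do rewrite (brw_pos_walk _ _ _ _ sn).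
have mB : measurable ([set y | x <= normsq (Kwalk y)] `&` [set y |
    @Defs.ball0 R d u (fun i => (z ord0 i)%:~R + y (inl i) + Kwalk y i)] : set TK).
  apply: measurableI; last exact: mKpos.
  rewrite (_ : [set y | _] = ~` [set y : TK | normsq (Kwalk y) < x]).
    apply: measurableC; apply: measurable_set_lt => //.
    by apply: measurable_sum => i; apply: measurable_funX.
  by apply/seteqP; split => y /=; rewrite leNgt => /negP.
exact: (cluster_law z j s z0 0%N s0 sn s0n _ mB).
Qed.

Let U0_indep (f : 'I_d -> R -> R) :
  (forall i, measurable_fun setT (f i)) -> (forall i x, 0 <= f i x) ->
  (\int[P]_w (\prod_(i < d) f i (U0 i w))%:E = \prod_(i < d) \int[P]_w (f i (U0 i w))%:E)%E.
Proof.
move=> mf f0.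
apply: (expectation_prod P F Fm FI FT Find 'I_d (fun i => [set iU z0 0%N i]) _ (fun i w => f i (U0 i w))).
- exact: index_enum_uniq.
- by move=> k l _ _ kl; apply/seteqP; split => // _ /= [-> [klE]]; rewrite klE eqxx in kl.
- move=> i _ _ A mA; rewrite setTI; apply: sub_sigma_algebra.
  exists (iU z0 0%N i) => //; exists (f i @^-1` A) => //.
  by rewrite -[X in measurable X]setTI; exact: mf.
- by move=> i w; exact: f0.
Qed.

Let JU : set (brw_index d) := [set iU z0 0%N i | i in [set: 'I_d]].
Let JD : set (brw_index d) := [set iX z0 0%N sv.1 sv.2 | sv in [set: seq nat * 'I_d]].

Let JDU : JD `&` JU = set0.
Proof. by apply/seteqP; split => // _ [[[s i] _ <-] []]. Qed.

Let mU0 i : measurable_fun setT (U0 i : g_sigma_algebraType (group_gen F JU) -> R).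
Proof.
move=> _ A mA; rewrite setTI; apply: sub_sigma_algebra.
by exists (iU z0 0%N i); [exists i|exact: FU].
Qed.

Let mD0 i : measurable_fun setT (D0 i : g_sigma_algebraType (group_gen F JD) -> R).
Proof.
apply: measurable_sum => k _ A mA; rewrite setTI; apply: sub_sigma_algebra.
by exists (iX z0 0%N (take k.+1 s0) i); [exists (take k.+1 s0, i)|exact: FX].
Qed.

Definition position_prob (z : zd d) (u : R) :=
  P [set w | @Defs.ball0 R d u (fun i => (z ord0 i)%:~R + U0 i w + D0 i w)].

Definition start_prob (z : zd d) (u : R) :=
  P [set w | @Defs.ball0 R d u (fun i => (z ord0 i)%:~R + U0 i w + 0)].

Definition far_prob (z : zd d) (x u : R) :=
  P [set w | x <= normsq (D0^~ w) /\
     @Defs.ball0 R d u (fun i => (z ord0 i)%:~R + U0 i w + D0 i w)].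

Definition walk_tail (x : R) := P [set w | x <= normsq (D0^~ w)].

Let mtail x : <<s group_gen F JD >> [set w | x <= normsq (D0^~ w)].
Proof.
rewrite (_ : [set w | _] = ~` [set w | normsq (D0^~ w) < x]).
  apply: (@measurableC _ (g_sigma_algebraType (group_gen F JD))).
  apply: (@measurable_set_lt _ _ (g_sigma_algebraType (group_gen F JD))) => //.
  by apply: measurable_sum => i; apply: measurable_funX; exact: mD0.
by apply/seteqP; split => y /=; rewrite leNgt => /negP.
Qed.

Lemma sum_position_prob u : 0 < u ->
  (\esum_(z in [set: zd d]) position_prob z u = (vol_ball d u)%:E)%E.
Proof.
move=> u0.
rewrite -[RHS]mul1e -(probability_setT P).
rewrite -(shift_sum P F Fm FI FT Find JD JU JDU U0 D0 mU0 mD0 (U_unif _ _) U0_indep _ _ u0).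
  by under [in RHS]eq_esum do rewrite setTI.
exact: (@measurableT _ (g_sigma_algebraType (group_gen F JD))).
Qed.

Lemma sum_start_prob u : 0 < u ->
  (\esum_(z in [set: zd d]) start_prob z u = (vol_ball d u)%:E)%E.
Proof.
move=> u0.
rewrite -[RHS]mul1e -(probability_setT P).
rewrite -(shift_sum P F Fm FI FT Find JD JU JDU U0 (fun _ _ => 0) mU0 _ (U_unif _ _) U0_indep _ _ u0).
- by under [in RHS]eq_esum do rewrite setTI.
- by move=> i; exact: measurable_cst.
- exact: (@measurableT _ (g_sigma_algebraType (group_gen F JD))).
Qed.

Lemma sum_far_prob x u : 0 < u ->
  (\esum_(z in [set: zd d]) far_prob z x u = walk_tail x * (vol_ball d u)%:E)%E.
Proof.
move=> u0.
by rewrite -(shift_sum P F Fm FI FT Find JD JU JDU U0 D0 mU0 mD0 (U_unif _ _) U0_indep _ _ u0 (mtail x)).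
Qed.

Definition hit z j (u : R) : set T := [set w | exists s : seq nat,
  [/\ size s = n, alive (fun v => xi z j v w) s & Defs.ball0 u (brw_pos U Xd z j s w)]].

Variable G : R -> R.
Hypothesis p_law : offspring_law p.
Hypothesis p_mean : series (fun k => k%:R * p k) @ \oo --> (1 : R).
Hypothesis p_gen : forall s : R, 0 <= s <= 1 ->
  series (fun k => p k * s ^+ k) @ \oo --> G s.

(** * Hit probability of a single cluster *)

Section Cluster.
Variables (z : zd d) (j : nat).

Let Jxi : set (brw_index d) := range (fun s => ixi z j s).
Let JUX : set (brw_index d) :=
  [set iU z j i | i in [set: 'I_d]] `|` [set iX z j sv.1 sv.2 | sv in [set: seq nat * 'I_d]].
Local Notation Txi := (g_sigma_algebraType (group_gen F Jxi)).
Local Notation TUX := (g_sigma_algebraType (group_gen F JUX)).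

Let Jdisj : Jxi `&` JUX = set0.
Proof. by apply/seteqP; split => // _ [[s _ <-] [[i _ //]|[[v i] _ //]]]. Qed.

Let alive_at k : set T := oapp (fun s : seq nat =>
  [set w | size s = n /\ alive (fun v => xi z j v w) s]) set0 (pickle_inv k).

Let Fxi s A : F (ixi z j s) (xi z j s @^-1` A).
Proof. by exists A. Qed.

Let m_alive k : @measurable _ Txi (alive_at k).
Proof.
rewrite /alive_at; case: pickle_inv => [s|] /=; last exact: (@measurable0 _ Txi).
have [sn|sn] := pselect (size s = n).
  rewrite (_ : [set w | _] = [set w | alive (fun v => xi z j v w) s]).
    exact: (alive_sigma F (fun s => ixi z j s) (xi z j) Fxi s).
  by apply/seteqP; split => w /= => [[]|].
rewrite (_ : [set w | _] = set0); first exact: (@measurable0 _ Txi).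
by apply/seteqP; split => w // [].
Qed.

Let survive : set T := \bigcup_k alive_at k.

Let survive_not_dead : survive = ~` [set w | dead (xi z j) n [::] w].
Proof.
apply/seteqP; split => w.
  move=> [k _]; rewrite /alive_at; case: pickle_inv => //= s [sn sa].
  by apply/(not_deadP (xi z j)); exists s.
move=> /(not_deadP (xi z j))[s [sn sa]]; exists (pickle s) => //.
by rewrite /alive_at pickleK_inv.
Qed.

Let at_word (E : seq nat -> set T) k : set T := oapp E set0 (pickle_inv k).

(** Here [A] speaks of genealogy and [E] of space, so they are independent, and the common value [e]
    can be pulled out of the sum over words. For words of another length [A k] is empty. Used with
    disjointed [A] for the lower bound and with [alive_at] itself for the upper one. *)
Let alive_word_prob (A : nat -> set T) (E : seq nat -> set T) (e : \bar R) k :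
  (forall k, @measurable _ Txi (A k)) -> (forall k, A k `<=` alive_at k) ->
  (forall s, @measurable _ TUX (E s)) -> (forall s, size s = n -> P (E s) = e) ->
  P (A k `&` at_word E k) = (e * P (A k))%E.
Proof.
move=> mA Aalive mE Ee.
have := Aalive k; rewrite /alive_at /at_word; case: pickle_inv => [s|] /= As; last first.
  have -> : A k = set0 by apply/seteqP; split => // w /As.
  by rewrite setI0 measure0 mule0.
have [sn|sn] := pselect (size s = n).
  by rewrite (group_independent2 P F Fm FI FT Find _ _ _ _ Jdisj (mA k) (mE s)) Ee// muleC.
have -> : A k = set0 by apply/seteqP; split => // w /As[].
by rewrite set0I measure0 mule0.
Qed.

Let mUXpos s i : measurable_fun setT ((fun w => brw_pos U Xd z j s w i) : TUX -> R).
Proof.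
have mUi : measurable_fun setT (U z j i : TUX -> R).
  move=> _ A mA; rewrite setTI; apply: sub_sigma_algebra.
  by exists (iU z j i); [left; exists i|exact: FU].
have mXi v : measurable_fun setT (Xd z j v i : TUX -> R).
  move=> _ A mA; rewrite setTI; apply: sub_sigma_algebra.
  by exists (iX z j v i); [right; exists (v, i)|exact: FX].
apply: measurable_funD; last by apply: measurable_sum => k; exact: mXi.
by apply: measurable_funD => //; exact: measurable_cst.
Qed.

Let mUXwalk s i : measurable_fun setT ((fun w => walk z j s w i) : TUX -> R).
Proof.
apply: measurable_sum => k _ A mA; rewrite setTI; apply: sub_sigma_algebra.
by exists (iX z j (take k.+1 s) i); [right; exists (take k.+1 s, i)|exact: FX].
Qed.

Let mUXball u s : 0 < u ->
  @measurable _ TUX [set w | Defs.ball0 u (brw_pos U Xd z j s w)].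
Proof.
move=> u0; rewrite (_ : [set w | _] = [set w | normsq (brw_pos U Xd z j s w) < u ^+ 2]).
  apply: (@measurable_set_lt _ _ TUX) => //.
  by apply: measurable_sum => i; apply: measurable_funX; exact: mUXpos.
by rewrite ball0E.
Qed.

Let mUXfar x u s : 0 < u -> @measurable _ TUX
  [set w | x <= normsq (walk z j s w) /\ Defs.ball0 u (brw_pos U Xd z j s w)].
Proof.
move=> u0; apply: (@measurableI _ TUX [set w | x <= normsq (walk z j s w)]); last exact: mUXball.
rewrite (_ : [set w | _] = ~` [set w | normsq (walk z j s w) < x]).
  apply: (@measurableC _ TUX); apply: (@measurable_set_lt _ _ TUX) => //.
  by apply: measurable_sum => i; apply: measurable_funX; exact: mUXwalk.
by apply/seteqP; split => y /=; rewrite leNgt => /negP.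
Qed.

Let xi_law s k : P (xi z j s @^-1` [set k]) = (p k)%:E.
Proof. by have [_ [_ [_ [_ [+ _]]]] _ _] := model; apply. Qed.

Let emb_inj : injective (fun s => ixi z j s).
Proof. by move=> s t []. Qed.

Let prob_survive : P survive = (1 - iter n G 0)%:E.
Proof.
rewrite survive_not_dead probability_setC.
  by rewrite (prob_dead P F Fm FI FT Find (fun s => ixi z j s) (xi z j) p emb_inj Fxi xi_law G p_gen).
exact: (group_sigma_measurable _ Fm _ _ (dead_sigma F (fun s => ixi z j s) (xi z j) Fxi n [::])).
Qed.

Let m_xi (A : set T) : @measurable _ Txi A -> measurable A.
Proof. exact: group_sigma_measurable. Qed.

Let m_UX (A : set T) : @measurable _ TUX A -> measurable A.
Proof. exact: group_sigma_measurable. Qed.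

Let m_at_word (E : seq nat -> set T) k : (forall s, @measurable _ TUX (E s)) -> measurable (at_word E k).
Proof. by move=> mE; rewrite /at_word; case: pickle_inv => [s|] //=; apply: m_UX; exact: mE. Qed.

Let hitE u : hit z j u =
  \bigcup_k (alive_at k `&` at_word (fun s => [set w | Defs.ball0 u (brw_pos U Xd z j s w)]) k).
Proof.
apply/seteqP; split => w.
  by move=> [s [sn sa sb]]; exists (pickle s) => //; rewrite /alive_at /at_word pickleK_inv.
move=> [k _]; rewrite /alive_at /at_word; case: pickle_inv => [s|] /= [] //.
by move=> [sn sa] sb; exists s.
Qed.

Lemma measurable_hit u : 0 < u -> measurable (hit z j u).
Proof.
move=> u0; rewrite hitE; apply: bigcup_measurable => k _; apply: measurableI.
  by apply: m_xi; exact: m_alive.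
by apply: m_at_word => s; exact: mUXball.
Qed.

Lemma hit_sigma u : 0 < u -> <<s group_gen F (Jxi `|` JUX) >> (hit z j u).
Proof.
move=> u0; rewrite hitE.
apply: (@bigcupT_measurable _ (g_sigma_algebraType (group_gen F (Jxi `|` JUX)))) => k.
apply: (@measurableI _ (g_sigma_algebraType (group_gen F (Jxi `|` JUX)))).
  by apply: (group_sigma_sub F Jxi); [exact: subsetUl|exact: m_alive].
rewrite /at_word; case: pickle_inv => [s|] /=; last first.
  exact: (@measurable0 _ (g_sigma_algebraType (group_gen F (Jxi `|` JUX)))).
by apply: (group_sigma_sub F JUX); [exact: subsetUr|exact: mUXball].
Qed.

(* Splitting over the first surviving word avoids any double counting. *)
Lemma hit_ge u : 0 < u ->
  ((1 - iter n G 0)%:E * position_prob z u <= P (hit z j u))%E.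
Proof.
move=> u0; rewrite -prob_survive.
pose E s := [set w | Defs.ball0 u (brw_pos U Xd z j s w)].
have mW k : @measurable _ Txi (seqDU alive_at k).
  apply: (@measurableD _ Txi); first exact: m_alive.
  by apply: (@bigsetU_measurable _ Txi) => i _; exact: m_alive.
have -> : survive = \bigcup_k seqDU alive_at k by exact: seqDU_bigcup_eq.
rewrite measure_bigcup//; last by move=> k _; apply: m_xi; exact: mW.
have cfin : position_prob z u \is a fin_num.
  rewrite /position_prob -(position_law z j s0)//.
  by apply: fin_num_measure; apply: m_UX; exact: mUXball.
rewrite muleC -(fineK cfin) -nneseriesZl//.
rewrite fineK//.
under eq_eseriesr => k _.
  rewrite -(alive_word_prob _ E _ k mW)//; last 3 first.
  - by move=> l; exact: subset_seqDU.
  - by move=> s; exact: mUXball.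
  - by move=> s sn; exact: position_law.
  over.
rewrite -measure_bigcup.
- apply: le_measure; rewrite ?inE.
  + apply: bigcup_measurable => k _; apply: measurableI; first by apply: m_xi; exact: mW.
    by apply: m_at_word => s; exact: mUXball.
  + exact: measurable_hit.
  + rewrite hitE; apply: subset_bigcup => k _; apply: setSI.
    exact: subset_seqDU.
- by move=> k _; apply: measurableI; [apply: m_xi; exact: mW|apply: m_at_word => s; exact: mUXball].
- apply/trivIsetP => k l _ _ kl; apply/seteqP; split => // w [[wk _] [wl _]].
  have /trivIsetP/(_ k l Logic.I Logic.I kl) := trivIset_seqDU alive_at.
  by move=> <-.
Qed.

Let sum_alive : (\sum_(k <oo) P (alive_at k) = 1)%E.
Proof.
have [p0 _] := p_law.
rewrite -(sum_prob_alive P F Fm FI FT Find (fun s => ixi z j s) (xi z j) p emb_inj Fxi xi_law p0 p_mean n).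
rewrite esum_mkcond esum_pickle; last by move=> s; case: ifP.
apply: eq_eseriesr => k _; rewrite /alive_at; case: pickle_inv => [s|] /=; last by rewrite measure0.
case: ifPn => [/set_mem/= sn|/negP sn].
  by congr (P _); apply/seteqP; split => w /= => [[]|].
rewrite (_ : [set w | _] = set0) ?measure0//.
by apply/seteqP; split => w //= [sz]; case: sn; exact/mem_set.
Qed.

Lemma hit_le (eps u : R) : 0 < eps -> 0 < u ->
  (P (hit z j u) <= (1 - iter n G 0)%:E * start_prob z ((1 + eps) * u) +
     far_prob z ((eps * u) ^+ 2) u)%E.
Proof.
move=> e0 u0; have v0 : 0 < (1 + eps) * u by rewrite mulr_gt0// addr_gt0.
pose S := [set w | Defs.ball0 ((1 + eps) * u) (init_pos U z j w)].
pose E s := [set w | (eps * u) ^+ 2 <= normsq (walk z j s w) /\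
   Defs.ball0 u (brw_pos U Xd z j s w)].
have mS : @measurable _ TUX S.
  rewrite /S ball0E//; apply: (@measurable_set_lt _ _ TUX) => //.
  apply: measurable_sum => i; apply: measurable_funX.
  apply: measurable_funD; first exact: measurable_cst.
  move=> _ A mA; rewrite setTI; apply: sub_sigma_algebra.
  by exists (iU z j i); [left; exists i|exact: FU].
have mE s : @measurable _ TUX (E s) by exact: mUXfar.
have msurv : @measurable _ Txi survive.
  by apply: (@bigcupT_measurable _ Txi) => k; exact: m_alive.
have mfar : measurable (\bigcup_k (alive_at k `&` at_word E k)).
  apply: bigcup_measurable => k _; apply: measurableI; last exact: m_at_word.
  by apply: m_xi; exact: m_alive.
apply: (@le_trans _ _ (P ((survive `&` S) `|` \bigcup_k (alive_at k `&` at_word E k)))).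
  apply: le_measure; rewrite ?inE.
  - exact: measurable_hit.
  - apply: measurableU => //; apply: measurableI; first exact: m_xi.
    exact: m_UX.
  - move=> w [s [sn sa sb]].
    (* A far particle is charged to a union over words. For a near one only survival and the
       starting point are retained, and these two events are independent. *)
    have [far|near] := leP ((eps * u) ^+ 2) (normsq (walk z j s w)).
      by right; exists (pickle s) => //; rewrite /alive_at /at_word pickleK_inv.
    left; split; first by exists (pickle s) => //; rewrite /alive_at pickleK_inv.
    move: sb; rewrite /S/= (brw_pos_walk _ _ _ _ sn) !ball0E//= => sb.
    exact: (normsq_split _ _ _ _ _ _ sb near).
apply: (le_trans (measureU2 _ _ _)) => //.
  by apply: measurableI; [exact: m_xi|exact: m_UX].
apply: leeD.
  rewrite [leLHS](_ : _ = P survive * P S)%E; last first.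
    exact: (group_independent2 P F Fm FI FT Find _ _ _ _ Jdisj msurv mS).
  rewrite prob_survive.
  by rewrite (start_law z j _ v0).
(* The factor 1 is the expected size of generation [n]: every possible word contributes its
   probability of being alive times the same far probability. *)
rewrite -[leRHS]mule1 -sum_alive.
have cfin : far_prob z ((eps * u) ^+ 2) u \is a fin_num.
  rewrite /far_prob -(far_law z j s0)//.
  by apply: fin_num_measure; apply: m_UX; exact: mE.
rewrite -(fineK cfin) -nneseriesZl//.
rewrite fineK//.
apply: le_trans (measure_sigma_subadditive _ _ _ _) _ => //.
- move=> k; apply: measurableI; last exact: m_at_word.
  by apply: m_xi; exact: m_alive.
- exact: subset_refl.
- apply: lee_nneseries => // k _.
  rewrite le_eqVlt; apply/orP; left; apply/eqP; apply: alive_word_prob => //.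
  + by move=> l; exact: subset_refl.
  + by move=> s sn; exact: far_law.
Qed.

End Cluster.

(** * From clusters to cubes and to the whole space *)

Let Q := 1 - iter n G 0.

Let Q_ge0 : 0 <= Q.
Proof.
have Fxi s A : F (ixi z0 0%N s) (xi z0 0%N s @^-1` A) by exists A.
have inj : injective (fun s => ixi z0 0%N s) by move=> s t [].
have xi_law s k : P (xi z0 0%N s @^-1` [set k]) = (p k)%:E.
  by have [_ [_ [_ [_ [+ _]]]] _ _] := model; apply.
rewrite /Q subr_ge0 -lee_fin.
rewrite -(prob_dead P F Fm FI FT Find (fun s => ixi z0 0%N s) (xi z0 0%N) p inj Fxi xi_law G p_gen n [::]).
apply: probability_le1.
exact: (group_sigma_measurable _ Fm _ _ (dead_sigma F (fun s => ixi z0 0%N s) (xi z0 0%N) Fxi n [::])).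
Qed.

Let Jcluster z j : set (brw_index d) := range (fun s => ixi z j s) `|`
  ([set iU z j i | i in [set: 'I_d]] `|` [set iX z j sv.1 sv.2 | sv in [set: seq nat * 'I_d]]).

(** All clusters [j] are included, whatever the value of [N z], so that the label set is
    deterministic and distinct cubes have disjoint ones. *)
Let Jcube z : set (brw_index d) := [set iN z] `|` \bigcup_j Jcluster z j.

Let Jcluster_label z j c : Jcluster z j c ->
  match c with
  | inl (inl (inr (z', j', _))) | inl (inr (inl (z', j', _)))
  | inl (inr (inr (z', j', _, _))) => z' = z /\ j' = j
  | _ => False
  end.
Proof. by move=> [[s _ <-]|[[i _ <-]|[[s i] _ <-]]]. Qed.

Let Jcube_disj z z' : z != z' -> Jcube z `&` Jcube z' = set0.
Proof.
move=> zz; apply/seteqP; split => // c [] [->|[j _ /Jcluster_label zc]] [zc'|[j' _ /Jcluster_label zc']].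
- by move: zz; case: zc' => ->; rewrite eqxx.
- by [].
- by move: zc; rewrite zc'.
- case: c zc zc' => [[[c|[[c k] i]]|[[[c k] s]|[[[c k] s] i]]]|c] //= [-> _] [zE _];
    by rewrite zE eqxx in zz.
Qed.

Definition quiet z (u : R) : set T := [set w | forall j, (j < N z w)%N -> ~ hit z j u w].

Let quiet_sigma z u : 0 < u -> <<s group_gen F (Jcube z) >> (quiet z u).
Proof.
move=> u0; rewrite (_ : quiet z u = \bigcap_j (N z @^-1` [set k | (k <= j)%N] `|` ~` hit z j u)).
  apply: (@bigcapT_measurable _ (g_sigma_algebraType (group_gen F (Jcube z)))) => j.
  apply: (@measurableU _ (g_sigma_algebraType (group_gen F (Jcube z)))).
    apply: sub_sigma_algebra; exists (iN z); first by left.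
    by exists [set k | (k <= j)%N].
  apply: (@measurableC _ (g_sigma_algebraType (group_gen F (Jcube z)))).
  apply: (group_sigma_sub F (Jcluster z j)); last exact: hit_sigma.
  by move=> c Jc; right; exists j.
apply/seteqP; split => w /= H.
  by move=> j _ /=; have [jN|jN] := ltnP j (N z w); [right; exact: H|left].
by move=> j jN; have [/=|//] := H j Logic.I; rewrite leqNgt jN.
Qed.

Let measurable_quiet z u : 0 < u -> measurable (quiet z u).
Proof. by move=> u0; exact: group_sigma_measurable Fm _ _ (quiet_sigma z u u0). Qed.

Let hit_prob z j u := fine (P (hit z j u)).

Let hit_probE z j u : 0 < u -> (hit_prob z j u)%:E = P (hit z j u).
Proof. by move=> u0; rewrite fineK// fin_num_measure//; exact: measurable_hit. Qed.

Let hit_prob01 z j u : 0 < u -> 0 <= hit_prob z j u <= 1.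
Proof.
by move=> u0; rewrite -!lee_fin hit_probE// measure_ge0 probability_le1//; exact: measurable_hit.
Qed.

Let prob_quiet z u : 0 < u -> P (quiet z u) =
  (\sum_(k <oo) (expR (-1) / k`!%:R)%:E * \prod_(j < k) (1 - hit_prob z j u)%:E)%E.
Proof.
move=> u0.
rewrite /quiet (prob_random_conjunction P F Fm FI FT Find (iN z) (N z) (Jcluster z) (fun j => ~` hit z j u)).
- apply: eq_eseriesr => k _.
  have [_ [N_law _] _ _] := model; rewrite N_law; congr (_ * _)%E.
  apply: eq_bigr => j _; rewrite probability_setC; last exact: measurable_hit.
  by rewrite -hit_probE.
- by move=> A; exists A.
- move=> j; apply: (@measurableC _ (g_sigma_algebraType (group_gen F (Jcluster z j)))).
  exact: hit_sigma.
- by move=> j /Jcluster_label.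
- move=> i j ij; apply/seteqP; split => // c [/Jcluster_label ci /Jcluster_label cj].
  case: c ci cj => [[[c|[[c k] l]]|[[[c k] s]|[[[c k] s] l]]]|c] //= [_ ->] [_ ijE];
    by rewrite ijE eqxx in ij.
Qed.

Definition void (u : R) : set T := \bigcap_(z in [set: zd d]) quiet z u.

Let quiet_at u k : set T := oapp (fun z => quiet z u) setT (pickle_inv k).

Let voidE u : void u = \bigcap_k quiet_at u k.
Proof.
apply/seteqP; split => w H.
  by move=> k _; rewrite /quiet_at; case: pickle_inv => //= z; exact: H.
by move=> z _; have := H (pickle z) Logic.I; rewrite /quiet_at pickleK_inv.
Qed.

Let measurable_quiet_at u : 0 < u -> forall k, measurable (quiet_at u k).
Proof. by move=> u0 k; rewrite /quiet_at; case: pickle_inv => [z|] //=; exact: measurable_quiet. Qed.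

Let quiet_at_prod u m : 0 < u ->
  P (\bigcap_(k in [set` iota 0 m]) quiet_at u k) = (\prod_(k <- iota 0 m) P (quiet_at u k))%E.
Proof.
move=> u0.
apply: (group_independent P F Fm FI FT Find nat (fun k => oapp Jcube set0 (@pickle_inv (zd d) k))).
- exact: iota_uniq.
- move=> k l _ _ kl.
  have := pickle_invK (T := zd d) k; have := pickle_invK (T := zd d) l.
  case: pickle_inv => [z|] /=; last by rewrite setI0.
  case: pickle_inv => [z'|] /=; last by rewrite set0I.
  move=> zl zk; apply: Jcube_disj; apply: contraNneq kl => zz.
  by rewrite -zl -zk zz.
- move=> k _; rewrite /quiet_at; case: pickle_inv => [z|] /=; first exact: quiet_sigma.
  exact: (@measurableT _ (g_sigma_algebraType (group_gen F set0))).
Qed.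

Let sum_at (f : zd d -> R) (S : R) : (forall z, 0 <= f z) ->
  (\esum_(z in [set: zd d]) (f z)%:E = S%:E)%E ->
  (\sum_(k <oo) (oapp f 0 (@pickle_inv (zd d) k))%:E = S%:E)%E.
Proof.
move=> f0 <-; rewrite esum_pickle; last by move=> z; rewrite lee_fin.
by apply: eq_eseriesr => k _; case: pickle_inv.
Qed.

Let mD0T i : measurable_fun setT (D0 i).
Proof. by apply: measurable_sum => k; exact: mX. Qed.

Let measurable_shift_ball (z : zd d) u (f : T -> 'I_d -> R) : 0 < u ->
  (forall i, measurable_fun setT (fun w => f w i)) ->
  measurable [set w | @Defs.ball0 R d u (fun i => (z ord0 i)%:~R + U0 i w + f w i)].
Proof.
move=> u0 mf; rewrite ball0E//; apply: measurable_set_lt => //.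
apply: measurable_sum => i; apply: measurable_funX.
by apply: measurable_funD => //; apply: measurable_funD => //; exact: mU.
Qed.

Let position_fin (z : zd d) u : 0 < u -> position_prob z u \is a fin_num.
Proof. by move=> u0; apply: fin_num_measure; exact: (measurable_shift_ball z u (fun w i => D0 i w)). Qed.

Let start_fin (z : zd d) u : 0 < u -> start_prob z u \is a fin_num.
Proof. by move=> u0; apply: fin_num_measure; exact: (measurable_shift_ball z u (fun _ _ => 0)). Qed.

Let measurable_tail x : measurable [set w | x <= normsq (D0^~ w)].
Proof. exact: group_sigma_measurable Fm _ _ (mtail x). Qed.

Let far_fin (z : zd d) x u : 0 < u -> far_prob z x u \is a fin_num.
Proof.
move=> u0; apply: fin_num_measure; apply: (measurableI _ _ (measurable_tail x)).
exact: (measurable_shift_ball z u (fun w i => D0 i w)).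
Qed.

Lemma measurable_void u : 0 < u -> measurable (void u).
Proof. by move=> u0; rewrite voidE; apply: bigcapT_measurable => k; exact: measurable_quiet_at. Qed.

(** The rate of cube [z] is the lower bound [f z] of its hit probabilities, and the rates sum to
    [Q * vol_ball d u]. A code without a cube has event [setT] and rate 0. *)
Lemma void_le u : 0 < u -> (P (void u) <= (expR (- (Q * vol_ball d u)))%:E)%E.
Proof.
move=> u0; rewrite voidE.
pose f z := Q * fine (position_prob z u).
have f0 z : 0 <= f z by rewrite mulr_ge0// fine_ge0// measure_ge0.
apply: (prob_bigcap_le P _ (measurable_quiet_at u u0) (fun m => quiet_at_prod u m u0)
  (fun k => oapp f 0 (@pickle_inv (zd d) k))).
- by move=> k; case: pickle_inv => //=.
- apply: sum_at => //.
  rewrite (EFinM Q) -(sum_position_prob u u0) -esumZl; last 2 first.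
  + by rewrite lee_fin.
  + by move=> z; exact: measure_ge0.
  by apply: eq_esum => z _; rewrite /f EFinM fineK//; exact: position_fin.
- move=> k; rewrite /quiet_at; case: pickle_inv => [z|] /=; last first.
    by rewrite probability_setT oppr0 expR0.
  rewrite prob_quiet//.
  apply: (poisson_thinning_le (fun j => hit_prob z j u) (f z) (fun j => hit_prob01 z j u u0)) => // j.
  rewrite -lee_fin hit_probE// /f EFinM fineK//; last exact: position_fin.
  exact: hit_ge.
Qed.

Lemma void_ge (eps u : R) : 0 < eps -> 0 < u ->
  ((expR (- (Q * vol_ball d ((1 + eps) * u) +
             fine (walk_tail ((eps * u) ^+ 2)) * vol_ball d u))%R)%:E <= P (void u))%E.
Proof.
move=> e0 u0; rewrite voidE.
have v0 : 0 < (1 + eps) * u by rewrite mulr_gt0// addr_gt0.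
pose f z := Q * fine (start_prob z ((1 + eps) * u)) + fine (far_prob z ((eps * u) ^+ 2) u).
have f0 z : 0 <= f z.
  by rewrite addr_ge0 ?mulr_ge0 ?fine_ge0// measure_ge0.
apply: (prob_bigcap_ge P _ (measurable_quiet_at u u0) (fun m => quiet_at_prod u m u0)
  (fun k => oapp f 0 (@pickle_inv (zd d) k))).
- by move=> k; case: pickle_inv => //=.
- apply: sum_at => //.
  under eq_esum do rewrite /f EFinD.
  rewrite esumD; last 2 first.
  + by move=> z _; rewrite lee_fin mulr_ge0// fine_ge0// measure_ge0.
  + by move=> z _; rewrite lee_fin fine_ge0// measure_ge0.
  rewrite EFinD (EFinM Q) (EFinM (fine _)) -(sum_start_prob _ v0) -esumZl; last 2 first.
  + by rewrite lee_fin.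
  + by move=> z; exact: measure_ge0.
  rewrite fineK; last by apply: fin_num_measure; exact: measurable_tail.
  rewrite -(sum_far_prob _ _ u0); congr (_ + _)%E; apply: eq_esum => z _.
    by rewrite EFinM fineK//; exact: start_fin.
  by rewrite fineK//; exact: far_fin.
- move=> k; rewrite /quiet_at; case: pickle_inv => [z|] /=; last first.
    by rewrite probability_setT oppr0 expR0.
  rewrite prob_quiet//.
  apply: (poisson_thinning_ge (fun j => hit_prob z j u) (f z) (fun j => hit_prob01 z j u u0)) => // j.
  rewrite -lee_fin hit_probE// /f EFinD EFinM !fineK; [|exact: far_fin|exact: start_fin].
  exact: hit_le.
Qed.

Lemma brwZ_eq0 (u : R) w : brwZ N U xi Xd n (@Defs.ball0 R d u) w = 0%E <-> void u w.
Proof.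
rewrite /brwZ esum_one_eq0; split=> [S0 z _ j jN [s [sn sa sb]]|H].
  suff : (set0 : set (zd d * nat * seq nat)) (z, j, s) by [].
  by rewrite -S0.
apply/seteqP; split => // -[[z j] s] /= [jN [sa [sn sb]]].
by apply: (H z Logic.I j jN); exists s.
Qed.

(** The tree started from a single particle has its own labels [xi0]; it obeys the same extinction
    recursion as the clusters, which identifies the argument of [L] in $b_n$ with $q_n$. *)
Lemma survival_prob : P [set w | (0 < brwZ0_total (R := R) xi0 n w)%E] = Q%:E.
Proof.
pose ixi0 s : brw_index d := inr (inl s).
have F0 s A : F (ixi0 s) (xi0 s @^-1` A) by exists A.
have inj : injective ixi0 by move=> s t [].
have xi0_law s k : P (xi0 s @^-1` [set k]) = (p k)%:E.
  by have [_ [_ [_ [_ [_ +]]]] _ _] := model; apply.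
have mdead : measurable [set w | dead xi0 n [::] w].
  exact: (group_sigma_measurable _ Fm _ _ (dead_sigma F ixi0 xi0 F0 n [::])).
have deadE := prob_dead P F Fm FI FT Find ixi0 xi0 p inj F0 xi0_law G p_gen n [::].
rewrite /Q EFinB -deadE -probability_setC//; congr (P _).
apply/seteqP; split => w /=.
  move=> Z0; apply/(not_deadP xi0); apply: contrapT => noword.
  move: Z0; rewrite (_ : brwZ0_total _ _ _ = 0%E) ?ltxx//.
  apply/esum_one_eq0; apply/seteqP; split => // s [sa sn].
  by apply: noword; exists s.
move=> /(not_deadP xi0)[s [sn sa]].
rewrite lt_neqAle esum_ge0// andbT eq_sym; apply/eqP => /esum_one_eq0 S0.
suff : (set0 : set (seq nat)) s by [].
by rewrite -S0.
Qed.

Variable alpha : R.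
Hypothesis alpha_ge0 : 0 <= alpha.
Hypothesis moment : ('E_P[fun w => (eucl (fun i => Xd0 [:: 0%N] i w) `^ alpha)%R] < +oo)%E.

Definition moment_bound : R := fine 'E_P[fun w => (eucl (fun i => Xd0 [:: 0%N] i w) `^ alpha)%R].

Lemma moment_bound_ge0 : 0 <= moment_bound.
Proof.
apply: fine_ge0; rewrite unlock; apply: integral_ge0 => w _.
by rewrite lee_fin powR_ge0.
Qed.

Let displacement_moment z j s i :
  (\int[P]_w (`|Xd z j s i w| `^ alpha)%:E <= moment_bound%:E)%E.
Proof.
have [[_ [_ [_ [_ mdisp]]]] _ [same_law _] _] := model.
have mX0 k : measurable_fun setT (Xd0 [:: 0%N] k) by exact: (mdisp (inr ([:: 0%N], k))).
have mpow : measurable_fun setT (fun x : R => (`|x| `^ alpha)%:E).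
  apply/measurable_EFinP.
  exact: (measurableT_comp (measurable_powR _) (@normr_measurable R setT)).
have e0 w : (0 <= (eucl (fun i => Xd0 [:: 0%N] i w) `^ alpha)%:E)%E.
  by rewrite lee_fin powR_ge0.
have meucl : measurable_fun setT (fun w => (eucl (fun i => Xd0 [:: 0%N] i w) `^ alpha)%:E).
  apply/measurable_EFinP.
  apply: (measurableT_comp (measurable_powR _)).
  apply: (measurableT_comp (continuous_measurable_fun (@sqrt_continuous R))).
  by apply: measurable_sum => k; exact: measurable_funX.
rewrite (eq_integral_law P (Xd z j s i) (Xd0 [:: 0%N] i) (fun x => (`|x| `^ alpha)%:E))//; last first.
  exact: (same_law (inl (z, j, s, i)) (inr ([:: 0%N], i))).
rewrite /moment_bound fineK; last first.
  rewrite ge0_fin_numE// unlock; exact: integral_ge0.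
rewrite unlock; apply: ge0_le_integral => //.
- exact: (measurableT_comp mpow).
- move=> w _; rewrite lee_fin; apply: ge0_ler_powR => //; rewrite ?nnegrE//.
    exact: sqrtr_ge0.
  rewrite -sqrtr_sqr /eucl ler_sqrt; last by apply: sumr_ge0 => k _; exact: sqr_ge0.
  by rewrite (bigD1 i)//= lerDl; apply: sumr_ge0 => k _; exact: sqr_ge0.
Qed.

(** Along the ancestral line the displacements carry distinct labels, because the ancestors have
    distinct lengths. Each coordinate inherits the moment bound from the Euclidean norm. *)
Lemma walk_tail_le (t y : R) (m : nat) : 1 <= t <= 2 -> t <= alpha ->
  (0 < d)%N -> (0 < n)%N -> 0 < y ->
  (walk_tail ((d%:R * (3 * m%:R * y)) ^+ 2) <=
   (2 * d%:R * (n%:R * (moment_bound / y `^ alpha) +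
      expR 1 * (n%:R * (1 + moment_bound) / y `^ t) ^+ m))%:E)%E.
Proof.
move=> t12 ta d0 n0 y0.
have [_ _ [_ centred] _] := model.
apply: (normsq_tail P t alpha moment_bound t12 ta moment_bound_ge0 d n
  (fun i k => Xd z0 0%N (take k.+1 s0) i)) => //.
- by move=> i k; exact: (proj1 (centred (inl (z0, 0%N, take k.+1 s0, i)))).
- move=> i k; have := proj2 (centred (inl (z0, 0%N, take k.+1 s0, i))).
  by rewrite unlock.
- move=> i f mf f0.
  apply: (expectation_prod P F Fm FI FT Find 'I_n
    (fun k => [set iX z0 0%N (take k.+1 s0) i]) _ (fun k w => f (Xd z0 0%N (take k.+1 s0) i w))).
  + exact: index_enum_uniq.
  + move=> k l _ _ kl; apply/seteqP; split => // _ /= [-> [klE]].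
    move: kl; have := congr1 size klE.
    rewrite !size_takel ?s0n ?ltn_ord// => -[/ord_inj ->].
    by rewrite eqxx.
  + move=> k _ _ A mA; rewrite setTI; apply: sub_sigma_algebra.
    exists (iX z0 0%N (take k.+1 s0) i) => //; exists (f @^-1` A) => //.
    by rewrite -[X in measurable X]setTI; exact: mf.
  + by move=> k w; exact: f0.
Qed.

End Model.

(** * Asymptotics *)

Lemma cvg_powRl {R : realType} (u : nat -> R) (l p : R) : 0 < l ->
  u @ \oo --> l -> (fun n => u n `^ p) @ \oo --> l `^ p.
Proof.
move=> l0 ul; have lE x : 0 < x -> expR (p * ln x) = x `^ p.
  by move=> x0; rewrite /powR gt_eqF.
rewrite -lE//.
have : (fun n => expR (p * ln (u n))) @ \oo --> expR (p * ln l).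
  apply: continuous_cvg; first exact: continuous_expR.
  apply: cvgM; first exact: cvg_cst.
  by apply: continuous_cvg => //; exact: continuous_ln.
apply: cvg_trans; apply: near_eq_cvg; near=> n; rewrite lE//.
by near: n; apply: (cvgr_gt l).
Unshelve. all: end_near. Qed.

Lemma cvg_exprn {R : realType} {T : Type} {F : set_system T} {FF : Filter F}
    (u : T -> R) (l : R) (m : nat) :
  u @ F --> l -> (fun x => u x ^+ m) @ F --> l ^+ m.
Proof.
move=> ul; elim: m => [|m IH].
  by under eq_fun do rewrite expr0; exact: cvg_cst.
by under eq_fun do rewrite exprS; rewrite exprS; exact: cvgM.
Qed.

(** * Comparison of the displacement tail with the volume scale *)

Section TailNegligible.
Context {R : realType}.
Variables (beta t alpha l M : R) (d : nat) (q b : nat -> R).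
Hypothesis d_gt0 : (0 < d)%N.
Hypothesis t_large : beta < t / d%:R.
Hypothesis alpha_large : beta < (alpha - d%:R) / d%:R.
Hypothesis q_itv : forall n, 0 < q n <= 1.
Hypothesis q_cvg0 : q @ \oo --> (0 : R).
Hypothesis q_small : forall theta, beta < theta ->
  (fun n => n%:R * q n `^ theta) @ \oo --> (0 : R).
Hypothesis b_gt0 : \forall n \near \oo, 0 < b n.
Hypothesis l_gt0 : 0 < l.
Hypothesis qb_cvg : (fun n => q n * b n ^+ d) @ \oo --> l.

Let q_gt0 n : 0 < q n. Proof. by have /andP[] := q_itv n. Qed.

Let dR_gt0 : 0 < d%:R :> R. Proof. by rewrite ltr0n. Qed.

(** Eliminates [b n]: $b_n^{-x}=q_n^{x/d}(q_nb_n^d)^{-x/d}$, where the last factor converges. *)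
Let scaling (c x y : R) n : 0 < c -> 0 < b n ->
  q n `^ (x / d%:R) * (q n * b n ^+ d) `^ (- (x / d%:R)) * c `^ (- x) = (c * b n) `^ (- x).
Proof.
move=> c0 b0.
have bd0 : 0 < b n ^+ d by rewrite exprn_gt0.
rewrite powRM ?(ltW (q_gt0 n)) ?(ltW bd0)// mulrA -powRD; last by apply/implyP => _; rewrite gt_eqF.
rewrite subrr powRr0 mul1r -powR_mulrn ?(ltW b0)// -powRrM.
rewrite (_ : d%:R * - (x / d%:R) = - x); last by field; rewrite gt_eqF.
by rewrite powRM ?(ltW c0) ?(ltW b0)// mulrC.
Qed.

Let cvg_qb_pow x : (fun n => (q n * b n ^+ d) `^ x) @ \oo --> l `^ x.
Proof.
exact: cvg_powRl.
Qed.

(** The product is a constant times $n b_n^{-(\alpha-d)}$, which [scaling] turns into $n q_n^\theta$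
    with $\theta=(\alpha-d)/d>\beta$, up to a convergent factor. *)
Let term1_cvg0 c : 0 < c ->
  (fun n => b n ^+ d * (n%:R * (M / (c * b n) `^ alpha))) @ \oo --> (0 : R).
Proof.
move=> c0; set theta := (alpha - d%:R) / d%:R.
pose u n := M * c `^ (- alpha) * ((n%:R * q n `^ theta) * (q n * b n ^+ d) `^ (- theta)).
have : u @ \oo --> M * c `^ (- alpha) * (0 * l `^ (- theta)).
  apply: cvgM; first exact: cvg_cst.
  by apply: cvgM; [exact: q_small|exact: cvg_qb_pow].
rewrite mul0r mulr0; apply: cvg_trans; apply: near_eq_cvg.
near=> n; rewrite /u.
have b0 : 0 < b n by near: n.
have := scaling 1 (alpha - d%:R) 0 n ltr01 b0.
rewrite -/theta mul1r powR1 mulr1 => E.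
rewrite -(mulrA n%:R) E opprB -powR_mulrn ?(ltW b0)//.
rewrite -(powRN _ alpha) powRM ?(ltW c0) ?(ltW b0)//.
rewrite powRD; last by apply/implyP => _; rewrite gt_eqF.
by ring.
Unshelve. all: end_near. Qed.

(** The number [m] is chosen before [c], since the theorem will use a [c] that depends on [m]. With
    [theta] halfway between [beta] and [t / d] and [delta] the remaining gap, eventually $(n
    q_n^{t/d})^m\le q_n^{\delta m}\le q_n^2$: one factor $q_n$ balances $b_n^d$, the other tends to
    0. *)
Lemma tail_negligible : exists2 m : nat, (0 < m)%N & forall c, 0 < c ->
  (fun n => b n ^+ d * (n%:R * (M / (c * b n) `^ alpha) +
     expR 1 * (n%:R * (1 + M) / (c * b n) `^ t) ^+ m)) @ \oo --> (0 : R).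
Proof.
pose theta := (beta + t / d%:R) / 2.
pose delta := t / d%:R - theta.
have delta0 : 0 < delta by rewrite /delta /theta; have := t_large; lra.
have theta_gt : beta < theta by rewrite /theta; have := t_large; lra.
pose m := (Num.truncn (2 / delta)).+1.
have dm : 2 <= delta * m%:R.
  by rewrite mulrC -ler_pdivrMr// ltW// truncnS_gt.
exists m => // c c0.
pose u n := expR 1 * (((1 + M) * c `^ (- t)) ^+ m * ((q n * b n ^+ d) `^ (- (t / d%:R))) ^+ m *
   (q n * b n ^+ d)) * ((n%:R * q n `^ (t / d%:R)) ^+ m / q n).
have small : (fun n => (n%:R * q n `^ (t / d%:R)) ^+ m / q n) @ \oo --> (0 : R).
  apply: (@squeeze_cvgr _ _ _ _ (fun=> 0) q); [|exact: cvg_cst|exact: q_cvg0].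
  near=> n; have [q0 q1] := andP (q_itv n).
  have nq : n%:R * q n `^ theta <= 1.
    by near: n; apply: (cvgr_le (0 : R)); [exact: q_small|exact: ltr01].
  have nn : 0 <= n%:R * q n `^ (t / d%:R) by rewrite mulr_ge0// powR_ge0.
  rewrite divr_ge0 ?exprn_ge0 ?(ltW q0)//= ler_pdivrMr// -expr2.
  apply: (@le_trans _ _ ((q n `^ delta) ^+ m)).
    apply: lerXn2r; rewrite ?nnegrE ?powR_ge0//.
    rewrite (_ : t / d%:R = theta + delta); last by rewrite /delta; ring.
    rewrite powRD; last by apply/implyP => _; rewrite gt_eqF.
    by rewrite mulrA ler_piMl// powR_ge0.
  rewrite -powR_mulrn ?powR_ge0// -powRrM -powR_mulrn ?(ltW q0)//.
  by apply: ger_powR => //; rewrite q0.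
have cu : u @ \oo --> expR 1 * (((1 + M) * c `^ (- t)) ^+ m * (l `^ (- (t / d%:R))) ^+ m * l) * 0.
  apply: cvgM; last exact: small.
  apply: cvgM; first exact: cvg_cst.
  apply: cvgM; last exact: qb_cvg.
  apply: cvgM; first exact: cvg_cst.
  by apply: cvg_exprn; exact: cvg_qb_pow.
rewrite mulr0 in cu.
have : (fun n => b n ^+ d * (n%:R * (M / (c * b n) `^ alpha)) + u n) @ \oo --> 0 + (0 : R).
  by apply: cvgD; [exact: term1_cvg0|exact: cu].
rewrite addr0.
apply: cvg_trans; apply: near_eq_cvg.
near=> n; rewrite /= mulrDr; congr (_ + _); rewrite /u.
have b0 : 0 < b n by near: n.
rewrite -(powRN _ t) -(scaling c t 0 n c0 b0) !exprMn.
have q0 := q_gt0 n.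
by field; rewrite gt_eqF.
Unshelve. all: end_near. Qed.

End TailNegligible.

Lemma vol_ballM {R : realType} (d : nat) (c u : R) :
  vol_ball d (c * u) = c ^+ d * vol_ball d u.
Proof. by rewrite /vol_ball exprMn; ring. Qed.

Lemma vol_ball_ge0 {R : realType} (d : nat) (u : R) : 0 <= u -> 0 <= vol_ball d u.
Proof.
move=> u0; rewrite /vol_ball divr_ge0//; first by rewrite mulr_ge0 ?powR_ge0 ?exprn_ge0.
apply: fine_ge0; apply: integral_ge0 => x _.
by rewrite lee_fin mulr_ge0 ?powR_ge0 ?expR_ge0.
Qed.

(** The supremum need not be attained, but balls are open: a particle in the ball of radius [r * b]
    has norm strictly below the supremum, hence lies in some ball of radius [u] known to be
    empty. *)
Lemma brwR_void {R : realType} {d : nat} {dT : measure_display} {T : measurableType dT}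
    (N : zd d -> T -> nat) (U : zd d -> nat -> 'I_d -> T -> R)
    (xi : zd d -> nat -> seq nat -> T -> nat) (Xd : zd d -> nat -> seq nat -> 'I_d -> T -> R)
    (n : nat) (r b : R) : 0 < r -> 0 < b ->
  [set w | (r%:E <= brwR N U xi Xd n w * (b^-1)%:E)%E] = void N U xi Xd n (r * b).
Proof.
move=> r0 b0; apply/seteqP; split => w /=; rewrite lee_pdivlMr// -EFinM /brwR; last first.
  move=> /brwZ_eq0 Z0; rewrite le_max; apply/orP; right.
  by apply: ereal_sup_ubound; exists (r * b) => //; split => //; exact: mulr_gt0.
have /negbTE rb0 : ~~ ((r * b)%:E <= 0 :> \bar R)%E by rewrite -ltNge lte_fin mulr_gt0.
rewrite le_max rb0/= => rb z _ j jN [s [sn sa sb]].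
have : ((eucl (brw_pos U Xd z j s w))%:E <
    ereal_sup (EFin @` [set u : R | (0 < u)%R /\ brwZ N U xi Xd n (@Defs.ball0 R d u) w = 0%E]))%E.
  by apply: lt_le_trans rb; rewrite lte_fin.
move=> /ereal_sup_gt[_ [u [u0 /brwZ_eq0 Z0] <-]]; rewrite lte_fin => su.
by apply: (Z0 z Logic.I j jN); exists s.
Qed.

Theorem theorem1p4 (R : realType) (d : nat) (p : nat -> R) (beta alpha : R)
  (L : R -> R) (dT : measure_display) (T : measurableType dT)
  (P : probability T R)
  (N : zd d -> T -> nat) (U : zd d -> nat -> 'I_d -> T -> R)
  (xi : zd d -> nat -> seq nat -> T -> nat)
  (Xd : zd d -> nat -> seq nat -> 'I_d -> T -> R)
  (xi0 : seq nat -> T -> nat) (Xd0 : seq nat -> 'I_d -> T -> R) :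
  (0 < d)%N ->
  offspring_law p ->
  (* offspring mean m = 1 *)
  series (fun k => k%:R * p k) @ \oo --> (1 : R) ->
  0 < beta -> beta <= d%:R^-1 ->
  slowly_varying_at0 L ->
  (* f(s) = s + (1-s)^(1+beta) L(1-s) on [0,1] *)
  (forall s : R, 0 <= s <= 1 ->
     series (fun k => p k * s ^+ k) @ \oo --> s + (1 - s) `^ (1 + beta) * L (1 - s)) ->
  is_brw_model P p N U xi Xd xi0 Xd0 ->
  (* E[|X|^alpha] < oo, X = displacement vector of a particle *)
  (beta + 1) * d%:R < alpha ->
  ('E_P[fun w => (eucl (fun i => Xd0 [:: 0%N] i w) `^ alpha)%R] < +oo)%E ->
  let b := fun n : nat =>
    (n%:R * L (fine (P [set w | (0 < brwZ0_total (R:=R) xi0 n w)%E])))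
      `^ (beta * d%:R)^-1 in
  forall r : R, 0 < r ->
    (fun n : nat => P [set w | (r%:E <= brwR N U xi Xd n w * ((b n)^-1)%:E)%E])
      @ \oo --> (expR (- (vol_ball d r * beta^-1 `^ beta^-1)))%:E.
Proof.
move=> d0 p_law p_mean beta0 beta_le slow p_gen model alpha_gt moment b r r0.
have dR0 : 0 < d%:R :> R by rewrite ltr0n.
have d1 : 1 <= d%:R :> R by rewrite ler1n.
(* Since [(beta + 1) * d >= beta + 1 > 1]; this makes the order [t] below at least 1. *)
have alpha1 : 1 < alpha.
  apply: lt_trans alpha_gt; apply: (lt_le_trans _ (_ : beta + 1 <= _)); first by rewrite ltrDr.
  by rewrite ler_peMr// addr_ge0// ltW.
have alpha0 : 0 <= alpha by apply: ltW; apply: lt_trans alpha1.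
pose G (s : R) := s + (1 - s) `^ (1 + beta) * L (1 - s).
pose q n := 1 - iter n G 0.
have q0 : q 0%N = 1 by rewrite /q subr0.
have qS n : q n.+1 = q n - excess beta L (q n).
  by rewrite /q /= /excess {1}/G; ring.
have excessE (s : R) : 0 < s <= 1 -> excess beta L s = s `^ (1 + beta) * L s by [].
have e0 := excess0 beta L beta0.
have e_gt0 := excess_gt0 p beta L p_law p_mean p_gen.
have e_lt := excess_lt p beta L p_law p_mean p_gen.
have e_conv := excess_conv p beta L p_law p_mean p_gen.
have q_itv := recursion_itv (excess beta L) q e_gt0 e_lt q0 qS.
have q_cvg0 : q @ \oo --> (0 : R) :=
  recursion_cvg0 (excess beta L) q e0 e_gt0 e_lt e_conv q0 qS.
have q_asym : (fun n => n%:R * (q n `^ beta * L (q n))) @ \oo --> beta^-1 :=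
  recursion_asymptotics beta L (excess beta L) q beta0 slow excessE e0 e_gt0 e_lt e_conv q0 qS.
have q_small theta : beta < theta -> (fun n => n%:R * q n `^ theta) @ \oo --> (0 : R) :=
  recursion_small beta L (excess beta L) q beta0 slow excessE e0 e_gt0 e_lt e_conv q0 qS theta.
have bE n : b n = (n%:R * L (q n)) `^ (beta * d%:R)^-1.
  by rewrite /b (survival_prob P p N U xi Xd xi0 Xd0 model n G p_gen).
have ibeta0 : 0 < beta^-1 by rewrite invr_gt0.
(* The positive limit [beta^-1] forces this eventually; at [n = 0] it fails. *)
have nL_gt0 : \forall n \near \oo, 0 < n%:R * L (q n).
  near=> n; have /andP[qn0 _] := q_itv n.
  have : 0 < n%:R * (q n `^ beta * L (q n)) by near: n; apply: (cvgr_gt beta^-1).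
  by rewrite mulrCA pmulr_rgt0// powR_gt0.
have b_gt0 : \forall n \near \oo, 0 < b n.
  by near=> n; rewrite bE powR_gt0//; near: n; exact: nL_gt0.
pose l := beta^-1 `^ beta^-1.
have l_gt0 : 0 < l by exact: powR_gt0.
(* The sequence is the power [beta^-1] of the one in [q_asym]. *)
have qb_cvg : (fun n => q n * b n ^+ d) @ \oo --> l.
  have := cvg_powRl _ _ beta^-1 ibeta0 q_asym.
  apply: cvg_trans; apply: near_eq_cvg; near=> n.
  have /andP[qn0 _] := q_itv n.
  have nL0 : 0 < n%:R * L (q n) by near: n; exact: nL_gt0.
  rewrite bE -powR_mulrn ?powR_ge0// -powRrM.
  rewrite (_ : (beta * d%:R)^-1 * d%:R = beta^-1); last by field; rewrite !gt_eqF.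
  rewrite [X in X `^ _ = _]mulrCA (powRM _ (powR_ge0 _ _) (ltW nL0)); congr (_ * _).
  by rewrite -powRrM mulfV ?gt_eqF// powRr1// ltW.
pose t := Num.min alpha 2.
have t12 : 1 <= t <= 2 by rewrite le_min ge_min lexx orbT (ltW alpha1) ler1n.
have ta : t <= alpha by rewrite ge_min lexx.
(* If [t = alpha] this follows from [alpha > beta * d + d]; if [t = 2], from [beta * d <= 1 < 2]. *)
have t_large : beta < t / d%:R.
  rewrite ltr_pdivlMr// lt_min; apply/andP; split.
    by move: alpha_gt; rewrite mulrDl mul1r; have := dR0; lra.
  apply: (@le_lt_trans _ _ 1); last by rewrite ltr1n.
  by rewrite -ler_pdivlMr// div1r.
have alpha_large : beta < (alpha - d%:R) / d%:R.
  by rewrite ltr_pdivlMr//; move: alpha_gt; rewrite mulrDl mul1r; lra.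
have M0 := moment_bound_ge0 P Xd0 alpha.
have [m m0 tail0] := tail_negligible beta t alpha l (moment_bound P Xd0 alpha) d q b d0
  t_large alpha_large q_itv q_cvg0 q_small b_gt0 l_gt0 qb_cvg.
pose v := vol_ball d r.
have v0 : 0 <= v by apply: vol_ball_ge0; exact: ltW.
pose x n := fine (P [set w | (r%:E <= brwR N U xi Xd n w * ((b n)^-1)%:E)%E]).
have x_le : \forall n \near \oo, x n <= expR (- (q n * b n ^+ d * v)).
  near=> n; have bn : 0 < b n by near: n.
  have rb : 0 < r * b n by exact: mulr_gt0.
  rewrite /x brwR_void// -lee_fin fineK; last first.
    by apply: fin_num_measure; exact: (measurable_void P p N U xi Xd xi0 Xd0 model).
  have := void_le P p N U xi Xd xi0 Xd0 model n G p_gen _ rb.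
  by rewrite [r * _]mulrC vol_ballM mulrA.
have x_ge e : 0 < e -> \forall n \near \oo,
    expR (- ((1 + e) ^+ d * (q n * b n ^+ d * v) + 2 * d%:R * (b n ^+ d *
      (n%:R * (moment_bound P Xd0 alpha / (e * r / (3 * d%:R * m%:R) * b n) `^ alpha) +
       expR 1 * (n%:R * (1 + moment_bound P Xd0 alpha) /
         (e * r / (3 * d%:R * m%:R) * b n) `^ t) ^+ m)) * v)) <= x n.
  move=> e_0; near=> n; have bn : 0 < b n by near: n.
  have n0 : (0 < n)%N by near: n; exact: nbhs_infty_gt.
  have rb : 0 < r * b n by exact: mulr_gt0.
  have mR : 0 < m%:R :> R by rewrite ltr0n.
  (* The truncation level for which the threshold [d * (3 * m * y)] of the tail bound is exactly
     [e * (r * b n)]. *)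
  set y := e * r / (3 * d%:R * m%:R) * b n.
  have y0 : 0 < y by rewrite !mulr_gt0// invr_gt0 !mulr_gt0.
  rewrite /x brwR_void// -lee_fin fineK; last first.
    by apply: fin_num_measure; exact: (measurable_void P p N U xi Xd xi0 Xd0 model).
  apply: le_trans (void_ge P p N U xi Xd xi0 Xd0 model n G p_law p_mean p_gen e (r * b n) e_0 rb).
  rewrite lee_fin ler_expR lerN2 -/(q n).
  have yE : e * (r * b n) = d%:R * (3 * m%:R * y).
    by rewrite /y; field; rewrite !gt_eqF.
  have := walk_tail_le P p N U xi Xd xi0 Xd0 model n alpha alpha0 moment t y m t12 ta d0 n0 y0.
  rewrite -yE => tail_le.
  have : fine (walk_tail P Xd n ((e * (r * b n)) ^+ 2)) <=
      2 * d%:R * (n%:R * (moment_bound P Xd0 alpha / y `^ alpha) +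
        expR 1 * (n%:R * (1 + moment_bound P Xd0 alpha) / y `^ t) ^+ m).
    rewrite -lee_fin fineK// ge0_fin_numE; last exact: measure_ge0.
    exact: (le_lt_trans tail_le (ltry _)).
  set tau := fine _; set B := (X in 2 * d%:R * X) => tauB.
  rewrite vol_ballM (_ : vol_ball d (r * b n) = b n ^+ d * v); last first.
    by rewrite [r * _]mulrC vol_ballM.
  have bd0 : 0 <= b n ^+ d * v by rewrite mulr_ge0// exprn_ge0// ltW.
  have := ler_wpM2r bd0 tauB.
  rewrite (_ : q n * _ = (1 + e) ^+ d * (q n * b n ^+ d * v)); last by ring.
  rewrite (_ : 2 * d%:R * B * _ = 2 * d%:R * (b n ^+ d * B) * v); last by ring.
  by move=> H; rewrite lerD2l.
apply/fine_cvgP; split.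
  near=> n; have bn : 0 < b n by near: n.
  rewrite brwR_void//; apply: fin_num_measure.
  by apply: (measurable_void P p N U xi Xd xi0 Xd0 model); exact: mulr_gt0.
rewrite -/l -/v (mulrC v l).
apply/cvgrPdist_lt => delta delta0.
have up : (fun n => expR (- (q n * b n ^+ d * v))) @ \oo --> expR (- (l * v)).
  apply: continuous_cvg; first exact: continuous_expR.
  by apply: cvgN; apply: cvgM; [exact: qb_cvg|exact: cvg_cst].
(* [e] is fixed before [n] grows: enlarging the ball by [1 + e] must cost less than [delta] in the
   limit, and for this fixed [e] the tail term vanishes. *)
have [e e_0 he] : exists2 e : R, 0 < e & expR (- (l * v)) - delta < expR (- ((1 + e) ^+ d * (l * v))).
  have hc : (fun e : R => expR (- ((1 + e) ^+ d * (l * v)))) e @[e --> 0^'+] -->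
      expR (- ((1 + 0) ^+ d * (l * v))).
    apply: cvg_at_right_filter.
    apply: continuous_cvg; first exact: continuous_expR.
    apply: cvgN; apply: cvgM; last exact: cvg_cst.
    by apply: cvg_exprn; apply: cvgD; [exact: cvg_cst|exact: cvg_id].
  rewrite addr0 expr1n mul1r in hc.
  near (0 : R)^'+ => e; exists e; first by [].
  near: e; apply: (cvgr_gt _ hc).
  by rewrite ltrBlDr ltrDl.
have lo : (fun n => expR (- ((1 + e) ^+ d * (q n * b n ^+ d * v) + 2 * d%:R * (b n ^+ d *
      (n%:R * (moment_bound P Xd0 alpha / (e * r / (3 * d%:R * m%:R) * b n) `^ alpha) +
       expR 1 * (n%:R * (1 + moment_bound P Xd0 alpha) /
         (e * r / (3 * d%:R * m%:R) * b n) `^ t) ^+ m)) * v))) @ \oo -->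
    expR (- ((1 + e) ^+ d * (l * v) + 2 * d%:R * 0 * v)).
  apply: continuous_cvg; first exact: continuous_expR.
  apply: cvgN; apply: cvgD.
    by apply: cvgM; [exact: cvg_cst|apply: cvgM; [exact: qb_cvg|exact: cvg_cst]].
  apply: cvgM; last exact: cvg_cst.
  apply: cvgM; first exact: cvg_cst.
  apply: tail0; rewrite !mulr_gt0// invr_gt0 !mulr_gt0//.
  by rewrite ltr0n.
rewrite mulr0 mul0r addr0 in lo.
near=> n; rewrite ltr_distlC.
have xle : x n <= expR (- (q n * b n ^+ d * v)) by near: n.
have xge := near (x_ge e e_0) n.
apply/andP; split.
  apply: lt_le_trans (xge _) => //.
  near: n; exact: (cvgr_gt _ lo _ he).
apply: (le_lt_trans xle).
by near: n; apply: (cvgr_lt _ up); rewrite ltrDl.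
Unshelve. all: end_near. Qed.
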